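(* Let $A$ be an $m$-accretive operator of type $\omega\ge0$ on a Banach space $X$. For $h>0$, let $S^A$ and $S^{I+hA}$ be the semigroups generated by $-A$ and $-(I+hA)$, let $\mathcal{N}^A=(\|\cdot\|_X,|A\cdot|)$ and $\mathcal{N}^{I+hA}=(\|\cdot\|_X,|(I+hA)(\cdot)|)$ be the associated interpolation couples, with associated $K$-functions $K^A$, $K^{I+hA}$. Let $E$ be a Banach function space over $(0,\infty)$ on which the Hardy operator is bounded, and $\mathbf{E}=(E,E)$. Then for any $\tau,h>0$ with $\tau\omega<1$ and $h\omega<1$, \begin{align*} \mathrm{dom}\,A&\subseteq\Big\{x\in X: t\mapsto\tfrac{\|x-J_t^Ax\|_X}{t}\chi_{(0,\tau)}(t)\in E\Big\}\\ &=\Big\{x\in X: t\mapsto\tfrac{\|x-J_t^{I+hA}x\|_X}{t}\in E\Big\}\\ &=\Big\{x\in\overline{\mathrm{dom}\,A}: t\mapsto\tfrac{\|x-S^A(t)x\|_X}{t}\chi_{(0,\tau)}(t)\in E\Big\}\\ &=\Big\{x\in\overline{\mathrm{dom}\,A}: t\mapsto\tfrac{\|x-S^{I+hA}(t)x\|_X}{t}\chi_{(0,\tau)}(t)\in E\Big\}\\ &=\Big\{x\in X: t\mapsto\tfrac{K^A(x,t)}{t}\chi_{(0,\tau)}(t)\in E\Big\}=\mathrm{dom}\,(\mathcal{N}^A)_E^\tau\\ &=\Big\{x\in X: t\mapsto\tfrac{K^{I+hA}(x,t)}{t}\chi_{(0,\tau)}(t)\in E\Big\}=\mathrm{dom}\,(\mathcal{N}^{I+hA})_E^\tau\\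 &=\Big\{x\in X: t\mapsto\tfrac{K^{I+hA}(x,t)}{t}\in E\Big\}=\mathrm{dom}\,(\mathcal{N}^{I+hA})_E\\ &=\Big\{x\in X: t\mapsto\tfrac{\mathrm{d}}{\mathrm{d}t}\mathrm{Var}_{J_\cdot^Ax}(t)\,\chi_{(0,\tau)}(t)\in E\Big\}\\ &=\Big\{x\in X: t\mapsto\tfrac{\mathrm{d}}{\mathrm{d}t}\mathrm{Var}_{J_\cdot^{I+hA}x}(t)\in E\Big\}\\ &=\mathrm{dom}\,(\mathcal{N}^A)_{\mathbf{E}}^{L^0,\tau}=\mathrm{dom}\,(\mathcal{N}^A)_{\mathbf{E}}^{C,\tau}\\ &=\mathrm{dom}\,(\mathcal{N}^{I+hA})_{\mathbf{E}}^{L^0,\tau}=\mathrm{dom}\,(\mathcal{N}^{I+hA})_{\mathbf{E}}^{C,\tau}\\ &\subseteq\overline{\mathrm{dom}\,A}. \end{align*} If $X$ has the Radon–Nikodym property, then in addition $\mathrm{dom}\,(\mathcal{N}^A)_E^\tau=\mathrm{dom}\,(\mathcal{N}^A)_{\mathbf{E}}^{tr,\tau}$.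
   Context: A Banach function space over $(0,\infty)$ is a Banach space $E$ with $L^1\cap L^\infty(0,\infty)\subseteq E\subseteq L^1+L^\infty(0,\infty)$ such that for all $f,g\in L^1+L^\infty(0,\infty)$, $|g|\le|f|$ and $f\in E$ imply $g\in E$ and $\|g\|_E\le\|f\|_E$. Convention: $\|f\|_E=+\infty$ if $f\notin E$; products with $\chi_{(0,\tau)}$ are $0$ outside $(0,\tau)$. Hardy operator: $Pf(t)=\frac1t\int_0^tf(s)\,\mathrm{d}s$; bounded on $E$ means it maps $E$ boundedly into $E$. An operator (relation) $A\subseteq X\times X$ is accretive of type $\omega\in\mathbb{R}$ if $\|x-\hat x+\lambda(f-\hat f)\|_X\ge(1-\lambda\omega)\|x-\hat x\|_X$ for all $(x,f),(\hat x,\hat f)\in A$ and all $\lambda>0$ with $\lambda\omega<1$; it is $m$-accretive of type $\omega$ if moreover $\mathrm{ran}(I+\lambda A)=X$ for every such $\lambda$. If $h\omega<1$, then $I+hA$ is $m$-accretive of type $0$ and surjective. For $B\in\{A,I+hA\}$: $J_t^B=(I+tB)^{-1}$; $Bx=\{f:(x,f)\in B\}$; $|Bx|=\inf\{\|f\|_X:f\in Bx\}$ ($\inf\emptyset=\infty$); $\mathrm{dom}\,B=\{x:Bx\neq\emptyset\}$; $S^B$ is the strongly continuous semigroup on $\overline{\mathrm{dom}\,B}$ with $S^B(t)x=u(t)$, $u$ the unique mild solution of $\dot u+Bu\ni0$, $u(0)=x$ (Crandall–Liggett theorem). For $\mathcal{N}=(\mathcal{N}_0,\mathcal{N}_1)$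 a pair of functions $X\to[0,\infty]$: $K(x,t)=\inf\{\mathcal{N}_0(x-v)+t\mathcal{N}_1(v):v\in X\}$; $\mathcal{N}_E(x)=\|t\mapsto K(x,t)/t\|_E$; $\mathcal{N}_E^\tau(x)=\|t\mapsto\frac{K(x,t)}{t}\chi_{(0,\tau)}(t)\|_E$. For $G=L^0(0,\infty;X)$ (measurable functions; superscript $L^0$) or $G=C([0,\infty);X)$ (superscript $C$), \[\mathcal{N}_{\mathbf{E}}^{G,\tau}(x)=\inf\Big\{\Big\|t\mapsto\tfrac{\mathcal{N}_0(x-u(t))}{t}\chi_{(0,\tau)}(t)\Big\|_E+\|t\mapsto\mathcal{N}_1(u(t))\chi_{(0,\tau)}(t)\|_E:u\in G\Big\},\] \[\mathcal{N}_{\mathbf{E}}^{tr,\tau}(x)=\inf\big\{\|t\mapsto\mathcal{N}_0(\dot w(t))\chi_{(0,\tau)}(t)\|_E+\|t\mapsto\mathcal{N}_1(w(t))\chi_{(0,\tau)}(t)\|_E: w\in W^{1,1}_{loc}([0,\infty);X),\ w(0)=x\big\}.\] $\mathrm{dom}\,\mathcal{F}=\{x\in X:\mathcal{F}(x)<\infty\}$ for $\mathcal{F}:X\to[0,\infty]$. The variation function of $f$ is $\mathrm{Var}_f(t)=\sup\sum_i\|f(s_{i+1})-f(s_i)\|_X$, the supremum over all $0\le s_0\le\dots\le s_n\le t$; $\mathrm{Var}_{J^B_\cdot x}$ is the variation function of $\lambda\mapsto J^B_\lambda x$ (with $J^B_0x=x$), and $\frac{\mathrm{d}}{\mathrm{d}t}\mathrm{Var}_{J^B_\cdot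 x}$ is its derivative. $X$ has the Radon–Nikodym property if every absolutely continuous function $[0,\tau)\to X$ ($\tau<\infty$) lies in $W^{1,1}(0,\tau;X)$, i.e. admits a weak derivative in $L^1(0,\tau;X)$.
   Formalization: In the two variation sets, Var is also required finite and absolutely continuous from 0 (else false: X=ℝ, A the normal cone of [0,1], x=2); the E-norm of a possibly non-measurable t↦|Au(t)| is taken as the infimum of norms of its majorants in E. *)

(* Defs.v *)
From HB Require Import structures.
From mathcomp Require Import all_boot all_order all_algebra.
From mathcomp Require Import all_classical all_reals all_analysis.
From mathcomp Require Import measurable_realfun lra.

Set Implicit Arguments.
Unset Strict Implicit.
Unset Printing Implicit Defensive.

Import Order.TTheory GRing.Theory Num.Theory.
Import numFieldNormedType.Exports.

Local Open Scope classical_set_scope.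
Local Open Scope ring_scope.

(* Functions on (0,oo) are total functions on R; only their values at t > 0
   matter, and they are compared almost everywhere there. *)
Definition ae_pos (R : realType) (P : R -> Prop) : Prop :=
  {ae (@lebesgue_measure R), forall t, 0 < t -> P t}.

Lemma ae_posS (R : realType) (P Q : R -> Prop) :
  (forall t, 0 < t -> P t -> Q t) -> ae_pos P -> ae_pos Q.
Proof.
move=> PQ; apply: (@filterS _ _ (ae_filter_ringOfSetsType _)) => t Pt t0.
exact: PQ (Pt t0).
Qed.

Lemma ae_posI (R : realType) (P Q : R -> Prop) :
  ae_pos P -> ae_pos Q -> ae_pos (fun t => P t /\ Q t).
Proof.
apply: (@filterS2 _ _ (ae_filter_ringOfSetsType _)) => t Pt Qt t0.
by split; auto.
Qed.

Lemma ae_posW (R : realType) (P : R -> Prop) :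
  (forall t, 0 < t -> P t) -> ae_pos P.
Proof.
move=> PP; apply: (@filterE _ _ (ae_filter_ringOfSetsType _)).
exact: PP.
Qed.

(* f is (a representative of) an element of L^1 n L^oo (0,oo). *)
Definition L1_cap_Linf (R : realType) (f : R -> R) : Prop :=
  exists g : R -> R,
    [/\ (@lebesgue_measure R).-integrable `]0, +oo[ (EFin \o g),
        exists M : R, forall t, `|g t| <= M
      & ae_pos (fun t => f t = g t)].

(* f is (a representative of) an element of L^1 + L^oo (0,oo). *)
Definition L1_add_Linf (R : realType) (f : R -> R) : Prop :=
  exists g1 g2 : R -> R,
    [/\ (@lebesgue_measure R).-integrable `]0, +oo[ (EFin \o g1),
        measurable_fun (`]0, +oo[%classic : set R) g2,
        exists M : R, forall t, `|g2 t| <= M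
      & ae_pos (fun t => f t = g1 t + g2 t)].

(* A Banach function space is given by the set of all representatives of its
   elements: bfs_ideal makes bfs_car and bfs_norm invariant under equality
   almost everywhere. *)
Record banachFunctionSpace (R : realType) := BanachFunctionSpace {
  bfs_car : set (R -> R) ;
  bfs_norm : (R -> R) -> R ;
  bfs_L1_cap_Linf : forall f, L1_cap_Linf f -> bfs_car f ;
  bfs_L1_add_Linf : forall f, bfs_car f -> L1_add_Linf f ;
  bfs_ideal : forall f g, L1_add_Linf f -> L1_add_Linf g ->
    ae_pos (fun t => `|g t| <= `|f t|) -> bfs_car f ->
    bfs_car g /\ bfs_norm g <= bfs_norm f ;
  bfs_add : forall f g, bfs_car f -> bfs_car g ->
    bfs_car (f \+ g) /\ bfs_norm (f \+ g) <= bfs_norm f + bfs_norm g ;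
  bfs_scale : forall (a : R) f, bfs_car f ->
    bfs_car (a \*o f) /\ bfs_norm (a \*o f) = `|a| * bfs_norm f ;
  bfs_norm_ge0 : forall f, bfs_car f -> 0 <= bfs_norm f ;
  bfs_norm_eq0 : forall f, bfs_car f -> bfs_norm f = 0 ->
    ae_pos (fun t => f t = 0) ;
  bfs_complete : forall F : nat -> R -> R, (forall n, bfs_car (F n)) ->
    (forall eps : R, 0 < eps -> exists N : nat, forall m n, (N <= m)%N -> (N <= n)%N ->
       bfs_norm (F m \- F n) < eps) ->
    exists2 f, bfs_car f & (fun n => bfs_norm (F n \- f)) @ \oo --> 0
}.

Lemma clamp_le (R : realType) (a b c M : R) : `|c| <= M -> `|a| <= `|b + c| ->
  `|a - Num.max (- M) (Num.min M a)| <= `|b|.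
Proof.
move=> cM /le_trans/(_ (ler_normD b c)) abc.
have : `|a| <= `|b| + M by lra.
rewrite ler_norml => /andP[a1 a2]; rewrite ler_norml.
have b0 := normr_ge0 b; have c0 := normr_ge0 c.
have [Ma|Ma] := leP M a; last have [aM|aM] := leP (- M) a.
- by rewrite max_r; last lra; apply/andP; split; lra.
- by apply/andP; split; lra.
- by apply/andP; split; lra.
Qed.

Section FunctionSpaces.
Variables (R : realType) (E : banachFunctionSpace R).

Definition bfs_mem (f : R -> \bar R) : Prop :=
  exists2 g, bfs_car E g & ae_pos (fun t => f t = (g t)%:E).

(* The norm of E, extended to arbitrary functions (0,oo) -> [-oo,+oo]: it is
   the norm of E on the elements of E (bfs_enormE) and +oo on the measurable
   functions that are not in E (bfs_enorm_lty). It is needed, besides, on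
   compositions t |-> |A u(t)|, whose measurability is not guaranteed; such a
   function is measured by its majorants in E. *)
Definition bfs_enorm (f : R -> \bar R) : \bar R :=
  ereal_inf [set (bfs_norm E g)%:E | g in
    [set g | bfs_car E g /\ ae_pos (fun t => (`|f t| <= `|g t|%:E)%E)]].

Definition cutoff (tau : R) (f : R -> \bar R) : R -> \bar R :=
  fun t => if 0 < t < tau then f t else 0%E.

Definition hardy (f : R -> R) : R -> R :=
  fun t => t^-1 * (\int[@lebesgue_measure R]_(s in `]0, t[) f s)%R.

Definition hardy_bounded : Prop :=
  exists C : R, forall f, bfs_car E f ->
    bfs_car E (hardy f) /\ bfs_norm E (hardy f) <= C * bfs_norm E f.

Lemma bfs_enormE (f : R -> R) : bfs_car E f ->
  bfs_enorm (EFin \o f) = (bfs_norm E f)%:E.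
Proof.
move=> Ef; apply/eqP; rewrite eq_le; apply/andP; split.
  apply: ereal_inf_lbound; exists f => //; split=> //.
  by apply: ae_posW => t _ /=; rewrite lexx.
apply: le_ereal_inf_tmp => _ [g [Eg fg] <-]; rewrite lee_fin.
by have [] := bfs_ideal (bfs_L1_add_Linf Eg) (bfs_L1_add_Linf Ef) fg Eg.
Qed.

Lemma bfs_enorm_lty (f : R -> \bar R) :
    measurable_fun (`]0, +oo[%classic : set R) f ->
  (bfs_enorm f < +oo)%E <-> bfs_mem f.
Proof.
have mD : measurable (`]0, +oo[%classic : set R) by exact: measurable_itv.
move=> mf; split; last first.
  move=> [g Eg fg]; apply: le_lt_trans (ltry (bfs_norm E g)).
  apply: ereal_inf_lbound; exists g => //; split=> //.
  by apply: ae_posS fg => t _ ->; rewrite lexx.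
move=> /ereal_inf_lt[_ [g [Eg fg] _] _].
have fE : ae_pos (fun t => f t = (fine (f t))%:E).
  apply: ae_posS fg => t _ ft; rewrite fineK//.
  by rewrite -abse_fin_num ge0_fin_numE//; exact: le_lt_trans ft (ltry _).
exists (fine \o f) => //=.
have [g1 [g2 [ig1 mg2 [M gM] gE]]] := bfs_L1_add_Linf Eg.
have mf' : measurable_fun (`]0, +oo[%classic : set R) (fine \o f).
  exact: measurableT_comp.
pose f2 t := Num.max (- M) (Num.min M (fine (f t))).
have mf2 : measurable_fun (`]0, +oo[%classic : set R) f2.
  by apply: measurable_maxr => //; exact: measurable_minr.
pose f1 := (fine \o f) \- f2.
have M0 : 0 <= M by exact: le_trans (gM 0).
have mf1 : measurable_fun (`]0, +oo[%classic : set R) f1 by exact: measurable_funB.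
suff Lf : L1_add_Linf (fine \o f).
  have [] // := bfs_ideal (bfs_L1_add_Linf Eg) Lf _ Eg.
  apply: ae_posS (ae_posI fE fg) => t t0 [/= fEt].
  by rewrite fEt /= lee_fin.
exists f1, f2; split=> //.
- have /integrableP[mg1 ig1'] := ig1.
  apply/integrableP; split; first exact/measurable_EFinP.
  apply: le_lt_trans ig1'; apply: ae_ge0_le_integral => //=.
  + by apply/measurable_EFinP; exact: measurableT_comp.
  + by apply/measurable_EFinP; apply: measurableT_comp => //; exact/measurable_EFinP.
  have := ae_posI fE (ae_posI fg gE).
  apply: (@filterS _ _ (ae_filter_ringOfSetsType _)) => t; rewrite in_itv/= andbT.
  move=> /[apply] -[fEt [fgt gEt]].
  move: fgt (gM t); rewrite fEt gEt /= !lee_fin /f1 /f2 /=.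
  by move=> ft gM2; exact: clamp_le ft.
- exists M => t; rewrite /f2 ler_norml; apply/andP; split.
    by rewrite le_max lexx.
  by rewrite ge_max ge_min lexx /=; lra.
- by apply: ae_posW => t _; rewrite /f1 /= subrK.
Qed.

End FunctionSpaces.

Section VectorValued.
Variables (R : realType) (X : completeNormedModType R).
Notation mu := (@lebesgue_measure R).

Definition simple_fun (s : R -> X) : Prop :=
  finite_set (range s) /\ forall y, measurable (s @^-1` [set y]).

(* Bochner (strong) measurability *)
Definition strongly_measurable (D : set R) (u : R -> X) : Prop :=
  exists s : nat -> R -> X, (forall n, simple_fun (s n)) /\
    {ae mu, forall t, D t -> (fun n => s n t) @ \oo --> u t}.

Definition L1 (D : set R) (u : R -> X) : Prop :=
  strongly_measurable D u /\ (\int[mu]_(t in D) `|u t|%:E < +oo)%E.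

Definition simple_integral (D : set R) (s : R -> X) : X :=
  \sum_(y \in range s) fine (mu (D `&` s @^-1` [set y])) *: y.

(* u is Bochner integrable on D, with integral y *)
Definition has_bochner_integral (D : set R) (u : R -> X) (y : X) : Prop :=
  L1 D u /\
  exists s : nat -> R -> X,
    [/\ forall n, simple_fun (s n) /\ L1 D (s n),
        (fun n => \int[mu]_(t in D) `|u t - s n t|%:E)%E @ \oo --> 0%E
      & (fun n => simple_integral D (s n)) @ \oo --> y].

(* phi \in C_c^oo(D), for D open *)
Definition test_function (D : set R) (phi : R -> R) : Prop :=
  (forall n t, derivable (derive1n n phi) t 1) /\
  exists a b : R, `[a, b] `<=` D /\ forall t, t \notin `[a, b] -> phi t = 0.

Definition weak_derivative (D : set R) (w g : R -> X) : Prop :=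
  forall phi, test_function D phi -> exists y,
    has_bochner_integral D (fun t => derive1 phi t *: w t) y /\
    has_bochner_integral D (fun t => phi t *: g t) (- y).

(* w \in W^{1,1}(D;X), with weak derivative g *)
Definition W11 (D : set R) (w g : R -> X) : Prop :=
  [/\ L1 D w, L1 D g & weak_derivative D w g].

(* w is the continuous representative of an element of W^{1,1}_loc([0,oo);X),
   with weak derivative g; the continuity gives its meaning to w 0. *)
Definition W11loc (w g : R -> X) : Prop :=
  {within `[0, +oo[, continuous w} /\ forall T, 0 < T -> W11 `]0, T[ w g.

End VectorValued.

Definition abs_cont (R : realType) (V : normedModType R) (D : set R)
    (f : R -> V) : Prop :=
  forall eps : R, 0 < eps -> exists2 delta : R, 0 < delta &
    forall (n : nat) (a b : 'I_n -> R),
      (forall i, [/\ a i <= b i, D (a i) & D (b i)]) ->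
      (forall i j, i != j -> `]a i, b i[ `&` `]a j, b j[ = set0) ->
      \sum_i (b i - a i) < delta -> \sum_i `|f (b i) - f (a i)| < eps.

Definition radon_nikodym_property (R : realType) (X : completeNormedModType R)
    : Prop :=
  forall (tau : R) (f : R -> X), 0 < tau -> abs_cont `[0, tau[ f ->
    exists g, W11 `]0, tau[ f g.

Section Interpolation.
Variables (R : realType) (X : completeNormedModType R).
Variables (E : banachFunctionSpace R).

Definition edom (F : X -> \bar R) : set X := [set x | (F x < +oo)%E].

Definition functionals : Type := ((X -> \bar R) * (X -> \bar R))%type.

Implicit Type N : functionals.

Definition Kfun N (x : X) (t : R) : \bar R :=
  ereal_inf [set N.1 (x - v)%R + t%:E * N.2 v | v in [set: X]]%E.

Definition Kquot N (x : X) (t : R) : \bar R := (Kfun N x t * t^-1%:E)%E.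

Definition norm_K N (x : X) : \bar R := bfs_enorm E (Kquot N x).

Definition norm_Ktau N (tau : R) (x : X) : \bar R :=
  bfs_enorm E (cutoff tau (Kquot N x)).

Definition norm_mean (G : set (R -> X)) N (tau : R) (x : X) : \bar R :=
  ereal_inf [set
    bfs_enorm E (cutoff tau (fun t => N.1 (x - u t)%R * t^-1%:E)) +
    bfs_enorm E (cutoff tau (fun t => N.2 (u t))) | u in G]%E.

Definition norm_L0 := norm_mean [set u | strongly_measurable `]0, +oo[ u].

Definition norm_C :=
  norm_mean [set u : R -> X | {within `[0, +oo[, continuous u}].

Definition norm_tr N (tau : R) (x : X) : \bar R :=
  ereal_inf [set
    bfs_enorm E (cutoff tau (fun t => N.1 (p.2 t))) +
    bfs_enorm E (cutoff tau (fun t => N.2 (p.1 t))) | p in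
    [set p : (R -> X) * (R -> X) | W11loc p.1 p.2 /\ p.1 0%R = x]]%E.

End Interpolation.

Section Operators.
Variables (R : realType) (X : completeNormedModType R).
Implicit Types (A B : set (X * X)).

Definition accretive (omega : R) A : Prop :=
  forall x f y g, A (x, f) -> A (y, g) ->
    forall lambda : R, 0 < lambda -> lambda * omega < 1 ->
      (1 - lambda * omega) * `|x - y| <= `|x - y + lambda *: (f - g)|.

Definition m_accretive (omega : R) A : Prop :=
  accretive omega A /\
  forall lambda : R, 0 < lambda -> lambda * omega < 1 ->
    forall z, exists x f, A (x, f) /\ x + lambda *: f = z.

Definition op_dom A : set X := [set x | exists f, A (x, f)].

Definition op_id_add (h : R) A : set (X * X) :=
  [set (p.1, p.1 + h *: p.2) | p in A].

(* |B x| *)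
Definition op_abs B (x : X) : \bar R :=
  ereal_inf [set `|f|%:E | f in [set f | B (x, f)]].

Definition op_couple B : functionals X := (fun x : X => `|x|%:E, op_abs B).

(* J_t^B x; for m-accretive B of type omega and t omega < 1 there is exactly
   one y as in the set below *)
Definition resolvent B (t : R) (x : X) : X :=
  if t == 0 then x else xget x [set y | exists2 f, B (y, f) & y + t *: f = x].

(* an implicit Euler scheme of mesh and error eps on [0,T], with nodes t i,
   for u' + B u \ni 0 *)
Definition euler_scheme B (T eps : R) (n : nat) (t : nat -> R)
    (v f : nat -> X) : Prop :=
  [/\ t 0%N = 0, T - eps < t n <= T,
      forall i, (i < n)%N -> 0 < t i.+1 - t i < eps,
      \sum_(i < n) (t i.+1 - t i) * `|f i.+1| < eps
    & forall i, (i < n)%N ->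
        B (v i.+1, f i.+1 - (t i.+1 - t i)^-1 *: (v i.+1 - v i))].

Definition mild_solution B (x : X) (u : R -> X) : Prop :=
  [/\ {within `[0, +oo[, continuous u}, u 0 = x
    & forall T eps : R, 0 < T -> 0 < eps -> exists n t v f,
        [/\ euler_scheme B T eps n t v f, `|u 0 - v 0%N| <= eps
          & forall i s, (i < n)%N -> t i < s <= t i.+1 ->
              `|u s - v i.+1| <= eps]].

(* S^B(t)x; by the Crandall-Liggett theorem, for m-accretive B and x in the
   closure of the domain there is, on [0,oo), exactly one mild solution *)
Definition semigroup B (t : R) (x : X) : X :=
  xget (fun _ => x) [set u | mild_solution B x u] t.

Definition variation (f : R -> X) (t : R) : \bar R :=
  ereal_sup [set r | exists (n : nat) (s : nat -> R),
    [/\ 0 <= s 0%N, forall i, (i < n)%N -> s i <= s i.+1, s n <= t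
      & r = (\sum_(i < n) `|f (s i.+1) - f (s i)|)%:E]].

Definition Var_resolvent B (x : X) : R -> \bar R :=
  variation (fun lambda => resolvent B lambda x).

(* V is finite and absolutely continuous on [0,T), which is what makes derive1 V
   the derivative of V there, also as a weak derivative, without a singular
   part (for instance a jump at 0) being lost. *)
Definition fin_abs_cont (T : R) (V : R -> \bar R) : Prop :=
  (forall t, 0 <= t < T -> V t \is a fin_num) /\
  abs_cont `[0, T[ (fine \o V : R -> R^o).

Definition Var_derivative B (x : X) (t : R) : \bar R :=
  (derive1 (fine \o Var_resolvent B x : R -> R^o) t)%:E.

End Operators.

(* Main.v *)
(* Every condition is compared, for a single operator of type omega and on
   (0,tau), with the membership in E of the nonincreasing function K(x,t)/t.

   Accretivity gives K(x,t)/t <= 2|x - J_t x|/t <= C K(x,t)/t, so the resolvent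
   curve is an almost optimal choice of v in the K-functional, and, extended
   by the constant J_tau x, of the function u in the mean and trace methods.
   For the semigroup, the resolvent bounds |x - S(t)x| by the contraction
   estimate, and conversely |x - J_t x| is bounded by |x - S(t)x| plus the mean
   of |x - S(s)x| over (0,t), which the Hardy operator controls. The resolvent
   identity bounds |J_t x - J_s x| by C (t - s) K(x,t)/t, whence the bounds on
   the derivative of the variation; conversely |x - J_t x|/t is at most the mean
   over (0,t) of that derivative.

   For the trace method, testing the weak derivative g of w with smooth plateau
   functions shows that |w(b) - w(a) - (b - a) y| is at most the integral of
   |g - y| over (a,b). With y = 0 this and the Hardy operator bound K(x,t)/t;
   with y in a countable set whose closure contains almost every g(t), the
   Lebesgue differentiation theorem shows that the difference quotients of w
   converge to g almost everywhere, so that the derivative of the resolvent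
   curve, which the Radon-Nikodym property provides on each bounded interval, is
   globally defined and dominated by C K(x,t)/t.

   Passing from A to I + hA changes K(x,t)/t on (0,tau) by a factor and a
   constant, and K(x,t)/t for I + hA is O(1/t) at infinity; the Hardy operator
   puts 1/t on (tau,oo) into E. *)

(* Because K(x,t)/t is nonincreasing, it is measurable at once, and if it lies in E it is integrable
   near 0; hence K(x,t) and |x - J_t x| tend to 0. This gives continuity of the resolvent curve at 0
   and membership in the closure of the domain.

   [semigroup] is a choice among mild solutions: existence is established by the Crandall-Liggett
   estimate, and the bounds on S(t)x are derived for an arbitrary mild solution, along its Euler
   schemes.

   The variation is Lipschitz on [a,b] for a > 0, with a constant that may explode as a tends to 0.
   Its density on [a,b] comes from the Radon-Nikodym theorem for Stieltjes measures; absolute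
   continuity then lets a tend to 0.

   A Bochner integral is known only through approximating simple functions, so two of them are
   compared on common finite partitions.

   Constants: (1 - tau omega)^-1 bounds 1/(1 - t omega) on (0,tau), whereas I + hA is taken with
   type 0 and constant 1 on all of (0,oo). *)
Require Import Defs.
From HB Require Import structures.
From mathcomp Require Import all_boot all_order all_algebra.
From mathcomp Require Import all_classical all_reals all_analysis.
From mathcomp Require Import measurable_realfun lra ring.

Set Implicit Arguments.
Unset Strict Implicit.
Unset Printing Implicit Defensive.

Import Order.TTheory GRing.Theory Num.Theory.
Import numFieldNormedType.Exports.

Local Open Scope classical_set_scope.
Local Open Scope ring_scope.

(* Instance resolution does not find the filter of the complements of the null sets. *)
Local Notation ae_filterS :=
  (@filterS _ _ (ae_filter_ringOfSetsType (@lebesgue_measure _))).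
Local Notation ae_filterI :=
  (@filterI _ _ (ae_filter_ringOfSetsType (@lebesgue_measure _)) _ _).

(* [module] reduces an identity between linear combinations of vectors to the
   identities between their coefficients. *)
Inductive lexpr (K : Type) :=
  LVar of nat | LZero | LAdd of lexpr K & lexpr K | LOpp of lexpr K
| LScale of K & lexpr K.
Arguments LVar {K}. Arguments LZero {K}.

Section LinearReflection.
Variables (K : pzRingType) (V : lmodType K).

Fixpoint lden (env : seq V) (e : lexpr K) : V :=
  match e with
  | LVar i => nth 0 env i
  | LZero => 0
  | LAdd e1 e2 => lden env e1 + lden env e2
  | LOpp e1 => - lden env e1
  | LScale a e1 => a *: lden env e1
  end.

(** [Nat.eqb] lets [cbn] in [lcoefs] decide the comparisons of indices. *)
Fixpoint lcoef (e : lexpr K) (i : nat) : K :=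
  match e with
  | LVar j => if Nat.eqb j i then 1 else 0
  | LZero => 0
  | LAdd e1 e2 => lcoef e1 i + lcoef e2 i
  | LOpp e1 => - lcoef e1 i
  | LScale a e1 => a * lcoef e1 i
  end.

Lemma ldenE env e : lden env e = \sum_(i < size env) lcoef e i *: nth 0 env i.
Proof.
elim: e => [j||e1 IH1 e2 IH2|e1 IH1|a e1 IH1] /=.
- have [js|js] := ltnP j (size env); last first.
    rewrite nth_default// big1// => i _.
    case: PeanoNat.Nat.eqb_spec => [ji|]; last by rewrite scale0r.
    by move: js; rewrite ji leqNgt ltn_ord.
  rewrite (bigD1 (Ordinal js))//= PeanoNat.Nat.eqb_refl scale1r big1 ?addr0// => i.
  case: PeanoNat.Nat.eqb_spec => [ji /negP[]|]; last by rewrite scale0r.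
  by apply/eqP/val_inj; rewrite /= ji.
- by rewrite big1// => i _; rewrite scale0r.
- by rewrite IH1 IH2 -big_split; apply: eq_bigr => i _; rewrite scalerDl.
- by rewrite IH1 -sumrN; apply: eq_bigr => i _; rewrite scaleNr.
- by rewrite IH1 scaler_sumr; apply: eq_bigr => i _; rewrite scalerA.
Qed.

(** A recursive conjunction instead of a bounded quantifier: it unfolds to one coefficient equation
    per vector, which [repeat split] separates. *)
Fixpoint lagree (e1 e2 : lexpr K) (n : nat) : Prop :=
  if n is n'.+1 then lagree e1 e2 n' /\ lcoef e1 n' = lcoef e2 n' else True.

Lemma lden_eq env e1 e2 : lagree e1 e2 (size env) -> lden env e1 = lden env e2.
Proof.
move=> e12; rewrite !ldenE; apply: eq_bigr => -[i /= ilt] _; congr *:%R.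
elim: (size env) e12 ilt => // n IH [+ en].
by rewrite ltnS leq_eqVlt => /IH{}IH /orP[/eqP->|].
Qed.

End LinearReflection.

Ltac lmem v env :=
  match env with
  | nil => constr:(false)
  | cons v _ => constr:(true)
  | cons _ ?env' => lmem v env'
  end.
Ltac lindex v env :=
  match env with
  | cons v _ => constr:(O)
  | cons _ ?env' => let i := lindex v env' in constr:(S i)
  end.
Ltac lvars V env t :=
  match t with
  | @GRing.add _ ?a ?b => let env1 := lvars V env a in lvars V env1 b
  | @GRing.opp _ ?a => lvars V env a
  | @GRing.scale _ _ _ ?a => lvars V env a
  | @GRing.zero _ => env
  | ?v => let b := lmem v env in
      match b with true => env | false => constr:(@cons V v env) end
  end.
Ltac lreify K env t :=
  match t with
  | @GRing.add _ ?a ?b =>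
      let ea := lreify K env a in let eb := lreify K env b in
      constr:(@LAdd K ea eb)
  | @GRing.opp _ ?a => let ea := lreify K env a in constr:(@LOpp K ea)
  | @GRing.scale _ _ ?k ?a =>
      let ea := lreify K env a in constr:(@LScale K k ea)
  | @GRing.zero _ => constr:(@LZero K)
  | ?v => let i := lindex v env in constr:(@LVar K i)
  end.
(** Leaves the coefficient equations as goals, for [field] when they contain inverses; [module]
    finishes with [ring]. *)
Ltac lcoefs K V :=
  match goal with
  | |- ?a = ?b :> ?T =>
    let env := lvars T (@nil T) a in
    let env := lvars T env b in
    let ea := lreify K env a in
    let eb := lreify K env b in
    refine (@lden_eq K V env ea eb _); cbn [lagree lcoef size Nat.eqb];
    repeat split
  end.
Ltac module K V := lcoefs K V; try ring.

(** * Resolvents of an m-accretive operator *)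

Section Resolvent.
Variables (R : realType) (X : completeNormedModType R).
Implicit Types (A : set (X * X)) (omega t s : R) (x y v f : X).

Lemma resolventP A omega t x : m_accretive omega A -> 0 < t -> t * omega < 1 ->
  A (resolvent A t x, t^-1 *: (x - resolvent A t x)).
Proof.
move=> [_ /(_ t)] + t0 tw; move=> /(_ t0 tw x)[y [f [Ayf yf]]].
rewrite /resolvent gt_eqF//.
case: xgetP => [z _ [g Azg <-]|/(_ y)[]]; last by exists f.
by rewrite addrC addKr scalerA mulVf ?gt_eqF// scale1r.
Qed.

Lemma resolvent0 A x : resolvent A 0 x = x.
Proof. by rewrite /resolvent eqxx. Qed.

(** Accretivity between the pair of [resolventP] and an arbitrary (v,f). Contraction, uniqueness and
    the bound by the K-functional are all read off from it. *)
Lemma accretive_resolvent A omega t x v f : m_accretive omega A ->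
  0 < t -> t * omega < 1 -> A (v, f) ->
  (1 - t * omega) * `|resolvent A t x - v| <= `|x - v - t *: f|.
Proof.
move=> mA t0 tw Avf; have [acc _] := mA.
apply: le_trans (acc _ _ _ _ (resolventP x mA t0 tw) Avf _ t0 tw) _.
rewrite scalerBr scalerA mulfV ?gt_eqF// scale1r.
suff -> : resolvent A t x - v + (x - resolvent A t x - t *: f) = x - v - t *: f by [].
by module R X.
Qed.

Lemma resolvent_lipschitz A omega t x y : m_accretive omega A ->
  0 < t -> t * omega < 1 ->
  (1 - t * omega) * `|resolvent A t x - resolvent A t y| <= `|x - y|.
Proof.
move=> mA t0 tw.
apply: le_trans (accretive_resolvent x mA t0 tw (resolventP y mA t0 tw)) _.
rewrite scalerA mulfV ?gt_eqF// scale1r.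
suff -> : x - resolvent A t y - (y - resolvent A t y) = x - y by [].
by module R X.
Qed.

Lemma resolvent_unique A omega t v f : m_accretive omega A ->
  0 < t -> t * omega < 1 -> A (v, f) -> resolvent A t (v + t *: f) = v.
Proof.
move=> mA t0 tw Avf; apply/eqP; rewrite -subr_eq0 -normr_le0.
have := accretive_resolvent (v + t *: f) mA t0 tw Avf.
by rewrite (addrC v) addrK addrN normr0 pmulr_rle0// subr_gt0.
Qed.

(** The pair (J_t x, (x - J_t x)/t) of [A] also solves a resolvent equation with step [s], whose
    right-hand side is the convex combination (for s <= t) of x and J_t x. *)
Lemma resolvent_identity A omega s t x : m_accretive omega A ->
  0 < s -> 0 < t -> s * omega < 1 -> t * omega < 1 ->
  resolvent A t x =
  resolvent A s ((s / t) *: x + (1 - s / t) *: resolvent A t x).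
Proof.
move=> mA s0 t0 sw tw.
rewrite -[LHS](resolvent_unique mA s0 sw (resolventP x mA t0 tw)).
congr resolvent; rewrite scalerA; module R X.
Qed.

(** By the resolvent identity both terms are values of J_s, at points that differ by (1 - s/t)(x -
    J_t x). *)
Lemma resolvent_diff_le A omega s t x : m_accretive omega A ->
  0 < s -> s <= t -> s * omega < 1 -> t * omega < 1 ->
  (1 - s * omega) * `|resolvent A t x - resolvent A s x| <=
  (t - s) * (`|x - resolvent A t x| / t).
Proof.
move=> mA s0 st sw tw; have t0 := lt_le_trans s0 st.
rewrite {1}(resolvent_identity x mA s0 t0 sw tw).
apply: le_trans (resolvent_lipschitz _ _ mA s0 sw) _.
have -> : (s / t) *: x + (1 - s / t) *: resolvent A t x - x =
    - ((1 - s / t) *: (x - resolvent A t x)).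
  by module R X.
rewrite normrN normrZ ger0_norm; last by rewrite subr_ge0 ler_pdivrMr ?mul1r.
by rewrite mulrA mulrAC; apply: ler_wpM2r => //; rewrite mulrBl divff ?gt_eqF.
Qed.

(* [id + h A] is accretive of type [h omega - 1]; only type [0] is used. *)
Lemma m_accretive_id_add A omega h : m_accretive omega A -> 0 < h ->
  h * omega < 1 -> m_accretive 0 (op_id_add h A).
Proof.
move=> [acc ran] h0 hw; split.
  move=> _ _ _ _ [[x f] Axf [<- <-]] [[y g] Ayg [<- <-]] l l0 _ /=.
  rewrite mulr0 subr0 mul1r.
  have l1 : 0 < 1 + l by lra.
  (* x + l (x + h f) = (1 + l) (x + m f) with m = l h / (1 + l): a resolvent problem of step [l] for
     I + hA is one of step m for A. As m < h, the condition m omega < 1 holds for every [l]. *)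
  have m0 : 0 < l * h / (1 + l) by rewrite divr_gt0// mulr_gt0.
  have mw : l * h / (1 + l) * omega < 1.
    by rewrite mulrAC ltr_pdivrMr// mul1r -mulrA; nra.
  have := acc _ _ _ _ Axf Ayg _ m0 mw.
  rewrite -(ler_pM2l l1) -{3}(ger0_norm (ltW l1)) -normrZ scalerDr scalerA.
  rewrite (_ : (1 + l) * (l * h / (1 + l)) = l * h); last by field; rewrite gt_eqF.
  have -> : (1 + l) *: (x - y) + l * h *: (f - g) =
      x - y + l *: (x + h *: f - (y + h *: g)).
    by module R X.
  apply: le_trans.
  rewrite mulrA -{1}[X in X <= _]mul1r; apply: ler_wpM2r => //.
  rewrite mulrBr mulr1.
  rewrite (_ : (1 + l) * (l * h / (1 + l) * omega) = l * (h * omega)); first by nra.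
  by field; rewrite gt_eqF.
move=> l l0 _ z.
have l1 : 0 < 1 + l by lra.
have m0 : 0 < l * h / (1 + l) by rewrite divr_gt0// mulr_gt0.
have mw : l * h / (1 + l) * omega < 1.
  by rewrite mulrAC ltr_pdivrMr// mul1r -mulrA; nra.
have [x [f [Axf xf]]] := ran _ m0 mw ((1 + l)^-1 *: z).
exists x, (x + h *: f); split; first by exists (x, f).
rewrite -[RHS]scale1r -(mulfV (lt0r_neq0 l1)) -scalerA -xf.
by lcoefs R X; field; rewrite gt_eqF.
Qed.

Lemma op_dom_id_add A h : op_dom (op_id_add h A) = op_dom A.
Proof.
apply/seteqP; split=> x [f]; first by case=> -[y g] Ayg [<- _]; exists g.
by move=> Axf; exists (x + h *: f), (x, f).
Qed.

End Resolvent.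

(** * The K-functional of an operator *)

Section KFunctional.
Variables (R : realType) (X : completeNormedModType R).
Implicit Types (A : set (X * X)) (omega t s : R) (x y v f : X).

(** The infimum over [v] and the one defining [op_abs A v] merge into an infimum over the pairs of
    [A]; outside the domain [op_abs] is +oo. *)
Lemma Kfun_op_ge A x t (a : R) : 0 < t ->
  (forall v f, A (v, f) -> a <= `|x - v| + t * `|f|) ->
  (a%:E <= Kfun (op_couple A) x t)%E.
Proof.
move=> t0 Aa; apply: le_ereal_inf_tmp => _ [v _ <-] /=.
have : (((a - `|x - v|) / t)%:E <= op_abs A v)%E.
  apply: le_ereal_inf_tmp => _ [f Avf <-]; rewrite lee_fin ler_pdivrMr//.
  by rewrite lerBlDl mulrC; exact: Aa.
rewrite -(@lee_pmul2l _ t%:E) ?fin_numE ?lte_fin// -EFinM => /(leeD2l `|x - v|%:E).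
by rewrite -EFinD mulrCA divff ?gt_eqF// mulr1 addrC subrK.
Qed.

Lemma Kfun_op_le A x t v f : 0 < t -> A (v, f) ->
  (Kfun (op_couple A) x t <= (`|x - v| + t * `|f|)%:E)%E.
Proof.
move=> t0 Avf; apply: (@le_trans _ _ (`|x - v|%:E + t%:E * op_abs A v)%E).
  by apply: ereal_inf_lbound; exists v.
rewrite EFinD EFinM leeD2l// lee_pmul2l ?fin_numE ?lte_fin//.
by apply: ereal_inf_lbound; exists f.
Qed.

(** A real-valued [Kquot], equal to it for t > 0 as soon as the domain is nonempty ([kquotE]), so
    that real arithmetic applies. *)
Definition kquot A x t : R := fine (Kfun (op_couple A) x t) / t.

Lemma Kfun_fin A x t : op_dom A !=set0 -> 0 < t ->
  Kfun (op_couple A) x t \is a fin_num.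
Proof.
move=> [v [f Avf]] t0; rewrite ge0_fin_numE; last first.
  by apply: Kfun_op_ge => // *; rewrite addr_ge0// mulr_ge0// ltW.
exact: le_lt_trans (Kfun_op_le x t0 Avf) (ltry _).
Qed.

Lemma kquotE A x t : op_dom A !=set0 -> 0 < t ->
  Kquot (op_couple A) x t = (kquot A x t)%:E.
Proof.
by move=> A0 t0; rewrite /Kquot /kquot EFinM fineK//; exact: Kfun_fin.
Qed.

Lemma kquot_le A x t v f : op_dom A !=set0 -> 0 < t -> A (v, f) ->
  kquot A x t <= `|x - v| / t + `|f|.
Proof.
move=> A0 t0 Avf; rewrite /kquot ler_pdivrMr// mulrDl mulrAC -mulrA divff ?gt_eqF//.
by rewrite mulr1 (mulrC `|f|) -lee_fin fineK ?Kfun_fin//; exact: Kfun_op_le.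
Qed.

Lemma kquot_ge A x t a : op_dom A !=set0 -> 0 < t ->
  (forall v f, A (v, f) -> a <= `|x - v| / t + `|f|) -> a <= kquot A x t.
Proof.
move=> A0 t0 Aa; rewrite /kquot ler_pdivlMr// -lee_fin fineK ?Kfun_fin//.
apply: Kfun_op_ge => // v f /Aa; rewrite -(ler_pM2r t0) mulrDl.
by rewrite mulrAC -mulrA divff ?gt_eqF// mulr1 (mulrC `|f|).
Qed.

Lemma kquot_ge0 A x t : op_dom A !=set0 -> 0 < t -> 0 <= kquot A x t.
Proof.
by move=> A0 t0; apply: kquot_ge => // *; rewrite addr_ge0// divr_ge0// ltW.
Qed.

(** Each competitor |x - v|/t + |f| is nonincreasing in [t]. *)
Lemma kquot_nincr A x s t : op_dom A !=set0 -> 0 < s -> s <= t ->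
  kquot A x t <= kquot A x s.
Proof.
move=> A0 s0 st; have t0 := lt_le_trans s0 st.
apply: kquot_ge => // v f Avf; apply: le_trans (kquot_le x A0 t0 Avf) _.
by rewrite lerD2r ler_wpM2l// lef_pV2.
Qed.

Section Resolvent.
Variables (A : set (X * X)) (omega t : R) (x : X).
Hypotheses (w0 : 0 <= omega) (mA : m_accretive omega A).
Hypotheses (t0 : 0 < t) (tw : t * omega < 1).

Lemma op_dom_neq0 : op_dom A !=set0.
Proof. by exists (resolvent A t x), (t^-1 *: (x - resolvent A t x)); exact: resolventP tw. Qed.

(** With v = J_t x the two terms of the K-functional are equal, whence the factor 2. *)
Lemma kquot_le_resolvent : kquot A x t <= 2 * (`|x - resolvent A t x| / t).
Proof.
apply: le_trans (kquot_le x op_dom_neq0 t0 (resolventP x mA t0 tw)) _.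
by rewrite normrZ gtr0_norm ?invr_gt0//; lra.
Qed.

(** |x - J_t x| <= |x - v| + |J_t x - v|, where accretivity bounds the second term by c (|x - v| + t
    |f|). The constant [c] is a parameter so that one value serves a whole interval of [t]; omega >=
    0 forces c >= 1, which absorbs the first term. *)
Lemma resolvent_le c v f : 1 <= c * (1 - t * omega) -> A (v, f) ->
  `|x - resolvent A t x| <= 2 * c * (`|x - v| + t * `|f|).
Proof.
move=> c1 Avf.
have tw0 : 0 < 1 - t * omega by rewrite subr_gt0.
have c0 : 0 < c by rewrite -(pmulr_lgt0 _ tw0) (lt_le_trans _ c1).
have cge1 : 1 <= c.
  have := mulr_ge0 (ltW c0) (mulr_ge0 (ltW t0) w0); lra.
have := accretive_resolvent x mA t0 tw Avf.
move=> /le_trans/(_ (ler_normB _ _)); rewrite normrZ (gtr0_norm t0) => J1.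
have J2 : `|resolvent A t x - v| <= c * (`|x - v| + t * `|f|).
  rewrite -(ler_pM2l tw0); apply: le_trans J1 _.
  by rewrite mulrA (mulrC _ c) ler_peMl// addr_ge0// mulr_ge0// ltW.
have : `|x - resolvent A t x| <= `|x - v| + `|resolvent A t x - v|.
  rewrite (distrC (resolvent A t x)); apply: le_trans (ler_normD _ _).
  by rewrite addrA subrK.
have : `|x - v| <= c * (`|x - v| + t * `|f|).
  have f0 := mulr_ge0 (ltW t0) (normr_ge0 f).
  by rewrite mulrDr; have := ler_wpM2r (normr_ge0 (x - v)) cge1; nra.
lra.
Qed.

Lemma resolvent_le_kquot c : 1 <= c * (1 - t * omega) ->
  `|x - resolvent A t x| / t <= 2 * c * kquot A x t.
Proof.
move=> c1.
have tw0 : 0 < 1 - t * omega by rewrite subr_gt0.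
have c0 : 0 < 2 * c by rewrite mulr_gt0// -(pmulr_lgt0 _ tw0) (lt_le_trans _ c1).
rewrite -ler_pdivrMl//; apply: kquot_ge => //; first exact: op_dom_neq0.
move=> v f Avf; rewrite ler_pdivrMl// ler_pdivrMr//.
apply: le_trans (resolvent_le c1 Avf) _.
by rewrite -[leRHS]mulrA (mulrDl _ _ t) mulfVK ?gt_eqF// (mulrC _ t).
Qed.

End Resolvent.

(** The pair (v, v + h f) competes for I + hA. The extra |v| is at most |x| + |x - v|, and |x - v|
    <= T |x - v|/t, so the norm of x only enters as an additive constant. *)
Lemma kquot_id_add_le A h x t T : op_dom A !=set0 -> 0 < h -> 0 < t -> t <= T ->
  kquot (op_id_add h A) x t <= (1 + T + h) * kquot A x t + `|x|.
Proof.
move=> A0 h0 t0 tT.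
have B0 : op_dom (op_id_add h A) !=set0 by rewrite op_dom_id_add.
have C0 : 0 < 1 + T + h by lra.
rewrite -lerBlDr -ler_pdivrMl//; apply: kquot_ge => // v f Avf.
rewrite ler_pdivrMl// lerBlDr.
have Bvf : op_id_add h A (v, v + h *: f) by exists (v, f).
apply: le_trans (kquot_le x B0 t0 Bvf) _.
have vx : `|v| <= `|x - v| + `|x|.
  by rewrite (distrC x); apply: le_trans (ler_normD _ _); rewrite subrK.
have xvt : `|x - v| <= T * (`|x - v| / t).
  by rewrite mulrCA ler_peMr// ler_pdivlMr// mul1r.
have := ler_normD v (h *: f); rewrite normrZ (gtr0_norm h0).
have q0 : 0 <= `|x - v| / t by rewrite divr_ge0// ltW.
have f0 := normr_ge0 f.
have : 0 <= h * (`|x - v| / t) by rewrite mulr_ge0// ltW.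
have : 0 <= (1 + T) * `|f| by rewrite mulr_ge0//; lra.
move: (`|x - v| / t) xvt q0 => q; nra.
Qed.

(** Conversely h |f| <= |v + h f| + |v|, and |v| is estimated through |x| and T |x - v|/t as
    before. *)
Lemma kquot_le_id_add A h x t T : op_dom A !=set0 -> 0 < h -> 0 < t -> t <= T ->
  kquot A x t <= (1 + (T + 1) / h) * kquot (op_id_add h A) x t + `|x| / h.
Proof.
move=> A0 h0 t0 tT.
have B0 : op_dom (op_id_add h A) !=set0 by rewrite op_dom_id_add.
have C0 : 0 < 1 + (T + 1) / h.
  by rewrite addr_gt0// divr_gt0//; lra.
rewrite -lerBlDr -ler_pdivrMl//; apply: kquot_ge => // _ _ [[v f] Avf [<- <-]] /=.
rewrite ler_pdivrMl// lerBlDr.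
apply: le_trans (kquot_le x A0 t0 Avf) _.
have vx : `|v| <= `|x - v| + `|x|.
  by rewrite (distrC x); apply: le_trans (ler_normD _ _); rewrite subrK.
have xvt : `|x - v| <= T * (`|x - v| / t).
  by rewrite mulrCA ler_peMr// ler_pdivlMr// mul1r.
have hf : h * `|f| <= `|v + h *: f| + `|v|.
  rewrite -{1}(gtr0_norm h0) -normrZ (addrC v).
  by apply: le_trans (ler_normB _ _); rewrite addrK.
have q0 : 0 <= `|x - v| / t by rewrite divr_ge0// ltW.
have g0 := normr_ge0 (v + h *: f).
rewrite -(ler_pM2l h0).
have -> : h * ((1 + (T + 1) / h) * (`|x - v| / t + `|v + h *: f|) + `|x| / h) =
    (h + T + 1) * (`|x - v| / t + `|v + h *: f|) + `|x|.
  by field; rewrite !gt_eqF.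
have : 0 <= h * `|v + h *: f| by rewrite mulr_ge0// ltW.
have : 0 <= T * `|v + h *: f| by rewrite mulr_ge0//; lra.
have f0 := normr_ge0 f.
move: (`|x - v| / t) (`|v + h *: f|) xvt q0 g0 hf => q g; nra.
Qed.

(** J_h 0 is a zero of I + hA; as a competitor it leaves only the first term of the K-functional. *)
Lemma kquot_id_add_infty A h omega x t : m_accretive omega A -> 0 < h ->
  h * omega < 1 -> 0 < t ->
  kquot (op_id_add h A) x t <= `|x - resolvent A h 0| / t.
Proof.
move=> mA h0 hw t0; have A0 := op_dom_neq0 0 mA h0 hw.
have B0 : op_dom (op_id_add h A) !=set0 by rewrite op_dom_id_add.
have Bv : op_id_add h A (resolvent A h 0, 0).
  exists (resolvent A h 0, h^-1 *: (0 - resolvent A h 0)); first exact: resolventP hw.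
  congr pair; rewrite /= scalerA mulfV ?gt_eqF// scale1r.
  by module R X.
by apply: le_trans (kquot_le x B0 t0 Bv) _; rewrite normr0 addr0.
Qed.

End KFunctional.

(** * Banach function spaces *)

Section BoundedIntegrable.
Variable R : realType.
Notation mu := (@lebesgue_measure R).

Lemma itv_measure_lty ba (a : R) bb (b : R) :
  (mu [set` Interval (BSide ba a) (BSide bb b)] < +oo)%E.
Proof. by rewrite /= lebesgue_measure_itv/=; case: ifP => _; rewrite ?ltry. Qed.

Lemma bounded_integrable (D : set R) (f : R -> R) (C : R) : measurable D ->
  (mu D < +oo)%E -> measurable_fun D f -> (forall t, D t -> `|f t| <= C) ->
  mu.-integrable D (EFin \o f).
Proof.
move=> mD Dfin mf fC; apply: (@le_integrable _ _ _ mu D mD _ (EFin \o cst C)) => /=.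
- exact/measurable_EFinP.
- by move=> t Dt /=; rewrite lee_fin (le_trans (fC t Dt))// ler_norm.
- apply/integrableP; split; first exact/measurableT_comp.
  rewrite /= (integral_cst mu mD `|C|%:E) /=.
  by rewrite lte_mul_pinfty.
Qed.

Lemma itv_integrable_cst ba (a : R) bb (b k : R) :
  mu.-integrable [set` Interval (BSide ba a) (BSide bb b)] (EFin \o (fun=> k)).
Proof.
apply: (bounded_integrable (C := `|k|)) => //; exact: itv_measure_lty.
Qed.

End BoundedIntegrable.

Section FunctionSpace.
Variables (R : realType) (E : banachFunctionSpace R).
Notation mu := (@lebesgue_measure R).
Notation pos := (`]0, +oo[%classic : set R).
Implicit Types (f g : R -> R) (S : set R).

Lemma bfs_car_ae f g : ae_pos (fun t => f t = g t) -> bfs_car E f -> bfs_car E g.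
Proof.
move=> fg Ef; have [g1 [g2 [ig1 mg2 Mg2 fE]]] := bfs_L1_add_Linf Ef.
have Lg : L1_add_Linf g.
  exists g1, g2; split=> //.
  by apply: ae_posS (ae_posI fg fE) => t _ [<- <-].
have [] // := bfs_ideal (bfs_L1_add_Linf Ef) Lg _ Ef.
by apply: ae_posS fg => t _ ->.
Qed.

Lemma bfs_memE (F : R -> \bar R) g : (forall t, 0 < t -> F t = (g t)%:E) ->
  bfs_mem E F <-> bfs_car E g.
Proof.
move=> Fg; split=> [[f Ef Ff]|Eg]; last by exists g => //; exact: ae_posW.
by apply: bfs_car_ae Ef; apply: ae_posS Ff => t t0; rewrite Fg// => -[].
Qed.

(** Being dominated by an element of [E] is the form that also applies to functions such as t |-> |A
    u(t)|, whose measurability is unknown. *)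
Lemma bfs_enorm_ltyP (F : R -> \bar R) : (bfs_enorm E F < +oo)%E <->
  exists2 g, bfs_car E g & ae_pos (fun t => (`|F t| <= `|g t|%:E)%E).
Proof.
split=> [/ereal_inf_lt[_ [g [Eg Fg] _] _]|[g Eg Fg]]; first by exists g.
apply: le_lt_trans (ltry (bfs_norm E g)).
by apply: ereal_inf_lbound; exists g.
Qed.

Lemma bfs_car_enorm g : measurable_fun pos g ->
  (bfs_enorm E (EFin \o g) < +oo)%E <-> bfs_car E g.
Proof.
move=> mg; rewrite bfs_enorm_lty; first exact: bfs_memE.
exact: measurableT_comp.
Qed.

(** The ideal property with measurability in place of membership in L^1 + L^oo, which domination
    supplies through [bfs_enorm_lty]. *)
Lemma bfs_car_le f g : measurable_fun pos g ->
  ae_pos (fun t => `|g t| <= `|f t|) -> bfs_car E f -> bfs_car E g.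
Proof.
move=> mg gf Ef; rewrite -bfs_car_enorm//; apply/bfs_enorm_ltyP.
by exists f => //; apply: ae_posS gf.
Qed.

Lemma bfs_enorm_ltyE (F : R -> \bar R) g : (forall t, 0 < t -> F t = (g t)%:E) ->
  measurable_fun pos g -> (bfs_enorm E F < +oo)%E <-> bfs_car E g.
Proof.
move=> Fg mg; rewrite -bfs_car_enorm// !bfs_enorm_ltyP.
by split=> -[f Ef fF]; exists f => //; apply: ae_posS fF => t t0; rewrite /= Fg.
Qed.

Lemma bfs_carD f g : bfs_car E f -> bfs_car E g -> bfs_car E (f \+ g).
Proof. by move=> Ef Eg; have [] := bfs_add Ef Eg. Qed.

Lemma bfs_carZ (a : R) f : bfs_car E f -> bfs_car E (a \*o f).
Proof. by move=> Ef; have [] := bfs_scale a Ef. Qed.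

Lemma measurable_pos : measurable pos.
Proof. exact: measurable_itv. Qed.

Lemma measurable_patch S f : measurable S -> measurable_fun S f ->
  measurable_fun pos (f \_ S).
Proof.
move=> mS mf; apply: (@measurable_funS _ _ _ _ setT) => //.
by apply/(measurable_restrictT _ _).1 => //; rewrite setTI.
Qed.

Lemma bfs_car_indic (T : R) : bfs_car E ((cst 1 : R -> R) \_ `]0, T[).
Proof.
apply: bfs_L1_cap_Linf; exists ((cst 1 : R -> R) \_ `]0, T[); split.
- have m1 : measurable_fun setT ((cst 1 : R -> R) \_ `]0, T[).
    by apply/(measurable_restrictT _ _).1.
  have -> : EFin \o ((cst 1 : R -> R) \_ `]0, T[) = (cst 1%E) \_ `]0%R, T[.
    by apply/funext => t; rewrite /= !patchE; case: ifP.
  apply: (@integrableS _ _ _ _ setT) => //.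
  rewrite -integrable_mkcond//; apply/integrableP; split => //=.
  under eq_integral do rewrite /= normr1.
  rewrite integral_cst//= mul1e lebesgue_measure_itv/=.
  by case: ifP => // _; rewrite -EFinB ltry.
- by exists 1 => t; rewrite patchE; case: ifP => _; rewrite ?normr1// normr0.
- exact: ae_posW.
Qed.

(** The form in which pointwise comparisons on [S] become memberships. A nonzero constant [b] needs
    S bounded, because constants are elements of [E] only after restriction to a bounded
    interval. *)
Lemma bfs_car_dom S f g (T a b : R) : measurable S -> S `<=` `]0, +oo[ ->
  (b = 0 \/ S `<=` `]0, T[) -> measurable_fun S g ->
  ae_pos (fun t => S t -> `|g t| <= a * f t + b) ->
  bfs_car E (f \_ S) -> bfs_car E (g \_ S).
Proof.
move=> mS S0 bS mg gf Ef.
apply: (@bfs_car_le ((a \*o (f \_ S)) \+ (b \*o ((cst 1 : R -> R) \_ `]0, T[)))).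
- exact: measurable_patch.
- apply: ae_posS gf => t t0 gft /=; rewrite patchE.
  case: ifPn => [/set_mem St|_]; last by rewrite normr0.
  rewrite patchE mem_set//=; apply: le_trans (gft St) (le_trans _ (ler_norm _)).
  rewrite lerD2l patchE; case: bS => [->|ST]; first by rewrite mul0r.
  by rewrite mem_set ?mulr1//; exact: ST.
- exact: bfs_carD (bfs_carZ _ Ef) (bfs_carZ _ (bfs_car_indic _)).
Qed.

(** On a bounded interval both summands of L^1 + L^oo are integrable. An element of [E] is only
    almost everywhere equal to a measurable function, so measurability of [f] is assumed
    separately. *)
Lemma bfs_locally_integrable f (T : R) : bfs_car E f -> measurable_fun pos f ->
  mu.-integrable `]0, T[ (EFin \o f).
Proof.
move=> Ef mf; have [g1 [g2 [ig1 mg2 [M gM] gE]]] := bfs_L1_add_Linf Ef.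
have sub : (`]0%R, T[ `<=` `]0%R, +oo[)%classic.
  by apply: subset_itvl; rewrite bnd_simp.
have ig : mu.-integrable `]0, T[ (EFin \o (g1 \+ g2)).
  rewrite (_ : EFin \o _ = (EFin \o g1) \+ (EFin \o g2))%E//.
  apply: integrableD => //.
    exact: integrableS ig1.
  apply: (@le_integrable _ _ _ mu `]0, T[ (measurable_itv _) _ (EFin \o cst M)) => /=.
  - by apply: measurableT_comp => //; exact: measurable_funS mg2.
  - by move=> t _ /=; rewrite lee_fin (le_trans (gM t))// ler_norm.
  - apply/integrableP; split=> /=; first exact/measurableT_comp.
    rewrite integral_cst//= lebesgue_measure_itv/=.
    by case: ifP => _; rewrite ?mule0// -EFinB -EFinM ltry.
have mf' : measurable_fun (`]0, T[%classic : set R) (EFin \o f).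
  by apply: measurableT_comp => //; exact: measurable_funS mf.
have /integrableP[mg ig'] := ig.
apply/integrableP; split=> //; apply: le_lt_trans ig'.
apply: ae_ge0_le_integral => //; [exact: measurableT_comp|exact: measurableT_comp|].
apply: ae_filterS gE => t gE.
by move=> /=; rewrite in_itv/= => /andP[/gE <- _].
Qed.

End FunctionSpace.

(** The sets where f >= r are intervals. *)
Lemma is_interval_nonincreasing_measurable (R : realType) (D : set R) (f : R -> R) :
  is_interval D -> (forall s t, D s -> D t -> s <= t -> f t <= f s) ->
  measurable_fun D f.
Proof.
move=> iD fni mD.
apply: (measurability (@RGenCInfty.G R)) => //.
  exact: RGenCInfty.measurableE.
move=> _ [_ [r ->] <-]; apply: is_interval_measurable => s t /= [Ds].
rewrite !in_itv/= !andbT => rs [Dt rt] u /andP[su ut].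
have Du : D u by apply: iD Ds Dt _ _; rewrite su.
by split=> //; rewrite in_itv/= andbT (le_trans rt)// fni.
Qed.

Section Hardy.
Variables (R : realType) (E : banachFunctionSpace R).
Hypothesis hE : hardy_bounded E.
Notation mu := (@lebesgue_measure R).

Lemma bfs_car_hardy (f : R -> R) : bfs_car E f -> bfs_car E (hardy f).
Proof. by have [C HC] := hE => /HC[]. Qed.

Lemma hardy_indic (T t : R) : 0 < T -> T <= t ->
  hardy ((cst 1 : R -> R) \_ `]0, T[) t = T / t.
Proof.
move=> T0 Tt; rewrite /hardy mulrC; congr (_ / _).
rewrite -Rintegral_mkcondr setIidr; last first.
  by apply: subset_itvl; rewrite bnd_simp.
rewrite Rintegral_cst// mul1r.
by rewrite /= lebesgue_measure_itv/= lte_fin T0 -EFinB /= subr0.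
Qed.

Lemma measurable_inv_pos (S : set R) : S `<=` `]0, +oo[ ->
  measurable_fun S (fun t : R => t^-1).
Proof.
move=> S0; apply: measurable_funS S0 _; first exact: measurable_pos.
apply: is_interval_nonincreasing_measurable; first exact: interval_is_interval.
by move=> s t /=; rewrite !in_itv/= !andbT => s0 t0 st; rewrite lef_pV2.
Qed.

(** The Hardy operator sends the indicator of (0,T), an element of [E], to a function equal to T/t
    on [T,oo). *)
Lemma bfs_car_inv_infty (T : R) : 0 < T ->
  bfs_car E ((fun t : R => t^-1) \_ `[T, +oo[).
Proof.
move=> T0.
have S0 : (`[T, +oo[ `<=` `]0 : R, +oo[)%classic.
  by apply: subset_itvr; rewrite bnd_simp.
have := bfs_carZ T^-1 (bfs_car_hardy (bfs_car_indic E T)).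
apply: bfs_car_le.
  by apply: measurable_patch; [exact: measurable_itv|exact: measurable_inv_pos].
apply: ae_posW => t t0; rewrite patchE; case: ifPn => [|_]; last by rewrite normr0.
rewrite inE/= in_itv/= andbT => Tt.
by rewrite hardy_indic// mulrA mulVf ?mul1r ?gt_eqF.
Qed.

End Hardy.

Lemma locally_lipschitz_continuous (R : realType) (X : normedModType R)
    (f : R -> X) (t L : R) :
  (\forall s \near t, `|f s - f t| <= L * `|s - t|) -> {for t, continuous f}.
Proof.
move=> fL; apply/cvgrPdist_le => eps eps0.
have L1 : 0 < `|L| + 1 by rewrite ltr_wpDl.
have d0 : 0 < eps / (`|L| + 1) by rewrite divr_gt0.
near=> s; rewrite distrC.
apply: (@le_trans _ _ (L * `|s - t|)); first by near: s.
have : `|s - t| <= eps / (`|L| + 1).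
  by near: s; under eq_near do rewrite distrC; exact: cvgr_dist_le.
rewrite ler_pdivlMr// mulrDr mulr1 mulrC; apply: le_trans.
by rewrite ler_wpDr// ler_wpM2r// ler_norm.
Unshelve. all: by end_near. Qed.

(** * Regularity of the resolvent curve *)

Section ResolventContinuity.
Variables (R : realType) (X : completeNormedModType R).
Variables (A : set (X * X)) (omega : R) (x : X).
Hypotheses (w0 : 0 <= omega) (mA : m_accretive omega A).

(** One factor [c] is the Lipschitz constant of J_s, the other comes with 2 from |x - J_t x|/t <= 2
    c K(x,t)/t. The case s = 0, where J_0 x = x, needs the latter bound only. *)
Lemma resolvent_diff_kquot s t c : 0 <= s -> s <= t -> 0 < t -> t * omega < 1 ->
  1 <= c * (1 - t * omega) ->
  `|resolvent A t x - resolvent A s x| <= 2 * c ^+ 2 * (t - s) * kquot A x t.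
Proof.
move=> s0 st t0 tw c1.
have tw0 : 0 < 1 - t * omega by rewrite subr_gt0.
have c0 : 0 < c by rewrite -(pmulr_lgt0 _ tw0) (lt_le_trans _ c1).
have cge1 : 1 <= c.
  by have := mulr_ge0 (ltW c0) (mulr_ge0 (ltW t0) w0); lra.
have k0 := kquot_ge0 x (op_dom_neq0 x mA t0 tw) t0.
have := resolvent_le_kquot x w0 mA t0 tw c1.
move: (kquot A x t) k0 => k k0 Jk.
move: s0; rewrite le_eqVlt => /orP[/eqP s0|s0].
  rewrite -s0 subr0 resolvent0 distrC; move: Jk; rewrite ler_pdivrMr// => /le_trans; apply.
  have : 0 <= c * t * k by rewrite !mulr_ge0// ltW.
  by rewrite expr2; nra.
have sw : s * omega < 1 by apply: le_lt_trans tw; rewrite ler_wpM2r.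
have := resolvent_diff_le x mA s0 st sw tw.
have c1' : 1 <= c * (1 - s * omega).
  apply: le_trans c1 _; rewrite ler_pM2l// lerD2l lerN2; exact: ler_wpM2r.
move: (`|_ - resolvent A s x|) (normr_ge0 (resolvent A t x - resolvent A s x)) => d d0 H.
have H1 : d <= c * ((1 - s * omega) * d) by nra.
apply: le_trans H1 _; rewrite expr2.
have : c * ((1 - s * omega) * d) <= c * ((t - s) * (2 * c * k)).
  rewrite ler_pM2l//; apply: le_trans H _; apply: ler_wpM2l => //.
  by rewrite subr_ge0.
by rewrite (_ : c * ((t - s) * (2 * c * k)) = 2 * (c * c) * (t - s) * k)//; ring.
Qed.

Lemma resolvent_continuous t : 0 < t -> t * omega < 1 ->
  {for t, continuous (fun t => resolvent A t x)}.
Proof.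
move=> t0 tw; pose c := 2 / (1 - t * omega).
have tw0 : 0 < 1 - t * omega by rewrite subr_gt0.
have c0 : 0 < c by rewrite divr_gt0.
have cw s : s * omega <= (1 + t * omega) / 2 -> s * omega < 1 /\ 1 <= c * (1 - s * omega).
  by move=> sw; split; [lra|rewrite /c mulrAC ler_pdivlMr//; lra].
apply: (@locally_lipschitz_continuous _ _ _ _ (2 * c ^+ 2 * kquot A x (t / 2))).
have D0 := op_dom_neq0 x mA t0 tw.
have tw2 : t * omega <= (1 + t * omega) / 2 by lra.
near=> s.
have s2 : t / 2 <= s by near: s; apply: (@cvgr_ge _ _ _ _ id t); [exact: cvg_id|lra].
have sw : s * omega <= (1 + t * omega) / 2.
  near: s; apply: (@cvgr_le _ _ _ _ (fun s => s * omega) (t * omega)); last by lra.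
  by apply: cvgM; [exact: cvg_id|exact: cvg_cst].
have t2 : 0 < t / 2 by lra.
have C0 : 0 <= 2 * c ^+ 2 by rewrite mulr_ge0// sqr_ge0.
have [st|/ltW ts] := leP s t.
  rewrite distrC (distrC s) (ger0_norm (_ : 0 <= t - s)); last by rewrite subr_ge0.
  have [? ?] := cw _ tw2.
  apply: le_trans (@resolvent_diff_kquot s t c _ st t0 tw _) _ => //; first by lra.
  rewrite mulrAC ler_wpM2r ?subr_ge0// ler_wpM2l//.
  by apply: kquot_nincr => //; lra.
rewrite (ger0_norm (_ : 0 <= s - t)); last by rewrite subr_ge0.
have [? ?] := cw _ sw.
apply: le_trans (@resolvent_diff_kquot t s c _ ts _ _ _) _ => //; [lra|lra|].
rewrite mulrAC ler_wpM2r ?subr_ge0// ler_wpM2l//.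
by apply: kquot_nincr => //; lra.
Unshelve. all: by end_near. Qed.

Lemma measurable_resolvent_dist (S : set R) :
  S `<=` [set t | 0 < t /\ t * omega < 1] ->
  measurable_fun S (fun t => `|x - resolvent A t x| / t).
Proof.
pose U : set R := [set t | 0 < t /\ t * omega < 1].
move=> SU; have oU : open U.
  rewrite (_ : U = [set t | 0 < t] `&` (fun t => t * omega) @^-1` [set r | r < 1])//.
  apply: openI; first exact: open_gt.
  apply: open_comp; last exact: open_lt.
  by move=> s _; apply: cvgM; [exact: cvg_id|exact: cvg_cst].
apply: measurable_funS SU _; first exact: open_measurable.
apply: measurable_funM; last first.
  apply: measurable_inv_pos => t [t0 _].
  by rewrite /= in_itv/= t0.
apply: open_continuous_measurable_fun => // t /set_mem[t0 tw].
apply: cvg_norm; apply: cvgB; first exact: cvg_cst.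
exact: resolvent_continuous.
Qed.

End ResolventContinuity.

(** * Membership in the function space and the K-quotient *)

Section Equivalence.
Variables (R : realType) (X : completeNormedModType R) (E : banachFunctionSpace R).
Notation mu := (@lebesgue_measure R).
Implicit Types (A : set (X * X)) (x : X) (b : itv_bound R).

Lemma itv0_pos b : [set` Interval (BRight (0 : R)) b] `<=` `]0, +oo[.
Proof. by move=> t /=; rewrite !itv_boundlr => /andP[-> _]. Qed.

Lemma measurable_kquot A x (S : set R) : op_dom A !=set0 -> S `<=` `]0, +oo[ ->
  measurable_fun S (kquot A x).
Proof.
move=> A0 S0; apply: measurable_funS S0 _; first exact: measurable_pos.
apply: is_interval_nonincreasing_measurable; first exact: interval_is_interval.
by move=> s t /=; rewrite !in_itv/= !andbT => s0 t0 st; exact: kquot_nincr.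
Qed.

(** The right end [b] is arbitrary, so that (0,tau) for A and (0,oo) for I + hA are both
    instances. *)
Lemma bfs_car_resolvent A omega c b x : 0 <= omega -> m_accretive omega A ->
  op_dom A !=set0 ->
  (forall t, [set` Interval (BRight 0) b] t ->
    t * omega < 1 /\ 1 <= c * (1 - t * omega)) ->
  bfs_car E ((fun t => `|x - resolvent A t x| / t) \_ [set` Interval (BRight 0) b])
  <-> bfs_car E (kquot A x \_ [set` Interval (BRight 0) b]).
Proof.
move=> w0 mA A0 Sc; pose S := [set` Interval (BRight 0) b].
have mS : measurable S by exact: measurable_itv.
have S0 := @itv0_pos b.
have pos t : S t -> 0 < t by move=> /S0/=; rewrite in_itv/= andbT.
have mJ : measurable_fun S (fun t => `|x - resolvent A t x| / t).
  by apply: (measurable_resolvent_dist x w0 mA) => t St; have [tw _] := Sc _ St; split; [exact: pos|].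
split=> [EJ|Ek].
- apply: (@bfs_car_dom _ E S (fun t => `|x - resolvent A t x| / t) _ 0 2 0) => //.
  + by left.
  + exact: measurable_kquot.
  + apply: ae_posW => t t0 St; have [tw _] := Sc _ St; rewrite addr0.
    rewrite ger0_norm ?kquot_ge0//; exact: (kquot_le_resolvent x mA t0 tw).
- apply: (@bfs_car_dom _ E S (kquot A x) _ 0 (2 * c) 0) => //; first by left.
  apply: ae_posW => t t0 St; have [tw c1] := Sc _ St; rewrite addr0.
  rewrite ger0_norm; last by rewrite divr_ge0// ltW.
  exact: (resolvent_le_kquot x w0 mA).
Qed.

(** For x in the domain the competitor v = x bounds the K-quotient by a constant. *)
Lemma bfs_car_op_dom A x (T : R) : op_dom A !=set0 -> op_dom A x ->
  bfs_car E (kquot A x \_ `]0, T[).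
Proof.
move=> A0 [f Axf].
apply: (@bfs_car_dom _ E _ (cst 1) _ T `|f| 0) => //.
- exact: itv0_pos.
- by left.
- by apply: measurable_kquot; [|exact: itv0_pos].
- apply: ae_posW => t t0 _; rewrite ger0_norm ?kquot_ge0//.
  by apply: le_trans (kquot_le x A0 t0 Axf) _; rewrite subrr normr0 mul0r add0r addr0 mulr1.
- exact: bfs_car_indic.
Qed.

Lemma bfs_car_id_add A h (T : R) x : op_dom A !=set0 -> 0 < h -> 0 < T ->
  bfs_car E (kquot (op_id_add h A) x \_ `]0, T[) <->
  bfs_car E (kquot A x \_ `]0, T[).
Proof.
move=> A0 h0 T0; have B0 : op_dom (op_id_add h A) !=set0 by rewrite op_dom_id_add.
split.
- apply: (@bfs_car_dom _ E _ _ _ T (1 + (T + 1) / h) (`|x| / h)) => //.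
  + exact: itv0_pos.
  + by right.
  + by apply: measurable_kquot; [|exact: itv0_pos].
  + apply: ae_posW => t t0 /=; rewrite in_itv/= t0 => /= /ltW tT.
    by rewrite ger0_norm ?kquot_ge0//; exact: kquot_le_id_add.
- apply: (@bfs_car_dom _ E _ _ _ T (1 + T + h) `|x|) => //.
  + exact: itv0_pos.
  + by right.
  + by apply: measurable_kquot; [|exact: itv0_pos].
  + apply: ae_posW => t t0 /=; rewrite in_itv/= t0 => /= /ltW tT.
    by rewrite ger0_norm ?kquot_ge0//; exact: kquot_id_add_le.
Qed.

(** On [T,oo) the K-quotient is at most a multiple of 1/t, which is there an element of [E]. *)
Lemma bfs_car_id_add_infty A omega h (T : R) x : hardy_bounded E ->
  m_accretive omega A -> 0 < h -> h * omega < 1 -> 0 < T ->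
  bfs_car E (kquot (op_id_add h A) x \_ `]0, +oo[) <->
  bfs_car E (kquot (op_id_add h A) x \_ `]0, T[).
Proof.
move=> hE mA h0 hw T0; have A0 := op_dom_neq0 0 mA h0 hw.
have B0 : op_dom (op_id_add h A) !=set0 by rewrite op_dom_id_add.
have mk := measurable_kquot x B0.
split=> Ek.
- apply: bfs_car_le Ek; first by apply: measurable_patch => //; exact: (mk _ (@itv0_pos _)).
  apply: ae_posW => t t0; rewrite !patchE.
  case: ifPn => [|_]; last by rewrite normr0.
  by rewrite inE/= in_itv/= t0 => /= tT; rewrite mem_set//= in_itv/= t0.
- have := bfs_carD Ek (bfs_carZ `|x - resolvent A h 0| (bfs_car_inv_infty hE T0)).
  apply: bfs_car_le.
    by apply: measurable_patch => //; exact: mk.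
  apply: ae_posW => t t0; rewrite patchE mem_set/= ?in_itv/= ?t0//.
  rewrite ger0_norm ?kquot_ge0// !patchE.
  have [tT|Tt] := ltP t T.
  + rewrite mem_set/= ?in_itv/= ?t0// memNset/= ?in_itv/= ?andbT; last first.
      by apply/negP; rewrite -ltNge.
    by rewrite mulr0 addr0 ler_norm.
  + rewrite memNset/= ?in_itv/= ?t0/=; last by apply/negP; rewrite -leNgt.
    rewrite mem_set/= ?in_itv/= ?Tt// add0r (le_trans _ (ler_norm _))//.
    exact: (kquot_id_add_infty x mA h0 hw t0).
Qed.

Lemma integrable_kquot A x (T : R) : op_dom A !=set0 ->
  bfs_car E (kquot A x \_ `]0, T[) ->
  mu.-integrable `]0, T[ (EFin \o kquot A x).
Proof.
move=> A0 Ek.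
have mk : measurable_fun (`]0, +oo[%classic : set R) (kquot A x \_ `]0, T[).
  by apply: measurable_patch => //; exact: (measurable_kquot x A0 (@itv0_pos _)).
have := bfs_locally_integrable T Ek mk.
apply: eq_integrable => // t tT.
by rewrite /= patchE tT.
Qed.

Lemma integrable_small (f : R -> R) (T eps : R) : 0 < T -> 0 < eps ->
  mu.-integrable `]0, T[ (EFin \o f) ->
  exists2 d, 0 < d <= T & \int[mu]_(s in `]0, d[) `|f s| < eps.
Proof.
move=> T0 eps0 fi.
have fi' : mu.-integrable setT (EFin \o (f \_ `]0, T[)).
  rewrite (_ : EFin \o _ = (EFin \o f) \_ `]0, T[); last first.
    by apply/funext => t; rewrite /= !patchE; case: ifP.
  by rewrite -integrable_mkcond.
have [d [d0 H]] := integral_normr_continuous fi' eps0.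
have dT : 0 < Num.min (d / 2) T by rewrite lt_min T0 andbT; lra.
exists (Num.min (d / 2) T); first by rewrite dT ge_min lexx orbT.
have := H `]0, (Num.min (d / 2) T)[%classic (measurable_itv _).
rewrite /= lebesgue_measure_itv/= lte_fin dT -EFinB subr0 lte_fin.
have -> : Num.min (d / 2) T < d by rewrite gt_min; apply/orP; left; lra.
move=> /(_ isT); congr (_ < _); apply: eq_Rintegral => t.
rewrite inE/= in_itv/= lt_min => /andP[t0 /andP[_ tT]].
by rewrite patchE mem_set//= in_itv/= t0.
Qed.

Lemma integral_kquot_ge A x (T t : R) : op_dom A !=set0 ->
  mu.-integrable `]0, T[ (EFin \o kquot A x) -> 0 < t -> t <= T ->
  t * kquot A x t <= \int[mu]_(s in `]0, t[) kquot A x s.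
Proof.
move=> A0 ki t0 tT.
have ki' : mu.-integrable `]0, t[ (EFin \o kquot A x).
  by apply: integrableS ki => //; apply: subset_itvl; rewrite bnd_simp.
have := @Rintegral_cst _ _ _ mu `]0, t[ (measurable_itv _) (kquot A x t).
rewrite /= lebesgue_measure_itv/= lte_fin t0 -EFinB subr0 /= mulrC => <-.
apply: le_Rintegral => //.
- exact: itv_integrable_cst.
- by move=> s /=; rewrite in_itv/= => /andP[s0 /ltW st]; exact: kquot_nincr.
Qed.

Lemma ge0_le_Rintegral_subset (D D' : set R) (f : R -> R) :
  measurable D -> measurable D' -> D `<=` D' ->
  mu.-integrable D' (EFin \o f) -> (forall t, D' t -> 0 <= f t) ->
  \int[mu]_(s in D) f s <= \int[mu]_(s in D') f s.
Proof.
move=> mD mD' DD' fi f0.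
have fiD : mu.-integrable D (EFin \o f) by apply: integrableS fi.
apply: fine_le.
- exact: integrable_fin_num.
- exact: integrable_fin_num.
- by apply: ge0_subset_integral => //; have /integrableP[] := fi.
Qed.

(** Here t * [kquot A x t] is K(x,t). By monotonicity it is at most the integral of the quotient
    over (0,t), which tends to 0 because the quotient is integrable near 0. *)
Lemma kquot_small A x (T eps : R) : op_dom A !=set0 -> 0 < T -> 0 < eps ->
  bfs_car E (kquot A x \_ `]0, T[) ->
  exists2 d, 0 < d & forall t, 0 < t < d -> t * kquot A x t < eps.
Proof.
move=> A0 T0 eps0 Ek; have ki := integrable_kquot A0 Ek.
have [d /andP[d0 dT] dint] := integrable_small T0 eps0 ki.
exists d => // t /andP[t0 /ltW td]; apply: le_lt_trans dint.
apply: le_trans (integral_kquot_ge A0 ki t0 (le_trans td dT)) _.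
have kid : mu.-integrable `]0, d[ (EFin \o kquot A x).
  by apply: integrableS ki => //; apply: subset_itvl; rewrite bnd_simp.
have kpos s : `]0, d[%classic s -> 0 <= kquot A x s.
  by rewrite /= in_itv/= => /andP[s0 _]; exact: kquot_ge0.
rewrite [leRHS](_ : _ = \int[mu]_(s in `]0, d[) kquot A x s); last first.
  by apply: eq_Rintegral => s /set_mem sd; rewrite ger0_norm// kpos.
apply: ge0_le_Rintegral_subset => //.
by apply: subset_itvl; rewrite bnd_simp.
Qed.

End Equivalence.

(** The disjoint intervals form a set whose measure is the sum of their lengths, so absolute
    continuity of the integral of [k] transfers to [f]. *)
Lemma abs_cont_integral (R : realType) (V : normedModType R) (f : R -> V)
    (k : R -> R) (C T : R) (mu := @lebesgue_measure R) : 0 <= C ->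
  mu.-integrable `]0, T[ (EFin \o k) -> (forall t, 0 < t < T -> 0 <= k t) ->
  (forall a b, 0 <= a -> a < b -> b < T ->
    `|f b - f a| <= C * \int[mu]_(s in `]a, b[) k s) -> abs_cont `[0, T[ f.
Proof.
move=> C0 ik k0 fk eps eps0.
(* Division is by C + 1, since [C] may be 0. *)
have C1 : 0 < C + 1 by rewrite ltr_wpDl.
have ki : mu.-integrable setT (EFin \o (k \_ `]0, T[)).
  rewrite (_ : EFin \o _ = (EFin \o k) \_ `]0, T[); last first.
    by apply/funext => t; rewrite /= !patchE; case: ifP.
  by rewrite -integrable_mkcond.
have [d [d0 Hd]] := integral_normr_continuous ki (divr_gt0 eps0 C1).
exists d => // n a b abT abd sumd.
pose F (i : 'I_n) : set R := `]a i, b i[%classic.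
pose D := \big[setU/set0]_(i < n) F i.
have mF i : measurable (F i) by exact: measurable_itv.
have mD : measurable D by exact: bigsetU_measurable.
have tF : trivIset setT F.
  apply/trivIsetP => i j _ _ ij; exact: abd.
have FT i t : F i t -> 0 < t < T.
  rewrite /F /= in_itv/= => /andP[at' tb]; have [_] := abT i.
  rewrite /= !in_itv/= => /andP[a0 _] /andP[_ bT].
  by rewrite (le_lt_trans a0 at') (lt_trans tb bT).
have muF i : mu (F i) = (b i - a i)%:E.
  have [ab _ _] := abT i; rewrite /mu /F /= lebesgue_measure_itv/= lte_fin.
  case: ltP => ab1; rewrite ?EFinB//.
  have -> : b i = a i by lra.
  by rewrite -EFinB subrr.
have muD : (mu D < d%:E)%E.
  suff -> : mu D = (\sum_(i < n) (b i - a i))%:E by rewrite lte_fin.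
  rewrite -sumEFin /D /mu measure_bigsetU_ord//.
  by apply: eq_bigr => i _; exact: muF.
have := Hd D mD muD.
have kF i : mu.-integrable (F i) (EFin \o k).
  by apply: integrableS ik => //; [exact: mF|move=> t /FT; rewrite /= in_itv/=].
have kD t : D t -> 0 < t < T.
  rewrite /D; elim/big_rec: _ => // i Y _ IH [/FT//|/IH//].
have -> : \int[mu]_(r in D) `|(k \_ `]0%R, T[) r| = \sum_(i < n) \int[mu]_(r in F i) k r.
  transitivity (\int[mu]_(r in D) k r).
    apply: eq_Rintegral => t /set_mem/kD t0T; rewrite patchE mem_set/= ?in_itv//=.
    by rewrite ger0_norm// k0.
  have IE : (\int[mu]_(r in D) (k r)%:E = \sum_(i < n) \int[mu]_(r in F i) (k r)%:E)%E.
    apply: ge0_integral_bigsetU => //.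
    - exact: index_enum_uniq.
    - exact: sub_trivIset tF.
    - have /integrableP[/measurable_EFinP mk _] := ik.
      by apply/measurable_EFinP; apply: measurable_funS mk => // t /kD; rewrite /= in_itv.
    - by move=> t /kD t0T; rewrite lee_fin k0.
  rewrite /Rintegral IE -sum_fine// => i _.
  by apply: integrable_fin_num; [exact: mF|exact: kF].
move=> Hsum.
have {}Hsum : C * \sum_(i < n) \int[mu]_(r in F i) k r < eps.
  apply: (@le_lt_trans _ _ (C * (eps / (C + 1)))); first by rewrite ler_wpM2l// ltW.
  by rewrite mulrCA gtr_pMr// ltr_pdivrMr// mul1r ltrDl.
apply: le_lt_trans Hsum; rewrite mulr_sumr; apply: ler_sum => i _.
have [ab a0 b0] := abT i.
move: a0 b0; rewrite /= !in_itv/= => /andP[a0 _] /andP[_ bT].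
move: ab; rewrite le_eqVlt => /orP[/eqP->|ab].
  by rewrite subrr normr0 mulr_ge0// Rintegral_ge0// => t /FT/k0.
exact: fk.
Qed.

(** * Mild solutions *)

Section CrandallLiggett.
Variables (R : realType) (X : completeNormedModType R).
Variables (A : set (X * X)) (omega : R).
Hypotheses (w0 : 0 <= omega) (mA : m_accretive omega A).
Implicit Types (x y u v f : X) (l s t : R) (m n : nat).

Definition rpow l n x : X := iter n (resolvent A l) x.

(** Accretivity with parameter l s/(l + s), multiplied by l + s: writing a = J_l u and b = J_s v,
    the right-hand vector becomes l (a - v) + s (u - b). *)
Lemma resolvent_two_step l s u v : 0 < l -> 0 < s -> l * omega < 1 ->
  s * omega < 1 ->
  (l + s - l * s * omega) * `|resolvent A l u - resolvent A s v| <=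
  l * `|resolvent A l u - v| + s * `|u - resolvent A s v|.
Proof.
move=> l0 s0 lw sw; have ls0 : 0 < l + s by rewrite addr_gt0.
have nu0 : 0 < l * s / (l + s) by rewrite divr_gt0// mulr_gt0.
have nuw : l * s / (l + s) * omega < 1.
  by rewrite mulrAC ltr_pdivrMr//; nra.
have [acc _] := mA.
have := acc _ _ _ _ (resolventP u mA l0 lw) (resolventP v mA s0 sw) _ nu0 nuw.
move: (resolvent A l u) (resolvent A s v) => a b.
rewrite -(ler_pM2l ls0) mulrA mulrBr mulr1 (_ : (l + s) * _ = l * s * omega); last first.
  by field; rewrite gt_eqF.
move=> /le_trans; apply; rewrite -[X in X * _](gtr0_norm ls0) -normrZ.
rewrite -[X in X * `|_ - v|](gtr0_norm l0) -[X in _ + X * _](gtr0_norm s0) -!normrZ.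
apply: le_trans (ler_normD _ _); rewrite le_eqVlt; apply/orP; left; apply/eqP.
by congr `|_|; lcoefs R X; field; rewrite !gt_eqF.
Qed.

Lemma rpow_lipschitz l n x y : 0 < l -> l * omega < 1 ->
  (1 - l * omega) ^+ n * `|rpow l n x - rpow l n y| <= `|x - y|.
Proof.
move=> l0 lw; elim: n => [|n IH]; first by rewrite expr0 mul1r.
apply: le_trans IH; rewrite exprSr -mulrA ler_wpM2l//.
  by rewrite exprn_ge0// subr_ge0 ltW.
exact: resolvent_lipschitz.
Qed.

Lemma rpow_dist_dom l n x f : 0 < l -> l * omega < 1 -> A (x, f) ->
  (1 - l * omega) ^+ n * `|rpow l n x - x| <= n%:R * l * `|f|.
Proof.
move=> l0 lw Axf; have lw0 : 0 < 1 - l * omega by rewrite subr_gt0.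
have lw1 : 1 - l * omega <= 1 by rewrite lerBlDr lerDl mulr_ge0// ltW.
elim: n => [|n IH]; first by rewrite /rpow /= subrr normr0 mulr0 !mul0r.
have J1 : (1 - l * omega) * `|resolvent A l x - x| <= l * `|f|.
  have := accretive_resolvent x mA l0 lw Axf.
  by rewrite subrr sub0r normrN normrZ (gtr0_norm l0).
have J2 : `|rpow l n.+1 x - x| <= `|rpow l n.+1 x - resolvent A l x| + `|resolvent A l x - x|.
  by apply: le_trans (ler_normD _ _); rewrite addrA subrK.
have J3 := resolvent_lipschitz (rpow l n x) x mA l0 lw.
have p0 : 0 <= (1 - l * omega) ^+ n by rewrite exprn_ge0// ltW.
have p1 : (1 - l * omega) ^+ n <= 1 by rewrite exprn_ile1// ltW.
have J4 := ler_wpM2l p0 J3.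
have J5 : (1 - l * omega) ^+ n * ((1 - l * omega) * `|resolvent A l x - x|) <= l * `|f|.
  by apply: le_trans J1; rewrite ler_piMl// mulr_ge0// ltW.
rewrite exprSr -mulrA -natr1 (mulrDl _ _ l) (mulrDl _ _ `|f|) mul1r.
apply: (le_trans _ (lerD (le_trans J4 IH) J5)).
by rewrite -mulrDr ler_wpM2l// -mulrDr ler_wpM2l// ltW.
Qed.

Let q l s m n : R := (m%:R * l - n%:R * s) ^+ 2 + m%:R * l ^+ 2 + n%:R * s ^+ 2.

Let Q l s c m n := (q l s m n / c + c) / 2.

(** The boundary case of the double induction: 2 (m l) c <= (m l)^2 + c^2. *)
Let Q_ge l s c m : 0 < c -> m%:R * l <= Q l s c m 0.
Proof.
move=> c0; rewrite /Q /q mul0r subr0 mul0r addr0 ler_pdivlMr//.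
rewrite -(ler_pM2r c0) [leRHS]mulrDl mulfVK ?gt_eqF//.
have : 0 <= m%:R * l ^+ 2 by rewrite mulr_ge0// sqr_ge0.
by have := sqr_ge0 (m%:R * l - c); rewrite !expr2; nra.
Qed.

(* The square root in the Crandall-Liggett estimate is replaced by
   [sqrt q <= (q / c + c) / 2] with a free parameter [c]: the right-hand side
   is affine in [q], and [q] solves the averaging recurrence exactly. *)
Lemma rpow_dist l s c m n x f : 0 < l -> 0 < s -> 0 < c -> l * omega < 1 ->
  s * omega < 1 -> A (x, f) ->
  (1 - l * omega) ^+ m * (1 - s * omega) ^+ n * `|rpow l m x - rpow s n x| <=
  `|f| * (((m%:R * l - n%:R * s) ^+ 2 + m%:R * l ^+ 2 + n%:R * s ^+ 2) / c + c) / 2.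
Proof.
move=> l0 s0 c0 lw sw Axf; rewrite -[leRHS]mulrA -/(q l s m n) -/(Q l s c m n).
have a0 : 0 < 1 - l * omega by rewrite subr_gt0.
have b0 : 0 < 1 - s * omega by rewrite subr_gt0.
have lsw : 0 <= l * s * omega by rewrite !mulr_ge0// ltW.
elim: m n => [|m IHm] n.
  rewrite expr0 mul1r distrC; apply: le_trans (rpow_dist_dom n s0 sw Axf) _.
  rewrite mulrC ler_wpM2l//; apply: le_trans (Q_ge s l n c0) _.
  rewrite le_eqVlt; apply/orP; left; apply/eqP.
  by rewrite /Q /q; field; rewrite gt_eqF.
elim: n => [|n IHn].
  rewrite expr0 mulr1; apply: le_trans (rpow_dist_dom m.+1 l0 lw Axf) _.
  by rewrite mulrC ler_wpM2l//; exact: Q_ge.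
have ls0 : 0 < l + s by rewrite addr_gt0.
have S0 : 0 < l + s - l * s * omega.
  by have := mulr_gt0 l0 b0; lra.
have := resolvent_two_step (rpow l m x) (rpow s n x) l0 s0 lw sw.
have {IHm} := IHm n.+1.
rewrite -[rpow l m.+1 x]/(resolvent A l (rpow l m x)) in IHn *.
rewrite -[rpow s n.+1 x]/(resolvent A s (rpow s n x)).
move: (`|rpow l m x - resolvent A s (rpow s n x)|) (normr_ge0 (rpow l m x - resolvent A s (rpow s n x))) => a2 a20.
move: IHn; move: (`|resolvent A l (rpow l m x) - rpow s n x|) (normr_ge0 (resolvent A l (rpow l m x) - rpow s n x)) => a1 a10.
move: (`|resolvent A l (rpow l m x) - resolvent A s (rpow s n x)|) => a I1 I2 H.
rewrite -(ler_pM2l S0) -(ler_pM2l ls0).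
set al := 1 - l * omega in I1 I2 a0 *; set be := 1 - s * omega in I1 I2 b0 *.
have am : 0 < al ^+ m by rewrite exprn_gt0.
have bn : 0 < be ^+ n by rewrite exprn_gt0.
(* Trades the growth factor that an induction hypothesis lacks for the coefficient in
   [resolvent_two_step]; the difference is s^2 omega here, and l^2 omega in [aS]. *)
have bS : (l + s) * be <= l + s - l * s * omega.
  by rewrite /be; have := mulr_ge0 (ltW s0) (mulr_ge0 (ltW s0) w0); nra.
have aS : (l + s) * al <= l + s - l * s * omega.
  by rewrite /al; have := mulr_ge0 (ltW l0) (mulr_ge0 (ltW l0) w0); nra.
set L1 := al ^+ m.+1 * be ^+ n * a1 in I1.
set L2 := al ^+ m * be ^+ n.+1 * a2 in I2.
have L10 : 0 <= L1 by rewrite /L1 !mulr_ge0// exprn_ge0// ltW.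
have L20 : 0 <= L2 by rewrite /L2 !mulr_ge0// exprn_ge0// ltW.
apply: (@le_trans _ _ (l * (((l + s) * be) * L1) + s * (((l + s) * al) * L2))).
  have P0 : 0 <= (l + s) * (al ^+ m.+1 * be ^+ n.+1).
    by rewrite ltW// mulr_gt0// mulr_gt0// exprn_gt0.
  have := ler_wpM2l P0 H; rewrite /L1 /L2 !exprS.
  move: (al ^+ m) (be ^+ n) => p p' {}H.
  rewrite [leLHS](_ : _ = (l + s) * (al * p * (be * p')) * ((l + s - l * s * omega) * a)); last by ring.
  by rewrite [leRHS](_ : _ = (l + s) * (al * p * (be * p')) * (l * a1 + s * a2)); last by ring.
set S := l + s - l * s * omega in S0 bS aS *.
apply: (@le_trans _ _ (l * (S * (`|f| * Q l s c m.+1 n)) + s * (S * (`|f| * Q l s c m n.+1)))).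
  apply: lerD; rewrite ler_pM2l//.
    by apply: (@le_trans _ _ (S * L1)); [exact: ler_wpM2r|rewrite ler_pM2l].
  by apply: (@le_trans _ _ (S * L2)); [exact: ler_wpM2r|rewrite ler_pM2l].
(* An equality: l q(m+1,n) + s q(m,n+1) = (l + s) q(m+1,n+1), as the cross terms of the squares
   cancel. *)
rewrite le_eqVlt; apply/orP; left; apply/eqP.
rewrite /Q /q -!(@natr1 _ m) -!(@natr1 _ n); field; rewrite gt_eqF//.
Qed.
End CrandallLiggett.

Lemma within_continuousP (R : realType) (X : normedModType R) (D : set R) (f : R -> X) :
  {within D, continuous f} <->
  forall t, D t -> forall eps : R, 0 < eps -> exists2 d : R, 0 < d &
    forall s, D s -> `|s - t| < d -> `|f s - f t| <= eps.
Proof.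
rewrite subspace_continuousP; split=> H t Dt.
  move=> eps eps0; have /cvgrPdist_le/(_ _ eps0) := H t Dt.
  rewrite near_withinE => /nbhs_ballP[d /= d0 dH]; exists d => // s Ds st.
  by rewrite distrC; apply: dH => //; rewrite -ball_normE /= distrC.
apply/cvgrPdist_le => eps eps0; have [d d0 dH] := H t Dt _ eps0.
rewrite near_withinE; apply/nbhs_ballP; exists d => // s.
by rewrite -ball_normE /= => st Ds; rewrite distrC; apply: dH => //; rewrite distrC.
Qed.

(** * Existence of mild solutions by the exponential formula *)

Section MildExistence.
Variables (R : realType) (X : completeNormedModType R).
Variables (A : set (X * X)) (omega : R).
Hypotheses (w0 : 0 <= omega) (mA : m_accretive omega A).
Implicit Types (x y u v f : X) (l s t : R) (m n : nat).

(** For 0 <= y <= 1/2, (1 - y) (1 + 2 y) >= 1, hence (1 - y) exp(2 y) >= 1; this is raised to the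
    power [n]. *)
Lemma expR_resolvent_growth l n (T : R) : 0 < l -> l * omega <= 2^-1 ->
  n%:R * l <= T -> 1 <= expR (2 * omega * T) * (1 - l * omega) ^+ n.
Proof.
move=> l0 lw nl; have lw0 : 0 < 1 - l * omega by lra.
have e1 : 1 <= (1 - l * omega) * expR (2 * (l * omega)).
  have y0 : 0 <= l * omega by rewrite mulr_ge0// ltW.
  have := expR_ge1Dx (2 * (l * omega)); move: (l * omega) lw lw0 y0 => y ? ? ?.
  move: (expR _) => e ?; nra.
have : 1 <= ((1 - l * omega) * expR (2 * (l * omega))) ^+ n by exact: exprn_ege1.
rewrite exprMn -expRM_natl mulrC => /le_trans; apply.
rewrite ler_wpM2r ?exprn_ge0 ?(ltW lw0)// ler_expR.
rewrite (_ : _ * _ = (2 * omega) * (n%:R * l)); last by ring.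
by rewrite ler_wpM2l// mulr_ge0.
Qed.

(** [rpow_dist] requires a point of the domain, so [x] is replaced by a nearby y; the iterates have
    Lipschitz constant at most G, uniformly on [0,T]. *)
Lemma rpow_cauchy x (T eps : R) : closure (op_dom A) x -> 0 < T -> 0 < eps ->
  exists2 d, 0 < d & forall l s m n, 0 < l < d -> 0 < s < d ->
    m%:R * l <= T -> n%:R * s <= T -> `|m%:R * l - n%:R * s| < d ->
    `|rpow A l m x - rpow A s n x| <= eps.
Proof.
move=> clx T0 eps0; pose G := expR (2 * omega * T).
have G0 : 0 < G by exact: expR_gt0.
have e4 : 0 < eps / (4 * G) by rewrite divr_gt0// mulr_gt0.
have [y [[f Ayf]]] := clx _ (nbhsx_ballx x _ e4).
rewrite -ball_normE /= => xy.
pose L := G ^+ 2 * `|f|.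
have L0 : 0 <= L by rewrite mulr_ge0// sqr_ge0.
(* The free parameter of [rpow_dist]. Once q <= c^2, the bound (q/c + c)/2 is at most c, and L c <=
   eps/2. *)
pose c := eps / (2 * (L + 1)).
have c0 : 0 < c by rewrite divr_gt0// mulr_gt0// ltr_wpDl.
have Lc : L * c <= eps / 2.
  rewrite /c mulrA ler_pdivrMr; last by rewrite mulr_gt0// ltr_wpDl.
  by rewrite (_ : eps / 2 * (2 * (L + 1)) = L * eps + eps); [rewrite lerDl ltW|field].
have T1 : 0 < 1 + 2 * T by rewrite addr_gt0// mulr_gt0.
have w1 : 0 < omega + 1 by rewrite ltr_wpDl.
(* 1 gives (m l - n s)^2 <= d; the second term then gives q <= d (1 + 2 T) <= c^2; the third keeps
   the step times omega below 1/2. *)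
pose d := Num.min (Num.min 1 (c ^+ 2 / (1 + 2 * T))) (2^-1 / (omega + 1)).
have d0 : 0 < d by rewrite !lt_min ltr01 !divr_gt0// exprn_gt0.
exists d => // l s m n /andP[l0 ld] /andP[s0 sd] ml ns mn.
have dw r : 0 < r -> r < d -> r * omega <= 2^-1.
  rewrite lt_min => r0 /andP[_]; rewrite ltr_pdivlMr// => H.
  by apply: le_trans (ltW H); rewrite ler_pM2l//; lra.
have lw := dw _ l0 ld; have sw := dw _ s0 sd.
have lw1 : l * omega < 1 by lra.
have sw1 : s * omega < 1 by lra.
have gl := expR_resolvent_growth l0 lw ml.
have gs := expR_resolvent_growth s0 sw ns.
rewrite -/G in gl gs.
have lip r k : 0 < r -> r * omega < 1 -> 1 <= G * (1 - r * omega) ^+ k ->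
    `|rpow A r k x - rpow A r k y| <= eps / 4.
  move=> r0 rw g; have := rpow_lipschitz mA k x y r0 rw.
  move: (`|_ - rpow A r k y|) (normr_ge0 (rpow A r k x - rpow A r k y)) => a a0 H.
  have Gxy : G * `|x - y| <= eps / 4.
    move: xy; rewrite ltr_pdivlMr ?mulr_gt0// => /ltW.
    by move: (`|x - y|) => z; rewrite ler_pdivlMr// (_ : z * (4 * G) = G * z * 4)//; ring.
  apply: le_trans Gxy; apply: (@le_trans _ _ (G * ((1 - r * omega) ^+ k * a))).
    by rewrite mulrA ler_peMl.
  by rewrite ler_pM2l.
have h1 := lip _ _ l0 lw1 gl; have h2 := lip _ _ s0 sw1 gs.
have h3 : `|rpow A l m y - rpow A s n y| <= eps / 2.
  apply: le_trans Lc; have := rpow_dist w0 mA m n l0 s0 c0 lw1 sw1 Ayf.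
  set qq := _ + n%:R * s ^+ 2; move: (`|_ - rpow A s n y|) (normr_ge0 (rpow A l m y - rpow A s n y)) => a a0 H.
  have qd : qq <= c ^+ 2.
    have dc : d * (1 + 2 * T) <= c ^+ 2.
      by rewrite -ler_pdivlMr// /d !ge_min lexx orbT.
    have d1 : d <= 1 by rewrite /d !ge_min lexx.
    apply: le_trans dc; rewrite /qq.
    have : (m%:R * l - n%:R * s) ^+ 2 <= d.
      rewrite -real_normK ?num_real//; move: mn (normr_ge0 (m%:R * l - n%:R * s)).
      by move: (`|_|) => z zd z0; rewrite expr2; nra.
    have : m%:R * l ^+ 2 <= T * d.
      rewrite expr2 mulrA; apply: ler_pM => //; [|exact: ltW|exact: ltW].
      by rewrite mulr_ge0// ltW.
    have : n%:R * s ^+ 2 <= T * d.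
      rewrite expr2 mulrA; apply: ler_pM => //; [|exact: ltW|exact: ltW].
      by rewrite mulr_ge0// ltW.
    lra.
  have qc : (qq / c + c) / 2 <= c.
    rewrite ler_pdivrMr// -lerBrDr ler_pdivrMr//.
    by rewrite (_ : (c * 2 - c) * c = c ^+ 2)//; ring.
  have P1 : 1 <= (G * (1 - l * omega) ^+ m) * (G * (1 - s * omega) ^+ n).
    by apply: mulr_ege1.
  apply: (@le_trans _ _ ((G * (1 - l * omega) ^+ m) * (G * (1 - s * omega) ^+ n) * a)).
    by rewrite ler_peMl.
  rewrite [leLHS](_ : _ = G ^+ 2 * ((1 - l * omega) ^+ m * (1 - s * omega) ^+ n * a)); last by ring.
  rewrite /L -[leRHS]mulrA ler_pM2l ?exprn_gt0//; apply: le_trans H _.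
  by rewrite -mulrA ler_wpM2l.
rewrite (_ : rpow A l m x - rpow A s n x = (rpow A l m x - rpow A l m y) +
  (rpow A l m y - rpow A s n y) - (rpow A s n x - rpow A s n y)); last by module R X.
apply: le_trans (ler_normB _ _) _.
have := ler_normD (rpow A l m x - rpow A l m y) (rpow A l m y - rpow A s n y).
lra.
Qed.

Lemma trunc_approx t l : 0 <= t -> 0 < l ->
  (Num.truncn (t / l))%:R * l <= t /\ `|(Num.truncn (t / l))%:R * l - t| < l.
Proof.
move=> t0 l0; have tl0 : 0 <= t / l by rewrite divr_ge0// ltW.
have /andP[] := truncn_itv tl0; rewrite ler_pdivlMr// ltr_pdivrMr// => H1.
rewrite -natr1 mulrDl mul1r => H2; split=> //.
by rewrite ler0_norm ?subr_le0//; lra.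
Qed.

(** The limit is taken along steps 1/(k+1). The estimate is uniform in [t] and allows any step and
    any number of steps with m l near t; continuity of [u] and its approximation by Euler schemes
    both follow. *)
Lemma exponential_formula x : closure (op_dom A) x ->
  exists u : R -> X, forall T eps : R, 0 < T -> 0 < eps ->
    exists2 d, 0 < d & forall t l m, 0 <= t <= T -> 0 < l < d ->
      `|m%:R * l - t| < d -> `|rpow A l m x - u t| <= eps.
Proof.
move=> clx; pose h k : R := k.+1%:R^-1.
have h0 k : 0 < h k by rewrite invr_gt0.
pose a t k := rpow A (h k) (Num.truncn (t / h k)) x.
have hsmall d : 0 < d -> exists N, forall k, (N <= k)%N -> h k < d.
  move=> d0; exists (Num.truncn d^-1) => k Nk; rewrite /h invf_plt ?posrE//.
  apply: lt_le_trans (truncnS_gt _) _.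
  by rewrite ler_nat ltnS.
have acvg t : 0 <= t -> cvgn (a t).
  move=> t0; apply/cauchy_cvgP/cauchy_ballP => eps eps0.
  have e2 : 0 < eps / 2 by lra.
  have [d d0 H] := rpow_cauchy clx (ltr_pwDr ltr01 t0) e2.
  have [N HN] := hsmall (d / 2) ltac:(lra).
  rewrite near_map2; near=> k j.
  have hk : h k < d / 2 by apply: HN; near: k; exact: nbhs_infty_ge.
  have hj : h j < d / 2 by apply: HN; near: j; exact: nbhs_infty_ge.
  rewrite -ball_normE /=.
  have [k1 k2] := trunc_approx t0 (h0 k); have [j1 j2] := trunc_approx t0 (h0 j).
  apply: (@le_lt_trans _ _ (eps / 2)); last by lra.
  have hk0 := h0 k; have hj0 := h0 j.
  apply: H; [lra|lra|lra|lra|].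
  rewrite (_ : _ - _ = ((Num.truncn (t / h k))%:R * h k - t) - ((Num.truncn (t / h j))%:R * h j - t)); last by ring.
  apply: le_lt_trans (ler_normB _ _) _; lra.
exists (fun t => limn (a t)) => T eps T0 eps0.
have e2 : 0 < eps / 2 by lra.
(* The horizon is T + 1 because m l may exceed t by less than 1. *)
have [d d0 H] := rpow_cauchy clx (ltr_wpDr (ltW ltr01) T0) e2.
exists (Num.min 1 (d / 2)) => [|t l m /andP[t0 tT]].
  by rewrite lt_min ltr01 divr_gt0.
rewrite !lt_min => /andP[l0 /andP[l1 ld]] /andP[m1 md].
have /cvgrPdist_le /(_ _ e2)[N1 _ HN1] := acvg _ t0.
have [N2 HN2] := hsmall (d / 2) ltac:(lra).
have {}HN1 := HN1 (maxn N1 N2) (leq_maxl _ _).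
have {}HN2 := HN2 (maxn N1 N2) (leq_maxr _ _).
have [k1 k2] := trunc_approx t0 (h0 (maxn N1 N2)).
have hk0 := h0 (maxn N1 N2).
have : `|rpow A l m x - a t (maxn N1 N2)| <= eps / 2.
  apply: H; [lra|lra| |lra|].
    by have := ler_norm (m%:R * l - t); lra.
  rewrite (_ : _ - _ = (m%:R * l - t) - ((Num.truncn (t / h (maxn N1 N2)))%:R * h (maxn N1 N2) - t)); last by ring.
  apply: le_lt_trans (ler_normB _ _) _; lra.
move: HN1 => /=; rewrite distrC.
have := ler_normD (rpow A l m x - a t (maxn N1 N2)) (a t (maxn N1 N2) - limn (a t)).
rewrite addrA subrK; lra.
Unshelve. all: by end_near. Qed.

Lemma mild_solution_exists x : closure (op_dom A) x ->
  exists U : R -> X, mild_solution A x U.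
Proof.
move=> clx; have [U HU] := exponential_formula clx; exists U; split.
- apply/within_continuousP => t; rewrite /= in_itv/= andbT => t0 eps eps0.
  have e2 : 0 < eps / 2 by lra.
  have T0 : 0 < t + 1 by lra.
  have [d d0 H] := HU _ _ T0 e2.
  exists (Num.min 1 (d / 2)) => [|s]; first by rewrite lt_min ltr01 divr_gt0.
  rewrite in_itv/= andbT lt_min => s0 /andP[st1 std].
  (* [U t] and [U s] are compared with one and the same iterate, whose time m d/2 is within d of
     both. *)
  have l0 : 0 < d / 2 by lra.
  have [_ m2] := trunc_approx t0 l0; set m := Num.truncn _ in m2.
  have := H t (d / 2) m ltac:(apply/andP; split; lra) ltac:(apply/andP; split; lra).
  have := H s (d / 2) m ltac:(apply/andP; split; have := ler_norm (s - t); lra) ltac:(apply/andP; split; lra).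
  move: (rpow A (d / 2) m x) => v.
  have -> : `|m%:R * (d / 2) - s| < d.
    rewrite (_ : _ - s = (m%:R * (d / 2) - t) - (s - t)); last by ring.
    by apply: le_lt_trans (ler_normB _ _) _; lra.
  have -> : `|m%:R * (d / 2) - t| < d by lra.
  move=> /(_ isT) H1 /(_ isT) H2.
  have := ler_normB (v - U t) (v - U s).
  by rewrite (_ : v - U t - (v - U s) = U s - U t); [lra|module R X].
- apply/eqP; rewrite -subr_eq0 -normr_le0; apply/ler_addgt0Pl => eps eps0.
  rewrite addr0; have [d d0 H] := HU _ _ ltr01 eps0.
  rewrite distrC; apply: (H 0 (d / 2) 0%N); rewrite ?mul0r ?subr0 ?normr0//; lra.
- move=> T eps T0 eps0; have [d d0 H] := HU _ _ T0 eps0.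
  have w1 : 0 < omega + 1 by rewrite ltr_wpDl.
  (* An upper bound for the step: [d] for the exponential formula, [eps] for the mesh, the last term
     for l omega < 1. Then n > T/e, and the uniform scheme of step T/n, without perturbation, ends
     exactly at T. *)
  pose e := Num.min (Num.min d eps) (omega + 1)^-1.
  have e0 : 0 < e by rewrite !lt_min d0 eps0 invr_gt0.
  pose n := (Num.truncn (T / e)).+1.
  have n0 : 0 < n%:R :> R by rewrite ltr0n.
  pose l := T / n%:R.
  have l0 : 0 < l by rewrite divr_gt0.
  have le : l < e.
    by rewrite ltr_pdivrMr// mulrC -ltr_pdivrMr// truncnS_gt.
  move: (le); rewrite !lt_min => /andP[/andP[ld leps] lw'].
  have lw : l * omega < 1.
    move: lw'; rewrite -(ltr_pM2r w1) mulVf ?gt_eqF//; apply: le_lt_trans.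
    by rewrite ler_pM2l// lerDl.
  have step i : (i.+1%:R - i%:R) * l = l by rewrite -natr1 addrAC subrr add0r mul1r.
  exists n, (fun i => i%:R * l), (fun i => rpow A l i x), (fun=> 0).
  split; first split.
  + by rewrite mul0r.
  + by rewrite /l mulrCA divff ?gt_eqF// mulr1 lexx andbT; lra.
  + by move=> i _; rewrite -mulrBl step l0.
  + by rewrite big1// => i _; rewrite normr0 mulr0.
  + move=> i _; rewrite -mulrBl step sub0r -scalerN opprB.
    exact: (resolventP _ mA).
  + by rewrite distrC; apply: (H 0 l 0%N); rewrite ?mul0r ?subr0 ?normr0//; lra.
  + move=> i s ni /andP[is1 si]; rewrite distrC; apply: H.
    * apply/andP; split.
        by apply: ltW; apply: le_lt_trans is1; rewrite mulr_ge0// ltW.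
      apply: le_trans si _; rewrite /l mulrCA; apply: ler_piMr; first exact: ltW.
      by rewrite ler_pdivrMr// mul1r ler_nat.
    * by rewrite l0 ld.
    * by rewrite ger0_norm; have := step i; rewrite mulrBl; lra.
Qed.

End MildExistence.

(** * Two-sided estimates for an arbitrary mild solution *)

Section MildEstimates.
Variables (R : realType) (X : completeNormedModType R).
Variables (A : set (X * X)) (omega : R).
Hypotheses (w0 : 0 <= omega) (mA : m_accretive omega A).
Notation mu := (@lebesgue_measure R).
Variables (x : X) (U : R -> X).
Hypothesis mU : mild_solution A x U.
Implicit Types (y z : X) (v f : nat -> X) (T eps : R) (n : nat) (t : nat -> R).

Lemma euler_scheme_ge0 T eps n t v f i : euler_scheme A T eps n t v f ->
  (i <= n)%N -> 0 <= t i.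
Proof.
move=> [t0 _ ht _ _]; elim: i => [|i IH] iln; first by rewrite t0.
have /andP[+ _] := ht _ iln; have := IH (ltnW iln); lra.
Qed.

(** A discrete Gronwall inequality: accretivity against (y,z) gives (1 - h omega) |v_{i+1} - y| <=
    |v_i - y| + h |f_{i+1}| + h |z| at each step, and the factors are collected in the
    exponential. *)
Lemma euler_scheme_dist_le T eps n t v f y z : euler_scheme A T eps n t v f ->
  eps * omega <= 2^-1 -> A (y, z) -> 0 < eps -> 0 < T ->
  `|v n - y| <= expR (2 * omega * T) * (`|v 0%N - y| + (eps + T * `|z|)).
Proof.
move=> es ew Ayz eps0 T0; have [t0 /andP[_ tnT] ht hf hv] := es.
have main i : (i <= n)%N -> `|v i - y| <= expR (2 * omega * t i) *
    (`|v 0%N - y| + (\sum_(j < i) (t j.+1 - t j) * `|f j.+1| + t i * `|z|)).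
  elim: i => [|i IH] iln.
    by rewrite t0 mulr0 expR0 mul1r big_ord0 mul0r !addr0.
  have := IH (ltnW iln); rewrite big_ord_recr /=.
  set S := \sum_(j < i) _; set h := t i.+1 - t i.
  have /andP[h0 heps] := ht _ iln; rewrite -/h in h0 heps.
  have hw : h * omega <= 2^-1 by apply: le_trans ew; rewrite ler_wpM2r// ltW.
  have [acc _] := mA.
  have /acc/(_ Ayz h h0) := hv _ iln; rewrite -/h => /(_ ltac:(lra)).
  rewrite (_ : v i.+1 - y + _ = (v i - y) + h *: f i.+1 - h *: z); last first.
    by lcoefs R X; field; rewrite gt_eqF.
  move=> H1 H2.
  have ti : t i.+1 = t i + h by rewrite /h; ring.
  have ti0 := euler_scheme_ge0 es (ltnW iln).
  have H3 : (1 - h * omega) * `|v i.+1 - y| <= `|v i - y| + h * `|f i.+1| + h * `|z|.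
    apply: le_trans H1 _; apply: le_trans (ler_normB _ _) _.
    rewrite normrZ (gtr0_norm h0) lerD2r.
    by apply: le_trans (ler_normD _ _) _; rewrite normrZ (gtr0_norm h0).
  have h1 : 1%:R * h <= h by rewrite mul1r.
  have := @expR_resolvent_growth _ _ w0 h 1 h h0 hw h1; rewrite expr1.
  have -> : expR (2 * omega * t i.+1) = expR (2 * omega * t i) * expR (2 * omega * h).
    by rewrite -expRD ti mulrDr.
  have Ei1 : 1 <= expR (2 * omega * t i).
    by rewrite -expR0 ler_expR !mulr_ge0.
  have Eh0 : 0 < expR (2 * omega * h) by exact: expR_gt0.
  move: (expR (2 * omega * t i)) (expR (2 * omega * h)) H2 Ei1 Eh0 => Ei Eh H2 Ei1 Eh0 e1.
  have F0 : 0 <= h * `|f i.+1| by rewrite mulr_ge0// ltW.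
  have Z0 : 0 <= h * `|z| by rewrite mulr_ge0// ltW.
  apply: (@le_trans _ _ (Eh * ((1 - h * omega) * `|v i.+1 - y|))).
    by rewrite mulrA ler_peMl.
  rewrite (mulrC Ei) -mulrA ler_pM2l//; apply: le_trans H3 _.
  rewrite ti (mulrDl (t i)); move: H2; move: (t i * `|z|) => tz H2.
  have := ler_wpM2r F0 Ei1; have := ler_wpM2r Z0 Ei1; nra.
apply: le_trans (main n (leqnn n)) _.
have tn0 := euler_scheme_ge0 es (leqnn n).
have S0 : 0 <= \sum_(j < n) (t j.+1 - t j) * `|f j.+1|.
  by apply: sumr_ge0 => j _; rewrite mulr_ge0//; have /andP[/ltW] := ht j (ltn_ord j).
apply: ler_pM.
- exact: expR_ge0.
- by rewrite !addr_ge0// mulr_ge0.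
- by rewrite ler_expR ler_wpM2l// mulr_ge0.
- by rewrite lerD2l lerD ?(ltW hf)// ler_wpM2r.
Qed.

(** The last node of a scheme on [0,t] may fall short of [t]; continuity of [U] at [t] closes the
    gap. *)
Lemma mild_solution_small (t eps : R) : 0 < t -> 0 < eps ->
  exists n tt v f e, [/\ euler_scheme A t e n tt v f, [/\ 0 < e <= eps & e * omega <= 2^-1],
    0 < tt n <= t, `|x - v 0%N| <= eps &
    [/\ `|v n - U t| <= eps, `|x - v n| <= `|x - U t| + eps &
    forall i s, (i < n)%N -> tt i < s <= tt i.+1 -> `|U s - v i.+1| <= e]].
Proof.
move=> t0 eps0; have [cU U0 HU] := mU.
have e2 : 0 < eps / 2 by lra.
have tcy : `[0, +oo[%classic t by rewrite /= in_itv/= andbT ltW.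
have [d d0 Hd] := (within_continuousP _ _).1 cU t tcy _ e2.
have w1 : 0 < omega + 1 by rewrite ltr_wpDl.
(* The first two terms bound the error and e omega; [d] keeps the last node within the continuity
   radius of [t]; the bound by [t] makes that node positive, so the scheme has at least one step. *)
pose e := Num.min (Num.min (eps / 2) (2^-1 / (omega + 1))) (Num.min d t).
have e0 : 0 < e by rewrite !lt_min e2 d0 t0 !divr_gt0.
have [n [tt [v [f [es H0 H1]]]]] := HU t e t0 e0.
have ee : e <= eps / 2 by rewrite !ge_min lexx.
have ed : e <= d by rewrite !ge_min lexx !orbT.
have et : e <= t by rewrite !ge_min lexx !orbT.
have ew : e * omega <= 2^-1.
  have : e <= 2^-1 / (omega + 1) by rewrite !ge_min lexx !orbT.
  rewrite ler_pdivlMr//; apply: le_trans; by rewrite ler_pM2l// lerDl.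
have [tt0 /andP[ttn1 ttn2] ht _ _] := es.
have ttn0 : 0 < tt n by lra.
have n0 : (0 < n)%N by case: (n) ttn0 => //; rewrite tt0 ltxx.
have vU : `|U (tt n) - v n| <= e.
  case: n n0 ht H1 {es ttn1 ttn2 ttn0} => // n _ ht H1.
  by apply: H1 => //; rewrite lexx andbT; have /andP[+ _] := ht n (ltnSn n); lra.
have UU : `|U (tt n) - U t| <= eps / 2.
  apply: Hd; first by rewrite /= in_itv/= andbT ltW.
  by rewrite ler0_norm ?subr_le0//; lra.
have vUt : `|v n - U t| <= eps.
  rewrite (_ : v n - U t = (U (tt n) - U t) - (U (tt n) - v n)); last by module R X.
  by apply: le_trans (ler_normB _ _) _; lra.
exists n, tt, v, f, e; split=> //.
- by split=> //; apply/andP; split=> //; lra.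
- by rewrite ttn0 ttn2.
- by rewrite -U0; apply: le_trans H0 _; lra.
- split=> //.
  rewrite (_ : x - v n = (x - U t) - (v n - U t)); last by module R X.
  by apply: le_trans (ler_normB _ _) _; lra.
Qed.

Lemma mild_solution_dist_le (t : R) y z : 0 < t -> A (y, z) ->
  `|x - U t| <= (1 + expR (2 * omega * t)) * (`|x - y| + t * `|z|).
Proof.
move=> t0 Ayz; set G := expR _; have G0 : 0 < G by exact: expR_gt0.
have z0 : 0 <= t * `|z| by rewrite mulr_ge0// ltW.
apply/ler_addgt0Pr => eps eps0.
(* The errors add up to 1 + 2 G times this quantity. *)
have e4 : 0 < eps / (2 * (1 + G)) by rewrite divr_gt0// mulr_gt0// addr_gt0.
have [n [tt [v [f [e [es [/andP[e0 ee] ew] _ xv0 [vU _ _]]]]]]] := mild_solution_small t0 e4.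
have := euler_scheme_dist_le es ew Ayz e0 t0; rewrite -/G => H.
have H1 : `|v 0%N - y| <= eps / (2 * (1 + G)) + `|x - y|.
  rewrite (_ : v 0%N - y = - (x - v 0%N) + (x - y)); last by module R X.
  by apply: le_trans (ler_normD _ _) _; rewrite normrN lerD2r.
have H2 : `|x - U t| <= `|x - y| + `|v n - y| + `|v n - U t|.
  rewrite (_ : x - U t = (x - y) - (v n - y) + (v n - U t)); last by module R X.
  by apply: le_trans (ler_normD _ _) _; rewrite lerD2r ler_normB.
have H3 : `|v n - y| <= G * (eps / (2 * (1 + G)) + `|x - y| + (eps / (2 * (1 + G)) + t * `|z|)).
  by apply: le_trans H _; rewrite ler_pM2l//; lra.
apply: le_trans H2 _; apply: le_trans (lerD (lerD (lexx _) H3) vU) _.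
set k := eps / _; have : 2 * ((1 + G) * k) = eps.
  by rewrite /k; field; rewrite gt_eqF// addr_gt0.
move: (`|x - y|) (normr_ge0 (x - y)) => a a0; have := divr_gt0 eps0 G0.
rewrite -/k in e4; move: k e4 => k k0; nra.
Qed.

(** Let y = J_T x. Accretivity between a step of the scheme and the pair (y, (x - y)/T), with
    parameter T h/(T + h), gives (T + h - T h omega) |v_{i+1} - y| <= h |v_{i+1} - x| + T |v_i - y|
    + T h |f_{i+1}|. Inserting |v_{i+1} - y| >= |x - y| - |v_{i+1} - x| produces the factor 2, and
    the sum over i telescopes. *)
Lemma euler_scheme_resolvent_ineq T eps n t v f : 0 < T -> T * omega < 1 ->
  euler_scheme A T eps n t v f ->
  T * (`|v n - resolvent A T x| - `|v 0%N - resolvent A T x|) <=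
  2 * (\sum_(i < n) (t i.+1 - t i) * `|v i.+1 - x|) -
  t n * ((1 - T * omega) * `|x - resolvent A T x|) + T * eps.
Proof.
move=> T0 Tw es; have [t0 _ ht hf hv] := es; set y := resolvent A T x.
suff main i : (i <= n)%N -> T * (`|v i - y| - `|v 0%N - y|) <=
    2 * (\sum_(j < i) (t j.+1 - t j) * `|v j.+1 - x|) -
    t i * ((1 - T * omega) * `|x - y|) +
    T * (\sum_(j < i) (t j.+1 - t j) * `|f j.+1|).
  by apply: le_trans (main n (leqnn n)) _; rewrite lerD2l ler_pM2l// ltW.
elim: i => [|i IH] iln.
  by rewrite subrr t0 !big_ord0 !mulr0 mul0r subr0 addr0.
have := IH (ltnW iln); rewrite !big_ord_recr /=.
have /andP[h0 _] := ht _ iln; have := hv _ iln.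
have -> : t i.+1 = t i + (t i.+1 - t i) by ring.
rewrite (_ : t i + (t i.+1 - t i) - t i = t i.+1 - t i); last by ring.
move: (t i.+1 - t i) h0 => h h0.
set S1 := \sum_(j < i) _ * `|v _ - x|; set S2 := \sum_(j < i) _ * `|f _|.
move=> Av' H1.
have Th0 : 0 < T + h by rewrite addr_gt0.
have nu0 : 0 < T * h / (T + h) by rewrite divr_gt0// mulr_gt0.
have nuw : T * h / (T + h) * omega < 1.
  by rewrite mulrAC ltr_pdivrMr//; nra.
have [acc _] := mA.
have := acc _ _ _ _ Av' (resolventP x mA T0 Tw) _ nu0 nuw; rewrite -/y.
rewrite -(ler_pM2l Th0) mulrA mulrBr mulr1 (_ : (T + h) * _ = T * h * omega); last first.
  by field; rewrite gt_eqF.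
rewrite -[X in _ <= X * _](gtr0_norm Th0) -normrZ.
rewrite (_ : (T + h) *: _ = h *: (v i.+1 - x) + T *: (v i - y) + (T * h) *: f i.+1); last first.
  by lcoefs R X; field; rewrite !gt_eqF.
move=> /le_trans/(_ (ler_normD _ _)).
have := ler_normD (h *: (v i.+1 - x)) (T *: (v i - y)).
rewrite !normrZ (gtr0_norm h0) (gtr0_norm T0) => H2 H3.
have : `|x - y| <= `|v i.+1 - x| + `|v i.+1 - y|.
  by rewrite (distrC (v i.+1) x); apply: le_trans (ler_normD _ _); rewrite addrA subrK.
have hw : 0 < h * (1 - T * omega) by rewrite mulr_gt0// subr_gt0.
move=> /(ler_wpM2l (ltW hw)).
have := mulr_ge0 (ltW (mulr_gt0 h0 T0)) (mulr_ge0 w0 (normr_ge0 (v i.+1 - x))).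
move: (`|x - y|) (`|v i.+1 - x|) (`|v i.+1 - y|) (`|f i.+1|) (`|v i - y|) H1 H2 H3 => a b c d e H1 H2 H3 H4 H5.
rewrite (mulrDl (t i)); lra.
Qed.

Lemma mild_solution_integrable (t : R) y :
  mu.-integrable `]0, t] (EFin \o (fun s => `|U s - y|)).
Proof.
have [cU _ _] := mU.
apply: (@integrableS _ _ _ mu `[0, t]) => //.
  by apply: subset_itvr; rewrite bnd_simp.
apply: continuous_compact_integrable; first exact: segment_compact.
apply/within_continuousP => s s0t eps eps0.
have s0y : `[0, +oo[%classic s.
  by move: s0t; rewrite /= !in_itv/= andbT => /andP[].
have [d d0 H] := (within_continuousP _ _).1 cU s s0y _ eps0.
exists d => // r r0t rs; apply: le_trans (ler_dist_dist _ _) _.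
rewrite (_ : U r - y - (U s - y) = U r - U s); last by module R X.
by apply: H => //; move: r0t; rewrite /= !in_itv/= andbT => /andP[].
Qed.

(** The sum is a Riemann sum: on the i-th interval [U] stays within [eps] of v_{i+1}. *)
Lemma euler_scheme_sum_le T eps n t v f : euler_scheme A T eps n t v f ->
  (forall i s, (i < n)%N -> t i < s <= t i.+1 -> `|U s - v i.+1| <= eps) ->
  \sum_(i < n) (t i.+1 - t i) * `|v i.+1 - x| <=
  (\int[mu]_(s in `]0%R, (t n)]) `|U s - x|) + t n * eps.
Proof.
move=> es HU; have [t0 _ ht hf hv] := es.
suff main i : (i <= n)%N -> \sum_(j < i) (t j.+1 - t j) * `|v j.+1 - x| <=
    (\int[mu]_(s in `]0%R, (t i)]) `|U s - x|) + t i * eps by exact: main.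
elim: i => [|i IH] iln.
  by rewrite big_ord0 t0 mul0r addr0; apply: Rintegral_ge0.
rewrite big_ord_recr /=; apply: le_trans (lerD (IH (ltnW iln)) (lexx _)) _.
have ti0 := euler_scheme_ge0 es (ltnW iln).
have /andP[h0 _] := ht _ iln.
have IB : (\int[mu]_(s in `]0%R, (t i.+1)]) `|U s - x|) -
    (\int[mu]_(s in `]0%R, (t i)]) `|U s - x|) =
    \int[mu]_(s in `](t i), (t i.+1)]) `|U s - x|.
  apply: Rintegral_itvB; first exact: mild_solution_integrable.
    by rewrite bnd_simp.
  by rewrite bnd_simp; lra.
have int : mu.-integrable `](t i), (t i.+1)] (EFin \o (fun s => `|U s - x|)).
  apply: integrableS (mild_solution_integrable (t i.+1) x) => //.
  by apply: subset_itvr; rewrite bnd_simp.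
have : \int[mu]_(s in `](t i), (t i.+1)]) (`|v i.+1 - x| - eps) <=
    \int[mu]_(s in `](t i), (t i.+1)]) `|U s - x|.
  apply: le_Rintegral => //.
    exact: itv_integrable_cst.
  move=> s; rewrite /= in_itv/= => /(HU _ _ iln).
  rewrite lerBlDr (_ : v i.+1 - x = (U s - x) - (U s - v i.+1)); last by module R X.
  by move=> H; apply: le_trans (ler_normB _ _) _; rewrite lerD2l.
rewrite -IB Rintegral_cst//= lebesgue_measure_itv/= lte_fin -subr_gt0 h0 -EFinB /=; lra.
Qed.

(** The limit of [euler_scheme_resolvent_ineq] along ever finer schemes, with the horizon equal to
    the resolvent parameter. *)
Lemma mild_solution_resolvent_le (t : R) : 0 < t -> t * omega < 1 ->
  (1 - t * omega) * `|x - resolvent A t x| <=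
  `|x - U t| + 2 * (t^-1 * \int[mu]_(s in `]0%R, t[) `|U s - x|).
Proof.
move=> t0 tw; set I := \int[mu]_(s in _) _.
rewrite -(ler_pM2l t0) mulrDr (_ : t * (2 * (t^-1 * I)) = 2 * I); last first.
  by field; rewrite gt_eqF.
apply/ler_addgt0Pr => eps eps0; set y := resolvent A t x.
pose a := (1 - t * omega) * `|x - y|.
have a0 : 0 <= a by rewrite mulr_ge0// subr_ge0 ltW.
(* The error budget: 2 t from the two ends of the scheme, 2 t from twice the Riemann sum, t from the
   perturbations, and [a] from the last node lying before [t]. *)
have C0 : 0 < 5 * t + a by lra.
have e0 : 0 < eps / (5 * t + a) by rewrite divr_gt0.
have eC : (5 * t + a) * (eps / (5 * t + a)) = eps by rewrite mulrC mulfVK// gt_eqF.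
move: (eps / (5 * t + a)) e0 eC => d d0 dC.
have [n [tt [v [f [e [es [/andP[e0 ee] ew] /andP[tn0 tnt] xv0 [vU xvn H1]]]]]]] := mild_solution_small t0 d0.
have := euler_scheme_resolvent_ineq t0 tw es; rewrite -/y -/a => H2.
have H3 := euler_scheme_sum_le es H1.
have H4 : \int[mu]_(s in `]0%R, (tt n)]) `|U s - x| <= I.
  rewrite /I Rintegral_itv_bndo_bndc; last first.
    apply: integrableS (mild_solution_integrable t x) => //.
    by apply: subset_itvl; rewrite bnd_simp.
  apply: ge0_le_Rintegral_subset => //; last exact: mild_solution_integrable.
  by apply: subset_itvl; rewrite bnd_simp.
have [_ /andP[tne _] _ _ _] := es.
have H5 : `|x - y| <= `|x - v n| + `|v n - y|.
  by apply: le_trans (ler_normD _ _); rewrite addrA subrK.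
have H6 : `|v 0%N - y| <= `|x - y| + `|x - v 0%N|.
  by rewrite (distrC x (v 0%N)) (addrC `|x - y|); apply: le_trans (ler_normD _ _); rewrite addrA subrK.
have H7 : t * (- `|x - U t| - 2 * d) <= t * (`|v n - y| - `|v 0%N - y|).
  by rewrite ler_pM2l//; lra.
have H8 : tt n * e <= t * d by apply: ler_pM => //; exact: ltW.
have H9 : (t - d) * a <= tt n * a by rewrite ler_wpM2r//; lra.
have H10 : t * e <= t * d by rewrite ler_pM2l.
move: (tt n * a) H9 H2 => ta H9 H2; rewrite -/a.
have : 0 <= a * d by rewrite mulr_ge0// ltW.
rewrite mulrBr in H2; rewrite mulrBr in H7; nra.
Qed.

End MildEstimates.

Section Semigroup.
Variables (R : realType) (X : completeNormedModType R) (E : banachFunctionSpace R).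
Notation mu := (@lebesgue_measure R).

Lemma bfs_car_semigroup (A : set (X * X)) (omega tau : R) (x : X) :
  0 <= omega -> m_accretive omega A -> hardy_bounded E -> 0 < tau ->
  tau * omega < 1 -> closure (op_dom A) x ->
  bfs_car E ((fun t => `|x - semigroup A t x| / t) \_ `]0, tau[) <->
  bfs_car E (kquot A x \_ `]0, tau[).
Proof.
move=> w0 mA hE tau0 tauw clx; pose S : set R := `]0, tau[%classic.
(* [semigroup] picks a mild solution by choice; existence ensures that the chosen function is
   one. *)
pose U := xget (fun=> x) [set u | mild_solution A x u].
have mU : mild_solution A x U.
  by have [V mV] := mild_solution_exists w0 mA clx; apply: (xgetPex (fun=> x)); exists V.
rewrite (_ : (fun t => `|x - semigroup A t x| / t) = (fun t => `|x - U t| / t))//.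
have A0 := op_dom_neq0 x mA tau0 tauw.
have S0 : S `<=` `]0, +oo[ by exact: itv0_pos.
have SP t : S t -> 0 < t /\ t < tau by rewrite /S /= in_itv/= => /andP[].
have mS : measurable S by exact: measurable_itv.
have mpsi : measurable_fun S (fun t => `|x - U t| / t).
  apply: measurable_funM; last exact: measurable_inv_pos.
  have /integrableP[/measurable_EFinP m _] := mild_solution_integrable mU tau x.
  rewrite (_ : (fun _ => _) = (fun t => `|U t - x|)); last first.
    by apply/funext => t; rewrite distrC.
  apply: measurable_funS m => //.
  by apply: subset_itvl; rewrite bnd_simp.
have mk : measurable_fun S (kquot A x) by exact: measurable_kquot.
split=> [Epsi|Ek].
- have c1 t : S t -> t * omega < 1 /\ 1 <= (1 - tau * omega)^-1 * (1 - t * omega).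
    move=> /SP[t0 tt]; have tw : t * omega <= tau * omega by rewrite ler_wpM2r// ltW.
    split; first exact: le_lt_trans tauw.
    by rewrite ler_pdivlMl ?subr_gt0// mulr1; lra.
  apply: (@bfs_car_resolvent _ _ E A omega _ (BLeft tau) x w0 mA A0 c1).1.
  pose psi := (fun t => `|x - U t| / t) \_ S.
  have := bfs_carZ (1 - tau * omega)^-1
    (bfs_carD Epsi (bfs_carZ 2 (bfs_car_hardy hE Epsi))).
  apply: bfs_car_le.
    apply: measurable_patch => //; apply: measurable_resolvent_dist w0 mA _ _.
    by move=> t St; have [? _] := c1 _ St; have [? _] := SP _ St.
  apply: ae_posW => t t0; rewrite patchE; case: ifPn => [/set_mem St|_]; last by rewrite normr0.
  have [tw c1t] := c1 _ St; have [_ tt] := SP _ St.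
  rewrite ger0_norm ?divr_ge0 ?(ltW t0)//; apply: le_trans (ler_norm _).
  rewrite /= -/S -/psi ler_pdivlMl ?subr_gt0//.
  have := mild_solution_resolvent_le w0 mA mU t0 tw; rewrite -/psi.
  have psit : psi t = `|x - U t| / t by rewrite /psi patchE mem_set.
  have psii : mu.-integrable `]0, t[ (EFin \o psi).
    have := bfs_locally_integrable tau Epsi (measurable_patch mS mpsi).
    by apply: integrableS => //; apply: subset_itvl; rewrite bnd_simp ltW.
  (* For s < t, |U s - x|/t <= |U s - x|/s. After a further division by t the right-hand side is the
     Hardy transform of [psi]. *)
  have : t^-1 * \int[mu]_(s in `]0, t[) `|U s - x| <= \int[mu]_(s in `]0, t[) psi s.
    rewrite -RintegralZl//; last first.
      apply: integrableS (mild_solution_integrable mU t x) => //.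
      by apply: subset_itvl; rewrite bnd_simp.
    apply: le_Rintegral => //.
      rewrite (_ : _ \o _ = (fun s => t^-1%:E * (EFin \o (fun s => `|U s - x|%R)) s)%E)//.
      apply: integrableZl => //.
      apply: integrableS (mild_solution_integrable mU t x) => //.
      by apply: subset_itvl; rewrite bnd_simp.
    move=> s; rewrite /= in_itv/= => /andP[s0 st].
    rewrite /psi patchE mem_set/=; last by rewrite /S /= in_itv/= s0 (lt_trans st).
    by rewrite distrC mulrC ler_wpM2l// lef_pV2// ltW.
  rewrite /hardy; move: (\int[mu]_(s in _) psi s) => Ip H1.
  move: (t^-1 * _) H1 => Iu H1 H2.
  rewrite psit.
  have J0 : 0 <= `|x - resolvent A t x| / t by rewrite divr_ge0// ltW.
  apply: (@le_trans _ _ ((1 - t * omega) * (`|x - resolvent A t x| / t))).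
    by rewrite ler_wpM2r// lerD2l lerN2 ler_wpM2r// ltW.
  rewrite mulrA ler_pdivrMr// (mulrDl _ _ t) mulfVK ?gt_eqF//.
  apply: le_trans H2 _; rewrite lerD2l -mulrA ler_pM2l// mulrAC mulVf ?gt_eqF//.
  by rewrite mul1r.
- apply: (@bfs_car_dom _ E S (kquot A x) _ 0 (1 + expR (2 * omega * tau)) 0) => //.
    by left.
  apply: ae_posW => t t0 /SP[_ tt]; rewrite addr0 ger0_norm ?divr_ge0 ?(ltW t0)//.
  have G0 : 0 < 1 + expR (2 * omega * tau) by rewrite addr_gt0// expR_gt0.
  rewrite -ler_pdivrMl//; apply: kquot_ge => // y z Ayz.
  rewrite ler_pdivrMl// ler_pdivrMr//.
  apply: le_trans (mild_solution_dist_le w0 mA mU t0 Ayz) _.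
  rewrite -[leRHS]mulrA (mulrDl _ _ t) mulfVK ?gt_eqF// (mulrC `|z| t).
  apply: ler_wpM2r; first by rewrite addr_ge0// mulr_ge0// ltW.
  by rewrite lerD2l ler_expR ler_wpM2l ?(ltW tt)// mulr_ge0.
Qed.

End Semigroup.

(** * Variation of the resolvent *)

Section LipschitzDensity.
Variable R : realType.
Notation mu := (@lebesgue_measure R).

Lemma lebesgue_stieltjes_measure_ocE (F : cumulative R R) (a b : R) : a <= b ->
  lebesgue_stieltjes_measure F `]a, b]%classic = (F b - F a)%:E.
Proof.
move=> ab; rewrite /lebesgue_stieltjes_measure /measure_extension/=.
by rewrite measurable_mu_extE/=; [rewrite wlength_itv_bnd|exact: is_ocitv].
Qed.

Lemma lipschitz_right_continuous (F : R -> R) (L : R) :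
  (forall s t, s <= t -> `|F t - F s| <= L * (t - s)) -> right_continuous F.
Proof.
move=> FL; apply: right_continuousW => t.
apply: (@locally_lipschitz_continuous _ _ _ _ L); near=> s.
have [st|/ltW ts] := leP s t; last by rewrite (ger0_norm (_ : 0 <= s - t)) ?subr_ge0// FL.
by rewrite distrC (distrC s) (ger0_norm (_ : 0 <= t - s)) ?subr_ge0// FL.
Unshelve. all: by end_near. Qed.

Lemma ocitv_measure_ext (F : cumulative R R) (m : {measure set (measurableTypeR R) -> \bar R}) :
  (forall a b, a < b -> m `]a, b]%classic = (F b - F a)%:E) ->
  forall A, measurable A -> lebesgue_stieltjes_measure F A = m A.
Proof.
move=> mF; apply: lebesgue_stieltjes_measure_unique => Y /ocitvP[->|[[a b] /= ab ->]].
  by rewrite !measure0.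
by rewrite mF// lebesgue_stieltjes_measure_ocE// ltW.
Qed.

(** Both [F] and L t - F(t) are nondecreasing, and their Stieltjes measures add up to L times
    Lebesgue measure. *)
Lemma lipschitz_dominates (F : cumulative R R) (L : R) : 0 <= L ->
  (forall s t, s <= t -> F t - F s <= L * (t - s)) ->
  lebesgue_stieltjes_measure F `<< mu.
Proof.
move=> L0 FL; pose G t := L * t - F t; pose H t := L * t.
have ndF s t : s <= t -> F s <= F t by exact: cumulative_is_nondecreasing.
have Glip s t : s <= t -> `|G t - G s| <= L * (t - s).
  move=> st; have := FL _ _ st; have := ndF _ _ st.
  by rewrite /G mulrBr => ? ?; rewrite ger0_norm; lra.
have Hlip s t : s <= t -> `|H t - H s| <= L * (t - s).
  by move=> st; rewrite /H -mulrBr ger0_norm// mulr_ge0// subr_ge0.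
have ndG : nondecreasing G.
  by move=> s t st; have := FL _ _ st; rewrite /G; lra.
have ndH : nondecreasing H by move=> s t st; exact: ler_wpM2l.
pose cG : cumulative R R := HB.pack G
  (isCumulative.Build R _ R G ndG (lipschitz_right_continuous Glip)).
pose cH : cumulative R R := HB.pack H
  (isCumulative.Build R _ R H ndH (lipschitz_right_continuous Hlip)).
pose mF := lebesgue_stieltjes_measure F; pose mG := lebesgue_stieltjes_measure cG.
have H1 := @ocitv_measure_ext cH (measure_add mF mG).
have H2 := @ocitv_measure_ext cH (mscale (NngNum L0) mu).
apply/null_content_dominatesP => A mA A0.
have {}H1 : (lebesgue_stieltjes_measure cH A = mF A + mG A)%E.
  rewrite H1// => [|a b /ltW ab]; first exact: measure_addE.
  transitivity (mF `]a, b]%classic + mG `]a, b]%classic)%E; first exact: measure_addE.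
  rewrite /mF /mG !lebesgue_stieltjes_measure_ocE// -EFinD.
  by congr EFin; rewrite /= /G /H; ring.
have {}H2 : (lebesgue_stieltjes_measure cH A = L%:E * mu A)%E.
  rewrite H2// => a b ab.
  by rewrite /= /mscale/= lebesgue_measure_itv/= lte_fin ab -EFinB -EFinM mulrBr.
move/eqP: H1; rewrite H2 A0 mule0 eq_sym padde_eq0//; first by move=> /andP[/eqP].
Qed.

(** The density is a Radon-Nikodym derivative. The values 0 and 1 at the two ends make the Stieltjes
    measure a finite one. *)
Lemma lipschitz_cumulative_density (F : R -> R) (a b L : R) : 0 <= L ->
  (forall s t, s <= t -> 0 <= F t - F s <= L * (t - s)) ->
  (forall t, t <= a -> F t = 0) -> (forall t, b <= t -> F t = 1) ->
  exists2 g : R -> R, mu.-integrable setT (EFin \o g) &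
    forall s t, s <= t -> F t - F s = \int[mu]_(r in `]s, t]) g r.
Proof.
move=> L0 FL F0 F1.
have ndF : nondecreasing F.
  by move=> s t /FL /andP[+ _]; rewrite subr_ge0.
have lipF s t : s <= t -> `|F t - F s| <= L * (t - s).
  by move=> /FL /andP[Fst0 FstL]; rewrite ger0_norm.
have FNy : F @ -oo --> (0 : R).
  by apply: cvg_near_cst; exists a; split; [exact: num_real|move=> t /ltW; exact: F0].
have Fy : F @ +oo --> (1 : R).
  by apply: cvg_near_cst; exists b; split; [exact: num_real|move=> t /ltW; exact: F1].
pose mixF := isCumulative.Build R _ R F ndF (lipschitz_right_continuous lipF).
pose mixB := isCumulativeBounded.Build R 0 1 F FNy Fy.
pose cF : cumulativeBounded (0 : R) (1 : R) := HB.pack F mixF mixB.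
have [f [f0 ffin fi fE]] := @radon_nikodym_sigma_finite _ _ R mu
  (lebesgue_stieltjes_measure cF)
  (@lipschitz_dominates cF L L0 (fun s t st => proj2 (andP (FL s t st)))).
exists (fine \o f).
  by rewrite (_ : _ \o _ = f)//; apply/funext => t; rewrite /= fineK.
move=> s t st; apply: EFin_inj.
have -> : (\int[mu]_(r in `]s, t]) (fine \o f) r)%:E = (\int[mu]_(r in `]s, t]) f r)%E.
  rewrite /Rintegral (eq_integral f); last by move=> r _; rewrite /= fineK.
  by rewrite fineK//; apply: integrable_fin_num => //; apply: integrableS fi.
have mst : measurable (`]s, t]%classic : set (measurableTypeR R)) by exact: measurable_itv.
by have := fE _ mst => <-; rewrite /= lebesgue_stieltjes_measure_ocE.
Qed.

Lemma lipschitz_ftc (V : R -> R) (a b L : R) : a < b -> 0 <= L ->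
  (forall s t, a <= s -> s <= t -> t <= b -> 0 <= V t - V s <= L * (t - s)) ->
  exists k : R -> R, [/\ mu.-integrable `]a, b[ (EFin \o k),
    V b - V a = \int[mu]_(r in `]a, b[) k r &
    {ae mu, forall t, a < t < b -> derivable V t 1 /\ derive1 V t = k t}].
Proof.
(* Clamping to [a,b] extends [V] to the whole line by constants. *)
move=> ab L0 VL; pose c t := Num.max a (Num.min b t).
have ca t : a <= c t by rewrite le_max lexx.
have cb t : c t <= b by rewrite ge_max ge_min lexx ltW.
have cE t : a <= t -> t <= b -> c t = t by move=> at' tb; rewrite /c min_r// max_r.
have clip s t : s <= t -> 0 <= c t - c s <= t - s.
  move=> st; rewrite /c; case: (leP b t) => ?; case: (leP b s) => ?.
  - by case: (leP a b) => ?; lra.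
  - by case: (leP a b) => ?; case: (leP a s) => ?; lra.
  - by case: (leP a b) => ?; case: (leP a t) => ?; lra.
  - by case: (leP a t) => ?; case: (leP a s) => ?; lra.
have M0 : 0 < V b - V a + (b - a).
  by have /andP[? _] := VL a b (lexx _) (ltW ab) (lexx _); lra.
(* Adding t - a keeps the total increase [M] positive even for constant V, so that division by [M]
   normalises to the values 0 and 1; the density of V is then M g - 1. *)
pose M := V b - V a + (b - a); rewrite -/M in M0.
pose F t := (V (c t) - V a + (c t - a)) / M.
have FL s t : s <= t -> 0 <= F t - F s <= (L + 1) / M * (t - s).
  move=> st; have /andP[c0 c1] := clip _ _ st.
  have /andP[V0 V1] := VL (c s) (c t) (ca _) ltac:(lra) (cb _).
  rewrite /F -mulrBl mulrAC; apply/andP; split; first by rewrite divr_ge0//; lra.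
  by rewrite ler_pM2r ?invr_gt0//; have := ler_wpM2l L0 c1; lra.
have L1 : 0 <= (L + 1) / M by rewrite divr_ge0 ?(ltW M0)// addr_ge0.
have Fa t : t <= a -> F t = 0.
  by move=> ta; rewrite /F /c max_l ?ge_min ?ta ?orbT// !subrr addr0 mul0r.
have Fb t : b <= t -> F t = 1.
  by move=> bt; rewrite /F /c min_l// max_r ?ltW// divff// gt_eqF.
have [g gi gE] := lipschitz_cumulative_density L1 FL Fa Fb.
have gi' D : measurable D -> mu.-integrable D (EFin \o g).
  by move=> mD; apply: integrableS gi.
have icst : mu.-integrable `]a, b[ (EFin \o cst (1 : R)) by exact: itv_integrable_cst.
have iMg : mu.-integrable `]a, b[ (EFin \o (fun t => M * g t)).
  rewrite (_ : _ \o _ = (fun s => M%:E * (EFin \o g) s)%E)//.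
  by apply: integrableZl => //; exact: gi'.
exists (fun t => M * g t - 1); split.
- rewrite (_ : _ \o _ = (EFin \o (fun t => M * g t)%R) \- (EFin \o cst 1%R))%E//.
  exact: integrableB.
- rewrite RintegralB// RintegralZl//; last exact: gi'.
  rewrite Rintegral_itv_bndo_bndc; last exact: gi'.
  rewrite -gE ?(ltW ab)// (Fa a)// (Fb b)// subr0 mulr1.
  rewrite Rintegral_cst//= lebesgue_measure_itv/= lte_fin ab -EFinB/= /M.
  ring.
have lg : locally_integrable setT g.
  by apply: open_integrable_locally => //; exact: openT.
have HF := @FTC1 _ g (BRight a) (fun y => gi' _ (measurable_itv _)) lg.
apply: ae_filterS HF => t H /andP[at' tb].
have [dH Hg] := H at'.
have near_eq : \forall s \near t, M * (\int[mu]_(r in `]a, s]) g r) - s + (a + V a) = V s.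
  near=> s.
  have as' : a <= s by apply: ltW; near: s; apply: (@cvgr_gt _ _ _ _ id t); [exact: cvg_id|].
  have sb : s <= b by apply: ltW; near: s; apply: (@cvgr_lt _ _ _ _ id t); [exact: cvg_id|].
  rewrite -gE// (Fa a)// subr0 /F cE//; field; by rewrite gt_eqF.
have dI : is_derive t 1 (fun s => \int[mu]_(r in `]a, s]) g r : R) (g t).
  by apply: DeriveDef => //; rewrite -derive1E.
have dV : is_derive t 1 (V : R -> R) (M * g t - 1).
  apply: near_eq_is_derive near_eq _.
  apply: is_derive_eq.
  by rewrite addr0.
by split; [exact: ex_derive|rewrite derive1E derive_val].
Unshelve. all: by end_near. Qed.

End LipschitzDensity.

(** * Density of a monotone, locally Lipschitz function *)

Section LocalDensity.
Variable R : realType.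
Notation mu := (@lebesgue_measure R).

Lemma derivable_cvg_seq (v : R -> R) (t : R) (u : nat -> R) : derivable v t 1 ->
  u @ \oo --> 0 -> (forall n, u n != 0) ->
  (fun n => (u n)^-1 * (v (u n + t) - v t)) @ \oo --> derive1 v t.
Proof.
move=> dv u0 un0.
have dvt : h^-1 *: (v (h + t) - v t) @[h --> 0^'] --> derive1 v t.
  have := dv; rewrite /derivable /derive1 => /cvg_ex[l vl].
  have E : (fun h => h^-1 *: (v (h + t) - v t)) =
      (fun h => h^-1 *: ((v \o shift t) (h *: (1 : R)) - v t)).
    by apply/funext => h; rewrite /= /shift/= scaler1.
  by rewrite E; rewrite (cvg_lim _ vl).
have u0' : u @ \oo --> 0^'.
  move=> P; rewrite /nbhs/= /dnbhs => /nbhs_ballP[d /= d0 dP].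
  have /cvgrPdist_lt/(_ _ d0) := u0; apply: filterS => n /=.
  by move=> und; apply: dP; [rewrite -ball_normE|exact: un0].
exact: (cvg_comp _ _ u0' dvt).
Qed.

(** Applied to (0,tau) and to (0,oo). The Lipschitz constant may depend on the interval, hence may
    explode at 0. *)
Variables (S : set R) (v : R -> R).
Hypotheses (mS : measurable S) (iS : is_interval S) (S0 : S `<=` `]0, +oo[).
Hypothesis S_open : forall t, S t -> exists2 t', S t' & t < t'.
Hypothesis S_down : forall s t, 0 < s -> s <= t -> S t -> S s.
Hypothesis vlip : forall a b, S a -> S b -> exists2 L, 0 <= L &
  forall s t, a <= s -> s <= t -> t <= b -> 0 <= v t - v s <= L * (t - s).

Let Spos t : S t -> 0 < t.
Proof. by move=> /S0; rewrite /= in_itv/= andbT. Qed.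

(** Intervals with rational ends in [S] cover [S]; each contributes a null set, and [pickle]
    enumerates them. *)
Let ae_derivable : {ae mu, forall t, S t -> derivable v t 1}.
Proof.
pose P (p : nat) (t : R) := if unpickle p is Some (r1, r2) then
  S (ratr r1) -> S (ratr r2) -> ratr r1 < t < ratr r2 -> derivable v t 1 else True.
have /ae_foralln : forall p, {ae mu, forall t, P p t}.
  move=> p; rewrite /P; case: (unpickle p) => [[r1 r2]|]; last first.
    exact: (@filterE _ _ (ae_filter_ringOfSetsType mu)).
  have [Sr|] := pselect (S (ratr r1) /\ S (ratr r2)); last first.
    by move=> nS; apply: (@filterE _ _ (ae_filter_ringOfSetsType mu)) => t S1 S2; case: nS.
  have [r12|r12] := ltP (ratr r1 : R) (ratr r2); last first.
    apply: (@filterE _ _ (ae_filter_ringOfSetsType mu)) => t _ _ /andP[t1 t2].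
    by have := lt_trans t1 t2; rewrite ltNge r12.
  have [L L0 HL] := vlip Sr.1 Sr.2.
  have [k [_ _]] := lipschitz_ftc r12 L0 HL.
  by apply: ae_filterS => t Ht _ _ /Ht[].
apply: ae_filterS => t HP St.
have [t' St' tt'] := S_open St.
have [q2] := rat_in_itvoo tt'; rewrite in_itv/= => /andP[tq2 q2t'].
have [q1] := rat_in_itvoo (Spos St); rewrite in_itv/= => /andP[q10 q1t].
have := HP (pickle (q1, q2)); rewrite /P pickleK; apply.
- exact: S_down (ltW q1t) St.
- by apply: S_down (ltW q2t') St'; exact: lt_trans (Spos St) tq2.
- by rewrite q1t.
Qed.

Let h (n : nat) : R := n.+1%:R^-1.
Let h0 n : 0 < h n. Proof. by rewrite invr_gt0. Qed.

(** Left difference quotients. Outside [S] the function is set to 0, which makes every quotient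
    measurable and is harmless for large n, when t - h n lies in [S]. *)
Let q (n : nat) (t : R) : R := n.+1%:R * (v t - (v \_ S) (t - h n)).

Let mv : measurable_fun S v.
Proof.
rewrite -(opprK v); apply/measurable_funN.
apply: is_interval_nonincreasing_measurable => // s t Ss St st.
have [L L0 H] := vlip Ss St; have /andP[+ _] := H s t (lexx _) st (lexx _).
by rewrite /= lerN2 subr_ge0.
Qed.

Let mq n : measurable_fun S (q n).
Proof.
apply: measurable_funM; first exact: measurable_cst.
apply: measurable_funB => //.
apply: (@measurable_comp _ _ _ _ _ _ setT) => //.
  by apply/(measurable_restrictT _ _).1.
by apply: measurable_funB => //; exact: measurable_cst.
Qed.

(** A version of the derivative that is measurable and nonnegative on all of [S], including the
    points where [v] has no derivative. *)
Let k (t : R) : R := `|fine (limn_esup (fun n => (q n t)%:E))|.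

Let mk : measurable_fun S k.
Proof.
apply: measurableT_comp => //; apply: measurableT_comp => //.
by apply: measurable_fun_limn_esup => n; exact/measurable_EFinP.
Qed.

Let k_derive1 t : S t -> derivable v t 1 -> derive1 v t = k t.
Proof.
move=> St dv.
have hcvg : (fun n => - h n) @ \oo --> (0 : R).
  by rewrite -oppr0; apply: cvgN; exact: cvg_harmonic.
have := derivable_cvg_seq dv hcvg (fun n => ltac:(by rewrite oppr_eq0 gt_eqF)).
set w := (fun n => _) => wcvg.
have near_q : \forall n \near \oo, q n t = w n /\ 0 <= w n.
  near=> n.
  have hn : h n < t.
    by near: n; apply: (@cvgr_lt _ _ _ _ h 0); [exact: cvg_harmonic|exact: Spos].
  have Sth : S (t - h n).
    by apply: (S_down _ _ St); [rewrite subr_gt0|rewrite lerBlDr lerDl ltW].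
  have thn : t - h n <= t by rewrite lerBlDr lerDl ltW.
  have [L L0 H] := vlip Sth St; have /andP[v0 _] := H _ _ (lexx _) thn (lexx _).
  have wE : w n = n.+1%:R * (v t - v (t - h n)).
    by rewrite /w invrN invrK (addrC _ t) mulNr -mulrN opprB.
  by rewrite /q patchE mem_set// wE mulr_ge0.
have dv0 : 0 <= derive1 v t.
  rewrite -(cvg_lim _ wcvg)//; apply: limr_ge.
    by apply/cvg_ex; exists (derive1 v t).
  by apply: filterS near_q => n [].
have qcvg : (fun n => (q n t)%:E) @ \oo --> (derive1 v t)%:E.
  apply: cvg_EFin; first exact: nearW.
  apply: cvg_trans wcvg; apply: near_eq_cvg.
  by apply: filterS near_q => n [<- _].
by rewrite /k (cvg_limn_einf_sup qcvg) /= ger0_norm.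
Unshelve. all: by end_near. Qed.

(** The density given by [lipschitz_ftc] depends on the interval, but equals the derivative almost
    everywhere; [k] replaces all of them. *)
Lemma locally_lipschitz_density : exists k : R -> R,
  [/\ measurable_fun S k, forall t, 0 <= k t,
    {ae mu, forall t, S t -> derivable v t 1 /\ derive1 v t = k t} &
    forall a b, S a -> S b -> a < b -> mu.-integrable `]a, b[ (EFin \o k) /\
      v b - v a = \int[mu]_(r in `]a, b[) k r].
Proof.
have kd : {ae mu, forall t, S t -> derivable v t 1 /\ derive1 v t = k t}.
  move: ae_derivable; apply: ae_filterS => t H St.
  by have dv := H St; split=> //; exact: k_derive1.
exists k; split; [exact: mk|by move=> t; exact: normr_ge0|exact: kd|].
move=> a b Sa Sb ab.
have [L L0 HL] := vlip Sa Sb.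
have [k' [ik' vk' dk']] := lipschitz_ftc ab L0 HL.
have abS : `]a, b[ `<=` S.
  move=> t /=; rewrite in_itv/= => /andP[at' tb].
  by apply: S_down (ltW tb) Sb; exact: lt_trans (Spos Sa) at'.
have kk' : ae_eq mu (`]a, b[%classic : set R) (EFin \o k') (EFin \o k).
  move: kd dk'; apply: (@filterS2 _ _ (ae_filter_ringOfSetsType mu)) => t H1 H2 tab.
  have [_ E1] := H1 (abS _ tab); move: tab; rewrite /= in_itv/= => /H2[_ E2].
  by rewrite -E1 -E2.
have mkab : measurable_fun (`]a, b[%classic : set R) (EFin \o k).
  by apply/measurable_EFinP; apply: measurable_funS mk.
have /integrableP[mk' ik'oo] := ik'.
split; last first.
  by rewrite vk' /Rintegral; congr fine; apply: ae_eq_integral.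
apply/integrableP; split=> //; apply: le_lt_trans ik'oo.
rewrite le_eqVlt; apply/orP; left; apply/eqP/esym; apply: ae_eq_integral => //.
- exact: measurableT_comp.
- exact: measurableT_comp.
- by move: kk'; apply: ae_filterS => t H /H /= [->].
Qed.

End LocalDensity.

(** * Variation functions *)

Section Variation.
Variables (R : realType) (X : completeNormedModType R) (f : R -> X).

Lemma le_variation s t : 0 <= s -> s <= t -> ((`|f t - f s|%R)%:E <= Defs.variation f t)%E.
Proof.
move=> s0 st; apply: ereal_sup_ubound; exists 1%N, (fun i => if i is 0 then s else t).
by split=> //= [[]//|]; rewrite big_ord1.
Qed.

Lemma variation_ge0 t : 0 <= t -> (0 <= Defs.variation f t)%E.
Proof.
by move=> t0; apply: le_trans (le_variation t0 (lexx t)); rewrite lee_fin.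
Qed.

Lemma variation0 : Defs.variation f 0 = 0%E.
Proof.
apply/eqP; rewrite eq_le variation_ge0// andbT.
apply: ge_ereal_sup => _ [n [p [p0 pi pn ->]]]; rewrite lee_fin big1// => i _.
have pz j : (j <= n)%N -> p j = 0.
  move=> jn; apply/eqP; rewrite eq_le; apply/andP; split.
    apply: le_trans pn; move: n pi jn {i}; elim=> [|n IH] pi; first by rewrite leqn0 => /eqP->.
    rewrite leq_eqVlt => /orP[/eqP->//|]; rewrite ltnS => jn.
    by apply: le_trans (pi n (ltnSn n)); apply: IH => // j' j'n; exact/pi/ltnW.
  elim: j jn => [//|j IH] jn; apply: le_trans (pi j jn); exact/IH/ltnW.
by rewrite !pz ?subrr ?normr0// ltnW.
Qed.

Lemma variation_le s t : s <= t -> (Defs.variation f s <= Defs.variation f t)%E.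
Proof.
move=> st; apply: ereal_sup_le => _ [n [p [p0 pi pn ->]]].
by exists n, p; split=> //; exact: le_trans st.
Qed.

(** [Phi] is a majorant of the increments on [s,t]: a linear function for the local Lipschitz bound,
    a primitive of the K-quotient for bounds starting at 0. *)
Lemma variation_split (Phi : R -> R) s t : 0 <= s -> s <= t ->
  (forall a b, s <= a -> a <= b -> b <= t -> `|f b - f a| <= Phi b - Phi a) ->
  (Defs.variation f t <= Defs.variation f s + (Phi t - Phi s)%R%:E)%E.
Proof.
move=> s0 st fPhi; apply: ge_ereal_sup => _ [n [p [p0 pi pn ->]]].
have pt i : (i <= n)%N -> p i <= t.
  move=> iln; apply: le_trans pn; elim: n iln pi => [|n IH]; first by rewrite leqn0 => /eqP->.
  rewrite leq_eqVlt => /orP[/eqP->//|]; rewrite ltnS => /IH{}IH pi.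
  by apply: le_trans (pi n (ltnSn n)); apply: IH => j jn; exact/pi/ltnW.
(* Truncation at [s] cuts the partition in two: [lo] is a partition of [0,s], and along [hi] the
   increments of [Phi] telescope. *)
pose lo i := Num.min (p i) s; pose hi i := Num.max (p i) s.
have lohi i : (i < n)%N -> `|f (p i.+1) - f (p i)| <=
    `|f (lo i.+1) - f (lo i)| + `|f (hi i.+1) - f (hi i)|.
  move=> /pi; rewrite /lo /hi; case: (leP (p i) s) => p1; case: (leP (p i.+1) s) => p2 p12.
  - by rewrite lerDl.
  - by rewrite (addrC `|f s - _|); apply: le_trans (ler_normD _ _); rewrite addrA subrK.
  - by have := lt_le_trans p1 p12; rewrite ltNge p2.
  - by rewrite lerDr.
have low : ((\sum_(i < n) `|f (lo i.+1) - f (lo i)|)%R%:E <= Defs.variation f s)%E.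
  apply: ereal_sup_ubound; exists n, lo; split=> //.
  - by rewrite le_min p0.
  - by move=> i /pi pii; rewrite le_min !ge_min pii lexx orbT.
  - by rewrite ge_min lexx orbT.
have high : \sum_(i < n) `|f (hi i.+1) - f (hi i)| <= Phi t - Phi s.
  have hit : hi n <= t by rewrite ge_max pn st.
  have hi0 i : s <= hi i by rewrite le_max lexx orbT.
  have PhiM a b : s <= a -> a <= b -> b <= t -> Phi a <= Phi b.
    by move=> sa ab bt; rewrite -subr_ge0; apply: le_trans (fPhi _ _ sa ab bt).
  apply: (@le_trans _ _ (\sum_(i < n) (Phi (hi i.+1) - Phi (hi i)))).
    apply: ler_sum => i _; apply: fPhi => //.
      by have pii := pi i (ltn_ord i); rewrite ge_max !le_max pii lexx orbT.
    by rewrite ge_max pt//= st.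
  rewrite -(big_mkord xpredT (fun i => Phi (hi i.+1) - Phi (hi i))) telescope_sumr//.
  by apply: lerB; apply: PhiM => //; rewrite ge_max st pt.
move: high; rewrite -lee_fin => high; apply: le_trans (leeD low high).
by rewrite -EFinD lee_fin -big_split /=; apply: ler_sum => i _; exact: lohi.
Qed.

End Variation.

(** * Derivative of the variation of the resolvent curve *)

Section ResolventVariation.
Variables (R : realType) (X : completeNormedModType R) (E : banachFunctionSpace R).
Notation mu := (@lebesgue_measure R).
Variables (A : set (X * X)) (omega c : R) (x : X).
Hypotheses (w0 : 0 <= omega) (mA : m_accretive omega A) (hE : hardy_bounded E).
(** [Q] holds the right ends T for which absolute continuity on [0,T) is required: T = tau when S =
    (0,tau), and every T > 0 when S = (0,oo). *)
Variables (S : set R) (Q : R -> Prop).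
Hypotheses (mS : measurable S) (iS : is_interval S) (S0 : S `<=` `]0, +oo[).
Hypothesis S_open : forall t, S t -> exists2 t', S t' & t < t'.
Hypothesis S_down : forall s t, 0 < s -> s <= t -> S t -> S s.
Hypothesis Sc : forall t, S t -> t * omega < 1 /\ 1 <= c * (1 - t * omega).
Hypothesis QS : forall T, Q T -> 0 < T /\ forall t, 0 < t -> t < T -> S t.
Hypothesis SQ : forall t, S t -> exists2 T, Q T & t < T.
Hypothesis A0 : op_dom A !=set0.

Let V := Var_resolvent A x.
Let v : R -> R := fine \o V.
Let kappa := kquot A x.
Let C := 2 * c ^+ 2.

Let Spos t : S t -> 0 < t.
Proof. by move=> /S0; rewrite /= in_itv/= andbT. Qed.

Let C0 : 0 <= C. Proof. by rewrite mulr_ge0// sqr_ge0. Qed.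

Let kappa0 t : S t -> 0 <= kappa t.
Proof. by move=> /Spos; exact: kquot_ge0. Qed.

Let J_diff s t : 0 <= s -> s <= t -> S t ->
  `|resolvent A t x - resolvent A s x| <= C * (t - s) * kappa t.
Proof.
move=> s0 st St; have [tw c1] := Sc St.
exact: (resolvent_diff_kquot x w0 mA s0 st (Spos St) tw c1).
Qed.

(** On [s,t] the increments of the curve have the Lipschitz constant C kappa(s), since kappa is
    nonincreasing. *)
Let V_step s t : S s -> s <= t -> S t ->
  (V t <= V s + (C * kappa s * (t - s))%:E)%E.
Proof.
move=> Ss st St; have s0 := Spos Ss.
rewrite mulrBr; apply: (@variation_split _ _ _ (fun r => C * kappa s * r)) => //.
  exact: ltW.
move=> a b sa ab bt; have b0 : 0 < b by exact: lt_le_trans s0 (le_trans sa ab).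
have Sb : S b by exact: S_down St.
apply: le_trans (J_diff (le_trans (ltW s0) sa) ab Sb) _.
rewrite -mulrBr mulrAC; apply: ler_wpM2r; first by rewrite subr_ge0.
by apply: ler_wpM2l => //; apply: kquot_nincr => //; exact: le_trans ab.
Qed.

Let v_step : (forall t, S t -> V t \is a fin_num) -> forall s t, S s -> s <= t -> S t ->
  0 <= v t - v s <= C * kappa s * (t - s).
Proof.
move=> Vfin s t Ss st St; have Vs := Vfin _ Ss; have Vt := Vfin _ St.
rewrite subr_ge0; apply/andP; split; first by apply: fine_le => //; exact: variation_le.
by have := V_step Ss st St; rewrite -(fineK Vs) -(fineK Vt) -EFinD lee_fin lerBlDl.
Qed.

Let v_density : (forall t, S t -> V t \is a fin_num) -> exists k : R -> R,
  [/\ measurable_fun S k, forall t, 0 <= k t,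
    {ae mu, forall t, S t -> derivable v t 1 /\ derive1 v t = k t} &
    forall a b, S a -> S b -> a < b -> mu.-integrable `]a, b[ (EFin \o k) /\
      v b - v a = \int[mu]_(r in `]a, b[) k r].
Proof.
move=> Vfin; apply: locally_lipschitz_density => // a b Sa Sb.
exists (C * kappa a) => [|s t as' st tb]; first by rewrite mulr_ge0// kappa0.
have s0 : 0 < s := lt_le_trans (Spos Sa) as'.
have St : S t by apply: S_down tb Sb; exact: lt_le_trans st.
have Ss : S s by exact: S_down st St.
have /andP[-> /=] := v_step Vfin Ss st St; move=> /le_trans; apply.
rewrite ler_wpM2r ?subr_ge0// ler_wpM2l//; apply: kquot_nincr => //.
exact: Spos.
Qed.

(** Quotients to the right of [t] are used, because [v_step] takes kappa at the left end of the
    interval. *)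
Let derive1_le : (forall t, S t -> V t \is a fin_num) -> forall t, S t ->
  derivable v t 1 -> derive1 v t <= C * kappa t.
Proof.
move=> Vfin t St dv; pose h (n : nat) : R := n.+1%:R^-1.
have h0 n : 0 < h n by rewrite invr_gt0.
have hcvg : h @ \oo --> (0 : R) by exact: cvg_harmonic.
have wcvg := derivable_cvg_seq dv hcvg (fun n => lt0r_neq0 (h0 n)).
rewrite -(cvg_lim _ wcvg)//; apply: limr_le; first by apply/cvg_ex; exists (derive1 v t).
have [t' St' tt'] := S_open St.
near=> n.
have hn : h n < t' - t.
  by near: n; apply: (@cvgr_lt _ _ _ _ h 0); [exact: hcvg|rewrite subr_gt0].
have thn : t <= h n + t by rewrite lerDr ltW.
have Sth : S (h n + t).
  apply: (S_down _ _ St'); last lra.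
  by rewrite addr_gt0//; exact: Spos.
rewrite ler_pdivrMl// mulrC.
by have /andP[_] := v_step Vfin St thn Sth; rewrite addrK.
Unshelve. all: by end_near. Qed.

Lemma bfs_car_variation_kquot : (forall T, Q T -> fin_abs_cont T V) ->
  bfs_car E (derive1 (v : R -> R^o) \_ S) -> bfs_car E (kappa \_ S).
Proof.
move=> VAC Ev.
have Vfin t : S t -> V t \is a fin_num.
  move=> St; have [T QT tT] := SQ St; have [+ _] := VAC _ QT; apply.
  by rewrite (ltW (Spos St)).
have [k [mk k0 dk vk]] := v_density Vfin.
have Ek : bfs_car E (k \_ S).
  apply: bfs_car_ae Ev; move: dk; apply: ae_filterS => t H _.
  by rewrite !patchE; case: ifPn => // /set_mem/H[].
have mkS := measurable_patch mS mk.
apply: bfs_car_le (bfs_carZ 2 (bfs_car_hardy hE Ek)).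
  by apply: measurable_patch => //; exact: measurable_kquot.
apply: ae_posW => t t0; rewrite patchE; case: ifPn => [/set_mem St|_]; last by rewrite normr0.
have [tw c1] := Sc St.
rewrite ger0_norm ?kappa0//; apply: le_trans (ler_norm _); rewrite /=.
apply: le_trans (kquot_le_resolvent x mA t0 tw) _; rewrite ler_pM2l//.
rewrite /hardy mulrC ler_pM2l ?invr_gt0//.
have ik := bfs_locally_integrable t Ek mkS.
have vt : `|x - resolvent A t x| <= v t.
  rewrite -lee_fin (fineK (Vfin _ St)) distrC -{2}(resolvent0 A x).
  exact: (@le_variation _ _ (fun l => resolvent A l x) 0 t (lexx _) (ltW t0)).
(* It remains to bound [v t] by the integral of the density over (0,t). [vk] concerns intervals
   (a,t) with a > 0; absolute continuity on the single interval (0,a), with v 0 = 0, makes [v a]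
   small. *)
apply: le_trans vt _; apply/ler_addgt0Pr => eps eps0.
have [T QT tT] := SQ St; have [T0 HT] := QS QT.
have [VT AC] := VAC _ QT; have [d d0 Hd] := AC _ eps0.
pose a := Num.min (d / 2) (t / 2).
have a0 : 0 < a by rewrite lt_min !divr_gt0.
have ad : a < d by rewrite gt_min; apply/orP; left; lra.
have at' : a < t by rewrite gt_min; apply/orP; right; lra.
have va : v a < eps.
  have := Hd 1%N (fun=> 0) (fun=> a); rewrite !big_ord1 subr0 => /(_ _ _ ad).
  have v0 : v 0 = 0 by rewrite /v /V /Var_resolvent /= variation0.
  have va0 : 0 <= v a by rewrite fine_ge0// variation_ge0// ltW.
  rewrite -/v v0 subr0 ger0_norm//; apply.
    by move=> i; split; rewrite /= ?in_itv/= ?lexx ?T0 ?(ltW a0) ?(lt_trans at' tT).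
  by move=> i j; rewrite !ord1 eqxx.
have Sa : S a by exact: S_down (ltW at') St.
have [_ vta] := vk _ _ Sa St at'.
have : \int[mu]_(r in `]a, t[) k r <= \int[mu]_(r in `]0, t[) (k \_ S) r.
  rewrite (_ : \int[mu]_(r in `]a, t[) k r = \int[mu]_(r in `]a, t[) (k \_ S) r); last first.
    apply: eq_Rintegral => r; rewrite inE/= in_itv/= => /andP[ar rt].
    by rewrite patchE mem_set//; apply: (S_down _ (ltW rt) St); exact: lt_trans ar.
  apply: ge0_le_Rintegral_subset => //.
  - by apply: subset_itvr; rewrite bnd_simp ltW.
  - by move=> r _; rewrite patchE; case: ifPn.
rewrite -vta; lra.
Qed.

Let Ioc t : R := \int[mu]_(r in `]0%R, t]) kappa r.

Let integrable_kappa T : bfs_car E (kappa \_ S) -> S T \/ Q T ->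
  mu.-integrable `]0, T[ (EFin \o kappa).
Proof.
move=> Ek ST; apply: (@integrable_kquot _ _ E) => //.
apply: bfs_car_le Ek.
  by apply: measurable_patch => //; exact: (measurable_kquot x A0 (@itv0_pos _ _)).
apply: ae_posW => t t0; rewrite !patchE; case: ifPn => [|_]; last by rewrite normr0.
rewrite inE/= in_itv/= => /andP[_ tT]; rewrite mem_set//.
by case: ST => [ST|/QS[_]]; [exact: S_down (ltW tT) ST|exact].
Qed.

Let integrable_kappa_oc t : bfs_car E (kappa \_ S) -> S t ->
  mu.-integrable `]0, t] (EFin \o kappa).
Proof.
move=> Ek St; have [t' St' tt'] := S_open St.
apply: integrableS (integrable_kappa Ek (or_introl St')) => //.
by apply: subset_itvl; rewrite bnd_simp.
Qed.

Let Ioc_ge s t : bfs_car E (kappa \_ S) -> 0 <= s -> s <= t -> S t ->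
  (t - s) * kappa t <= Ioc t - Ioc s.
Proof.
move=> Ek s0 st St; have it := integrable_kappa_oc Ek St.
rewrite /Ioc Rintegral_itvB ?bnd_simp//.
have := @Rintegral_cst _ _ _ mu `]s, t] (measurable_itv _) (kappa t).
rewrite /= lebesgue_measure_itv/= lte_fin.
move: st; rewrite le_eqVlt => /orP[/eqP->|st].
  by move=> _; rewrite subrr mul0r set_itvoc0 Rintegral_set0.
rewrite st -EFinB /= mulrC => <-.
apply: le_Rintegral => //.
- exact: itv_integrable_cst.
- by apply: integrableS it => //; apply: subset_itvr; rewrite bnd_simp.
- move=> r /=; rewrite in_itv/= => /andP[sr rt]; apply: kquot_nincr => //.
  exact: le_lt_trans sr.
Qed.

(** Unlike [V_step], this bound starts at s = 0, where kappa may be unbounded: (b - a) kappa(b) is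
    at most the integral of kappa over (a,b). *)
Let V_le s t : bfs_car E (kappa \_ S) -> 0 <= s -> s <= t -> S t ->
  (V t <= V s + (C * Ioc t - C * Ioc s)%:E)%E.
Proof.
move=> Ek s0 st St; apply: (@variation_split _ _ _ (fun r => C * Ioc r)) => //.
move=> a b sa; rewrite le_eqVlt => /orP[/eqP-> _|ab bt]; first by rewrite !subrr normr0.
have Sb : S b by apply: S_down bt St; exact: le_lt_trans (le_trans s0 sa) ab.
apply: le_trans (J_diff (le_trans s0 sa) (ltW ab) Sb) _.
by rewrite -mulrA -mulrBr ler_wpM2l//; exact: (Ioc_ge Ek (le_trans s0 sa) (ltW ab) Sb).
Qed.

Let V0 : V 0 = 0%E.
Proof. exact: variation0. Qed.

Let V_fin t : bfs_car E (kappa \_ S) -> S t -> V t \is a fin_num.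
Proof.
move=> Ek St; have t0 := ltW (Spos St).
rewrite ge0_fin_numE ?variation_ge0//.
by apply: le_lt_trans (V_le Ek (lexx _) t0 St) _; rewrite V0 add0e ltry.
Qed.

Let V_abs_cont T : bfs_car E (kappa \_ S) -> Q T -> fin_abs_cont T V.
Proof.
move=> Ek QT; have [T0 HT] := QS QT.
have fin0 t : 0 <= t < T -> V t \is a fin_num.
  rewrite le_eqVlt => /andP[/orP[/eqP<-|t0] tT]; first by rewrite V0.
  exact/V_fin/HT.
split=> //.
have ki : mu.-integrable `]0, T[ (EFin \o kappa) by apply: integrable_kappa => //; right.
apply: (@abs_cont_integral _ _ _ kappa C) => //.
  by move=> t /andP[t0 tT]; apply: kappa0; exact: HT.
move=> a b a0 ab bT.
have Sb : S b by apply: HT => //; exact: le_lt_trans ab.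
have va : V a \is a fin_num by apply: fin0; rewrite a0 (lt_trans ab).
have vb : V b \is a fin_num by apply: fin0; rewrite (ltW (le_lt_trans a0 ab)).
rewrite ger0_norm; last by rewrite subr_ge0 fine_le// variation_le// ltW.
have := V_le Ek a0 (ltW ab) Sb.
rewrite -(fineK va) -(fineK vb) -EFinD lee_fin -lerBlDl -mulrBr => /le_trans; apply.
rewrite ler_wpM2l// /Ioc Rintegral_itvB ?bnd_simp//; last 2 first.
- exact: integrable_kappa_oc.
- exact: ltW.
rewrite -Rintegral_itv_bndo_bndc//; apply: integrableS ki => //.
by move=> t /=; rewrite !in_itv/= => /andP[at' tb]; rewrite (le_lt_trans a0 at') (lt_trans tb bT).
Qed.

Lemma bfs_car_kquot_variation : bfs_car E (kappa \_ S) ->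
  (forall T, Q T -> fin_abs_cont T V) /\ bfs_car E (derive1 (v : R -> R^o) \_ S).
Proof.
move=> Ek; split=> [T QT|]; first exact: V_abs_cont.
have Vf t : S t -> V t \is a fin_num by exact: V_fin.
have [k [mk k0 dk vk]] := v_density Vf.
apply: (@bfs_car_ae _ E (k \_ S)).
  move: dk; apply: ae_filterS => t H _.
  by rewrite !patchE; case: ifPn => // /set_mem/H[].
apply: (@bfs_car_dom _ E S kappa _ 0 C 0) => //; first by left.
move: dk; apply: ae_filterS => t H _ St.
have [dv kv] := H St.
by rewrite addr0 ger0_norm// -kv; exact: derive1_le.
Qed.

Lemma resolvent_variation_kquot :
  (forall T, Q T -> fin_abs_cont T V) /\ bfs_car E (derive1 (v : R -> R^o) \_ S) <->
  bfs_car E (kappa \_ S).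
Proof.
by split=> [[VAC]|]; [exact: bfs_car_variation_kquot|exact: bfs_car_kquot_variation].
Qed.

End ResolventVariation.

(** * Mean methods *)

Section StrongMeasurability.
Variables (R : realType) (X : completeNormedModType R).
Notation mu := (@lebesgue_measure R).

Lemma simple_fun_comp (p : R -> nat) (N : nat) (c : nat -> X) :
  (forall t, (p t <= N)%N) -> (forall k, measurable (p @^-1` [set k])) ->
  simple_fun (c \o p).
Proof.
move=> pN mp; split.
  apply: (@sub_finite_set _ _ (c @` `I_N.+1)).
    by move=> _ [t _ <-]; exists (p t) => //=; rewrite ltnS.
  exact/finite_image/finite_II.
move=> y; rewrite (_ : _ @^-1` _ = \bigcup_(k in c @^-1` [set y]) (p @^-1` [set k])).
  by apply: bigcup_measurable => k _; exact: mp.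
by apply/seteqP; split=> [t /= ct|t [k /= ck pk]]; [exists (p t)|rewrite pk].
Qed.

Lemma continuous_strongly_measurable (u : R -> X) :
  {within `[0, +oo[, continuous u} -> strongly_measurable `]0, +oo[ u.
Proof.
move=> /within_continuousP cu.
(* Index 0 stands for the complement of (0,n), with value 0; the cells of length 1/(n+1) are
   numbered from 1 and carry the value of [u] at their left end. *)
pose p (n : nat) (t : R) : nat :=
  if (0 < t) && (t < n%:R) then (Num.truncn (t * n.+1%:R)).+1 else 0%N.
pose c (n k : nat) : X := if k is k'.+1 then u (k'%:R / n.+1%:R) else 0.
exists (fun n => c n \o p n); split.
  move=> n; apply: (@simple_fun_comp _ (n * n.+1).+1).
    move=> t; rewrite /p; case: ifP => // /andP[t0 tn]; rewrite ltnS.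
    rewrite -(@ler_nat R) natrM; apply: (@le_trans _ _ (t * n.+1%:R)).
      by have /andP[] := truncn_itv (mulr_ge0 (ltW t0) (ler0n R n.+1)).
    by rewrite ler_wpM2r// ltW.
  case=> [|k].
    rewrite (_ : _ @^-1` _ = ~` `]0, n%:R[%classic).
      by apply: measurableC; exact: measurable_itv.
    apply/seteqP; split=> t /=; rewrite /p in_itv/=.
      by case: ifP.
    by move/negP/negbTE => ->.
  rewrite (_ : _ @^-1` _ = `]0, n%:R[%classic `&` `[(k%:R / n.+1%:R), (k.+1%:R / n.+1%:R)[%classic).
    by apply: measurableI; exact: measurable_itv.
  apply/seteqP; split=> t /=; rewrite /p !in_itv/= ler_pdivrMr// ltr_pdivlMr//.
    case: ifP => // /andP[t0 tn] [<-]; split=> //.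
    exact: (truncn_itv (mulr_ge0 (ltW t0) (ler0n R n.+1))).
  move=> [/andP[t0 tn] ktk]; rewrite t0 tn; congr _.+1.
  by apply/eqP; rewrite truncn_eq// mulr_ge0// ltW.
apply: (@filterE _ _ (ae_filter_ringOfSetsType mu)) => t.
rewrite /= in_itv/= andbT => t0; apply/cvgrPdist_le => eps eps0.
have t0y : `[0, +oo[%classic t by rewrite /= in_itv/= andbT ltW.
have [d d0 Hd] := cu t t0y _ eps0.
near=> n.
have tn : t < n%:R by near: n; exact: nbhs_infty_gtr.
have nd : n.+1%:R^-1 < d by near: n; exact: near_infty_natSinv_lt (PosNum d0).
rewrite /p t0 tn /= distrC.
have n0 : 0 < n.+1%:R^-1 :> R by rewrite invr_gt0.
have [k1 k2] := trunc_approx (ltW t0) n0.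
rewrite invrK in k1 k2.
apply: Hd; last exact: lt_trans nd.
by rewrite /= in_itv/= andbT divr_ge0.
Unshelve. all: by end_near. Qed.

End StrongMeasurability.

Section MeanMethod.
Variables (R : realType) (X : completeNormedModType R) (E : banachFunctionSpace R).
Notation mu := (@lebesgue_measure R).
Notation pos := (`]0, +oo[%classic : set R).

Lemma bfs_enorm_ge0 (F : R -> \bar R) : (0 <= bfs_enorm E F)%E.
Proof.
apply: le_ereal_inf_tmp => _ [g [Eg _] <-]; rewrite lee_fin.
exact: bfs_norm_ge0.
Qed.

Lemma bfs_enormD_lty (F G : R -> \bar R) :
  (bfs_enorm E F + bfs_enorm E G < +oo)%E ->
  (bfs_enorm E F < +oo)%E /\ (bfs_enorm E G < +oo)%E.
Proof.
have F0 := bfs_enorm_ge0 F; have G0 := bfs_enorm_ge0 G.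
by case: (bfs_enorm E F) (bfs_enorm E G) F0 G0 => [r| |] [s| |]//= _ _ _; rewrite !ltry.
Qed.

(** A majorant in [E] is only almost everywhere measurable; [h] can be integrated and handed to the
    Hardy operator. *)
Lemma bfs_car_norm_version (g : R -> R) : bfs_car E g -> exists h,
  [/\ measurable_fun pos h, bfs_car E h, forall t, 0 <= h t &
      ae_pos (fun t => `|g t| = h t)].
Proof.
move=> Eg; have [g1 [g2 [ig1 mg2 _ gE]]] := bfs_L1_add_Linf Eg.
have mh : measurable_fun pos (g1 \+ g2).
  by apply: measurable_funD => //; have /integrableP[/measurable_EFinP] := ig1.
have Eh : bfs_car E (g1 \+ g2) by exact: bfs_car_ae Eg.
have mnh : measurable_fun pos (fun t => `|(g1 \+ g2) t|) by exact: measurableT_comp.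
exists (fun t => `|(g1 \+ g2) t|); split=> //; last by apply: ae_posS gE => t _ ->.
by apply: bfs_car_le Eh => //; apply: ae_posW => t _; rewrite normr_id.
Qed.

Lemma bfs_car_norm (g : R -> R) : bfs_car E g -> bfs_car E (fun t => `|g t|).
Proof.
move=> /bfs_car_norm_version[h [_ Eh _ gh]].
by apply: bfs_car_ae Eh; apply: ae_posS gh => t _ ->.
Qed.

Variables (A : set (X * X)) (x : X) (tau : R).
Hypothesis A0 : op_dom A !=set0.
Notation S := (`]0, tau[%classic : set R).

Lemma cutoffE (F : R -> \bar R) t : S t -> cutoff tau F t = F t.
Proof. by rewrite /= in_itv /cutoff => /= ->. Qed.

Lemma cutoff0 (F : R -> \bar R) t : ~ S t -> cutoff tau F t = 0%E.
Proof. by rewrite /= in_itv /cutoff /= => /negP/negbTE ->. Qed.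

Lemma kquot_le_ext t (y : X) (a b : R) : 0 < t -> (`|x - y|%:E * t^-1%:E <= a%:E)%E ->
  (op_abs A y <= b%:E)%E -> kquot A x t <= a + b.
Proof.
move=> t0 ya yb; rewrite -lee_fin -kquotE//.
apply: (@le_trans _ _ ((`|x - y|%:E + t%:E * op_abs A y) * t^-1%:E)%E).
  apply: lee_wpmul2r; first by rewrite lee_fin invr_ge0 ltW.
  by apply: ereal_inf_lbound; exists y.
have y0 : (0 <= op_abs A y)%E by apply: le_ereal_inf_tmp => _ [z _ <-]; rewrite lee_fin.
rewrite ge0_muleDl ?mule_ge0 ?lee_fin ?(ltW t0)// EFinD leeD//.
rewrite muleAC -EFinM divff ?gt_eqF// mul1e.
exact: yb.
Qed.

(** The class [G] is arbitrary: at almost every [t] the value [u t] is a competitor in the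
    K-functional. *)
Lemma norm_mean_kquot (G : set (R -> X)) :
  (norm_mean E G (op_couple A) tau x < +oo)%E -> bfs_car E (kquot A x \_ S).
Proof.
move=> /ereal_inf_lt[_ [u _ <-] /bfs_enormD_lty[]].
move=> /bfs_enorm_ltyP[g1 Eg1 H1] /bfs_enorm_ltyP[g2 Eg2 H2].
apply: bfs_car_le (bfs_carD (bfs_car_norm Eg1) (bfs_car_norm Eg2)).
  by apply: measurable_patch => //; exact: (measurable_kquot x A0 (@itv0_pos _ _)).
apply: ae_posS (ae_posI H1 H2) => t t0 [h1 h2]; rewrite patchE.
case: ifPn => [/set_mem St|_]; last by rewrite normr0.
rewrite ger0_norm ?kquot_ge0//=; apply: le_trans (ler_norm _).
apply: (@kquot_le_ext _ (u t)) => //.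
- apply: le_trans h1; rewrite cutoffE//=; exact: lee_abs.
- apply: le_trans h2; rewrite cutoffE//=; exact: lee_abs.
Qed.

Variable omega : R.
Hypotheses (w0 : 0 <= omega) (mA : m_accretive omega A).
Hypotheses (tau0 : 0 < tau) (tauw : tau * omega < 1).

Let c := (1 - tau * omega)^-1.
Let Sc t : t <= tau -> t * omega < 1 /\ 1 <= c * (1 - t * omega).
Proof.
move=> tt; have tw : t * omega <= tau * omega by rewrite ler_wpM2r.
split; first exact: le_lt_trans tauw.
by rewrite /c ler_pdivlMl ?subr_gt0// mulr1; lra.
Qed.

(** |x - J_t x| <= 2 c K(x,t), and K(x,t) tends to 0 by [kquot_small]. *)
Lemma resolvent_cvg0 (eps : R) : 0 < eps -> bfs_car E (kquot A x \_ S) ->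
  exists2 d, 0 < d & forall t, 0 <= t < d -> t <= tau -> `|resolvent A t x - x| <= eps.
Proof.
move=> eps0 Ek.
have c0 : 0 < c by rewrite /c invr_gt0 subr_gt0.
have e2 : 0 < eps / (2 * c) by rewrite divr_gt0// mulr_gt0.
have [d d0 Hd] := kquot_small A0 tau0 e2 Ek.
exists d => // t; rewrite le_eqVlt => /andP[/orP[/eqP<- _ _|t0 td tt]].
  by rewrite resolvent0 subrr normr0 ltW.
have [tw c1] := Sc tt; rewrite distrC.
have := resolvent_le_kquot x w0 mA t0 tw c1; rewrite ler_pdivrMr// => /le_trans; apply.
have := Hd t; rewrite t0 td => /(_ isT); rewrite ltr_pdivlMr ?mulr_gt0// => /ltW.
by rewrite (_ : 2 * c * kquot A x t * t = t * kquot A x t * (2 * c))//; ring.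
Qed.

Let u t := resolvent A (Num.min t tau) x.

Let cu : bfs_car E (kquot A x \_ S) -> {within `[0, +oo[, continuous u}.
Proof.
move=> Ek; apply/within_continuousP => t; rewrite /= in_itv/= andbT.
rewrite le_eqVlt => /orP[/eqP<-|t0] eps eps0.
  have [d d0 Hd] := resolvent_cvg0 eps0 Ek.
  exists d => // s; rewrite in_itv/= andbT subr0 => s0; rewrite ger0_norm// => sd.
  rewrite /u (min_l (ltW tau0)) resolvent0; apply: Hd; last by rewrite ge_min lexx orbT.
  by rewrite le_min s0 (ltW tau0) gt_min sd.
have m0 : 0 < Num.min t tau by rewrite lt_min t0.
have mt : Num.min t tau <= tau by rewrite ge_min lexx orbT.
have [mw _] := Sc mt.
have /cvgrPdist_le/(_ _ eps0) := @resolvent_continuous _ _ A omega x w0 mA _ m0 mw.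
move=> /nbhs_ballP[d /= d0 Hd]; exists d => // s; rewrite in_itv/= andbT => s0 st.
rewrite distrC; apply: Hd; rewrite -ball_normE /=; apply: le_lt_trans st.
have := ler_norm (s - t); have := ler_norm (t - s); rewrite (distrC t s).
case: (leP t tau) => t1; case: (leP s tau) => s1 h1 h2.
- by rewrite distrC.
- by rewrite ler0_norm ?subr_le0//; lra.
- by rewrite ger0_norm ?subr_ge0//; lra.
- by rewrite subrr normr0.
Qed.

Lemma kquot_norm_C : bfs_car E (kquot A x \_ S) ->
  [/\ {within `[0, +oo[, continuous u},
      (bfs_enorm E (cutoff tau (fun t => (`|x - u t|%:E * t^-1%:E)%E)) < +oo)%E &
      (bfs_enorm E (cutoff tau (fun t => op_abs A (u t))) < +oo)%E].
Proof.
move=> Ek; split; first exact: cu.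
all: apply/bfs_enorm_ltyP; exists ((2 * c) \*o (kquot A x \_ S)); first exact: bfs_carZ.
all: apply: ae_posW => t t0; have [St|nSt] := pselect (S t); last by rewrite cutoff0 // abse0 lee_fin.
all: have tt : t < tau by move: St; rewrite /= in_itv/= => /andP[].
all: have [tw c1] := Sc (ltW tt).
all: have c0 : 0 < c by rewrite /c invr_gt0 subr_gt0.
all: have := resolvent_le_kquot x w0 mA t0 tw c1; rewrite cutoffE// /u (min_l (ltW tt)) => H.
all: rewrite /= patchE mem_set//.
all: have K0 : 0 <= 2 * c * kquot A x t by apply: mulr_ge0; [rewrite mulr_ge0// ltW|exact: kquot_ge0].
- by rewrite lee_fin (ger0_norm K0) ger0_norm// divr_ge0// ltW.
- rewrite gee0_abs; last by apply: le_ereal_inf_tmp => _ [z _ <-]; rewrite lee_fin.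
  rewrite (ger0_norm K0); apply: (@le_trans _ _ (`|x - resolvent A t x| / t)%:E).
    apply: ereal_inf_lbound; exists (t^-1 *: (x - resolvent A t x)).
      exact: resolventP tw.
    by rewrite normrZ gtr0_norm ?invr_gt0// mulrC.
  by rewrite lee_fin.
Qed.

Lemma norm_C_iff : (norm_C E (op_couple A) tau x < +oo)%E <-> bfs_car E (kquot A x \_ S).
Proof.
split; first exact: norm_mean_kquot.
move=> /kquot_norm_C[cu' h1 h2]; apply: le_lt_trans (lte_add_pinfty h1 h2).
by apply: ereal_inf_lbound; exists u.
Qed.

Lemma norm_L0_iff : (norm_L0 E (op_couple A) tau x < +oo)%E <-> bfs_car E (kquot A x \_ S).
Proof.
split; first exact: norm_mean_kquot.
move=> /kquot_norm_C[cu' h1 h2]; apply: le_lt_trans (lte_add_pinfty h1 h2).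
apply: ereal_inf_lbound; exists u => //.
exact: continuous_strongly_measurable.
Qed.

Lemma kquot_closure : bfs_car E (kquot A x \_ S) -> closure (op_dom A) x.
Proof.
move=> Ek B /nbhs_ballP[e /= e0 eB].
have e2 : 0 < e / 2 by rewrite divr_gt0.
have [d d0 Hd] := resolvent_cvg0 e2 Ek.
pose t := Num.min (d / 2) tau.
have t0 : 0 < t by rewrite lt_min divr_gt0.
have tt : t <= tau by rewrite ge_min lexx orbT.
have [tw _] := Sc tt.
exists (resolvent A t x); split.
  by exists (t^-1 *: (x - resolvent A t x)); exact: resolventP tw.
apply: eB; rewrite -ball_normE /= distrC; apply: le_lt_trans (Hd t _ tt) _; last lra.
by rewrite (ltW t0) gt_min; apply/orP; left; lra.
Qed.

End MeanMethod.

(** * Weak derivatives and the trace method *)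

Section Smooth.
Variable R : realType.
Implicit Types (u v : R -> R) (n : nat).

(** [Cn n] means n + 1 times differentiable. The derivatives are given as functions, so that closure
    under the operations goes by induction on n. *)
Fixpoint Cn n u : Prop := exists2 du : R -> R,
  forall t, is_derive t (1 : R) u (du t) & (if n is n'.+1 then Cn n' du else True).

Lemma CnS n u : Cn n.+1 u -> Cn n u.
Proof.
elim: n u => [|n IH] u [du dudu Cdu]; first by exists du.
by exists du => //; exact: IH.
Qed.

Lemma Cn_derive1n n u : Cn n u -> forall t, derivable (derive1n n u) t 1.
Proof.
elim: n u => [|n IH] u [du dudu Cdu] t; first exact: (@ex_derive _ _ _ _ _ _ _ (dudu t)).
rewrite derive1Sn (_ : derive1 u = du); first exact: IH.
by apply/funext => s; rewrite derive1E; exact: (@derive_val _ _ _ _ _ _ _ (dudu s)).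
Qed.

Lemma Cn_cst n (a : R) : Cn n (fun=> a).
Proof.
elim: n a => [|n IH] a; exists (fun=> 0) => // t; exact: is_derive_cst.
Qed.

Lemma CnD n u v : Cn n u -> Cn n v -> Cn n (fun t => u t + v t).
Proof.
elim: n u v => [|n IH] u v [du dudu Cdu] [dv dvdv Cdv];
  exists (fun t => du t + dv t) => //; try exact: IH.
all: move=> t; have := dudu t; have := dvdv t; move=> ? ?; exact: is_deriveD.
Qed.

Lemma CnM n u v : Cn n u -> Cn n v -> Cn n (fun t => u t * v t).
Proof.
elim: n u v => [|n IH] u v.
  move=> [du dudu _] [dv dvdv _].
  exists (fun t => u t * dv t + v t * du t) => // t.
  by have := dudu t; have := dvdv t; move=> ? ?; exact: is_deriveM.
move=> Cu Cv; have [du dudu Cdu] := Cu; have [dv dvdv Cdv] := Cv.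
exists (fun t => u t * dv t + v t * du t).
  by move=> t; have := dudu t; have := dvdv t; move=> ? ?; exact: is_deriveM.
by apply: CnD; apply: IH => //; exact: CnS.
Qed.

Lemma Cn_affine n u (a b : R) : Cn n u -> Cn n (fun t => u (a * t + b)).
Proof.
elim: n u => [|n IH] u [du dudu Cdu]; exists (fun t => a * du (a * t + b)) => //.
- move=> t; have dlin : is_derive t (1 : R) (fun t : R => a * t + b) a.
    by apply: is_derive_eq; rewrite /GRing.scale/=; ring.
  have := @is_derive1_comp _ u (fun t => a * t + b) t (du (a * t + b)) a (dudu _) dlin.
  by rewrite mulrC.
- move=> t; have dlin : is_derive t (1 : R) (fun t : R => a * t + b) a.
    by apply: is_derive_eq; rewrite /GRing.scale/=; ring.
  have := @is_derive1_comp _ u (fun t => a * t + b) t (du (a * t + b)) a (dudu _) dlin.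
  by rewrite mulrC.
- by apply: CnM; [exact: Cn_cst|exact: IH].
Qed.

(* [hump 0] is the classical flat function, and the family is closed under
   differentiation: [hump n' = hump n.+2 - n * hump n.+1]. *)
Definition hump n (t : R) : R := if 0 < t then t ^- n * expR (- t^-1) else 0.

(** From exp(s) >= s^(n+2)/(n+2)! at s = 1/t. The square makes the function vanish at 0 together
    with its derivative. *)
Lemma hump_le n t : 0 < t -> hump n t <= n.+2`!%:R * t ^+ 2.
Proof.
move=> t0; rewrite /hump t0; have s0 : 0 <= t^-1 by rewrite invr_ge0 ltW.
have := expR_ge1Dxn n.+1 s0; rewrite expRN.
have f0 : 0 < n.+2`!%:R :> R by rewrite ltr0n fact_gt0.
move=> H; have {H} : t^-1 ^+ n.+2 / n.+2`!%:R <= expR t^-1.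
  by apply: le_trans H; rewrite lerDr.
rewrite ler_pdivrMr// => H.
rewrite ler_pdivrMr ?expR_gt0//.
rewrite -exprVn (_ : t^-1 ^+ n = t^-1 ^+ n.+2 * t ^+ 2); last first.
  by rewrite -addn2 exprD -mulrA -exprMn mulVf ?gt_eqF// expr1n mulr1.
rewrite [leRHS](_ : _ = expR t^-1 * n.+2`!%:R * t ^+ 2); last by ring.
by rewrite ler_wpM2r// exprn_ge0// ltW.
Qed.

Lemma hump_ge0 n t : 0 <= hump n t.
Proof. by rewrite /hump; case: ifP => // t0; rewrite mulr_ge0 ?expR_ge0// invr_ge0 exprn_ge0// ltW. Qed.

Lemma is_derive_hump n t :
  is_derive t (1 : R) (hump n) (hump n.+2 t - n%:R * hump n.+1 t).
Proof.
have [t0|t0|->] := ltgtP t 0.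
- rewrite /hump ltNge (ltW t0)/= mulr0 subr0.
  apply: near_eq_is_derive (is_derive_cst _ _ _).
  near=> s; rewrite ltNge (_ : s <= 0)//.
  by apply: ltW; near: s; exact: lt_nbhsl.
- have near_eq : \forall s \near t, s^-1 ^+ n * expR (- s^-1) = hump n s.
    near=> s; rewrite /hump (_ : 0 < s) ?exprVn//.
    by near: s; exact: lt_nbhsr.
  apply: near_eq_is_derive near_eq _.
  have tn0 : t != 0 by rewrite gt_eqF.
  have dinv : is_derive t (1 : R) (fun s : R => s^-1) (- t ^- 2).
    have := @is_deriveV R id t 1 1 tn0 (is_derive_id _ _).
    by rewrite /GRing.scale/= mulr1.
  have dexp : is_derive t (1 : R) (fun s : R => expR (- s^-1)) (t ^- 2 * expR (- t^-1)).
    have dN : is_derive t (1 : R) (fun s : R => - s^-1) (t ^- 2).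
      by have := is_deriveN dinv; rewrite opprK.
    have := @is_derive1_comp _ expR (fun s : R => - s^-1) t _ _ (is_derive_expR _) dN.
    by rewrite mulrC.
  have dpow : is_derive t (1 : R) (fun s : R => s^-1 ^+ n) (n%:R * t^-1 ^+ n.-1 * (- t ^- 2)).
    by have := is_deriveX n dinv; rewrite exprfctE.
  have := is_deriveM dpow dexp.
  rewrite /GRing.scale/= /hump t0.
  move=> dprod; apply: is_derive_eq dprod _.
  rewrite -!exprVn; case: n {dpow} => [|m] /=; first by ring.
  by move: (t^-1) (expR _) => r e; rewrite !exprS; ring.
- rewrite /hump ltxx mulr0 subr0.
  have cvg0 : h^-1 *: (hump n (h + 0) - hump n 0) @[h --> 0^'] --> (0 : R).
    apply/cvgrPdist_le => eps eps0.
    have F0 : 0 < n.+3`!%:R :> R by rewrite ltr0n fact_gt0.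
    have d0 : 0 < Num.min 1 (eps / n.+3`!%:R) by rewrite lt_min ltr01 divr_gt0.
    apply/nbhs_ballP; exists (Num.min 1 (eps / n.+3`!%:R)) => //= h.
    rewrite -ball_normE /= sub0r normrN lt_min => /andP[h1 hd] hn0.
    rewrite addr0 {2}/hump ltxx subr0 sub0r normrN.
    have [h0|h0] := ltP 0 h; last by rewrite /hump ltNge h0/= scaler0 normr0 ltW.
    (* For h > 0 the difference quotient at 0 is again a member of the family, so [hump_le] applies
       to it. *)
    rewrite (_ : h^-1 *: hump n h = hump n.+1 h); last first.
      by rewrite /hump h0 /GRing.scale/= mulrA -invfM exprS.
    rewrite ger0_norm ?hump_ge0//; apply: le_trans (hump_le _ h0) _.
    move: h1 hd; rewrite ger0_norm ?(ltW h0)// ltr_pdivlMr// => h1 /ltW; apply: le_trans.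
    by rewrite mulrC ler_wpM2r ?(ltW F0)// expr2 ler_piMl ?ltW.
  have cvg0' : h^-1 *: ((hump n \o shift (0 : R)) (h *: (1 : R)) - hump n 0) @[h --> 0^'] --> (0 : R).
    rewrite (_ : (fun h => _) = (fun h => h^-1 *: (hump n (h + 0) - hump n 0)))//.
    by apply/funext => h; rewrite /= /GRing.scale/= mulr1.
  apply: DeriveDef; first by apply/cvg_ex; exists 0.
  by rewrite /derive; apply: cvg_lim.
Unshelve. all: by end_near. Qed.

Lemma Cn_hump m n : Cn m (hump n).
Proof.
elim: m n => [|m IH] n; exists (fun t => hump n.+2 t - n%:R * hump n.+1 t) => //;
  try exact: is_derive_hump.
rewrite (_ : (fun t => _) = (fun t => hump n.+2 t + (- n%:R) * hump n.+1 t)); last first.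
  by apply/funext => t; rewrite mulNr.
by apply: CnD => //; apply: CnM => //; exact: Cn_cst.
Qed.


Lemma is_derive_continuous u du t : is_derive t (1 : R) u du -> {for t, continuous u}.
Proof.
by move=> [du' _]; apply: differentiable_continuous; exact/derivable1_diffP.
Qed.

Lemma Cn_continuous u : Cn 0 u -> continuous u.
Proof. by move=> [du dudu _] t; exact: is_derive_continuous (dudu t). Qed.

Lemma hump0_le1 t : hump 0 t <= 1.
Proof.
rewrite /hump; case: ifP => // t0; rewrite expr0 invr1 mul1r -expR0 ler_expR.
by rewrite oppr_le0 invr_ge0 ltW.
Qed.

Notation mu := (@lebesgue_measure R).

(** [r] is the bump hump(t - a) hump(a + e - t), divided by its integral, and [I] its primitive. *)
Lemma smooth_step (a e : R) : 0 < e -> exists I r : R -> R,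
  [/\ forall n, Cn n r, forall t, is_derive t (1 : R) I (r t),
    (forall t, 0 <= r t) /\ (exists M, forall t, r t <= M),
    (forall t, t <= a -> r t = 0 /\ I t = 0) /\
      (forall t, a + e <= t -> r t = 0 /\ I t = 1) &
    (forall t, 0 <= I t <= 1) /\
      forall al be, al <= a -> a + e <= be -> \int[mu]_(s in `]al, be[) r s = 1].
Proof.
move=> e0; pose q t := hump 0 (t - a) * hump 0 (a + e - t).
have Cq n : Cn n q.
  apply: CnM.
    rewrite (_ : (fun t => _) = (fun t => hump 0 (1 * t + - a))); first exact/Cn_affine/Cn_hump.
    by apply/funext => t; rewrite mul1r.
  rewrite (_ : (fun t => _) = (fun t => hump 0 (- 1 * t + (a + e)))); first exact/Cn_affine/Cn_hump.
  by apply/funext => t; congr hump; ring.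
have q0 t : 0 <= q t by rewrite mulr_ge0 ?hump_ge0.
have q1 t : q t <= 1.
  by rewrite -(mulr1 1); apply: ler_pM; rewrite ?hump_ge0 ?hump0_le1.
have qa t : t <= a -> q t = 0 by move=> ta; rewrite /q /hump subr_gt0 ltNge ta mul0r.
have qe t : a + e <= t -> q t = 0 by move=> ta; rewrite /q /hump !subr_gt0 [_ < a + e]ltNge ta mulr0.
have cq : continuous q by exact: Cn_continuous.
have iq : mu.-integrable setT (EFin \o q).
  have : mu.-integrable `[a, a + e] (EFin \o q).
    apply: continuous_compact_integrable; first exact: segment_compact.
    exact: continuous_subspaceT.
  rewrite integrable_mkcond// (_ : (EFin \o q) \_ _ = EFin \o q)//.
  apply/funext => t /=; rewrite patchE; case: ifPn => //.
  rewrite notin_setE /= in_itv/= => /negP; rewrite negb_and -!ltNge => /orP[/ltW/qa->|/ltW/qe->]//.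
have iqD D : measurable D -> mu.-integrable D (EFin \o q).
  by move=> mD; apply: integrableS iq.
pose F t := \int[mu]_(s in `]-oo, t]) q s.
have dF t : is_derive t (1 : R) F (q t).
  have tt : t < t + 1 by rewrite ltrDl.
  have [dv vE] := @continuous_FTC1 _ q -oo%O t (t + 1) tt (iqD _ (measurable_itv _)) (ltNyr _) (cq t).
  by apply: DeriveDef => //; rewrite -derive1E.
have Fa t : t <= a -> F t = 0.
  move=> ta; rewrite /F (@eq_Rintegral _ _ _ _ _ (fun=> 0)); last first.
    by move=> s /set_mem /=; rewrite in_itv/= => st; rewrite qa// (le_trans st).
  by rewrite Rintegral_cst// mul0r.
have Fmono s t : s <= t -> F s <= F t.
  move=> st; apply: ge0_le_Rintegral_subset => //; last exact: iqD.
  by apply: subset_itvl; rewrite bnd_simp.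
have Fe t : a + e <= t -> F t = F (a + e).
  move=> ta; apply/eqP; rewrite -subr_eq0 /F Rintegral_itvB ?bnd_simp//; last exact: iqD.
  rewrite (@eq_Rintegral _ _ _ _ _ (fun=> 0)); last first.
    by move=> s /set_mem /=; rewrite in_itv/= => /andP[/ltW/qe].
  by rewrite Rintegral_cst// mul0r.
have m0 : 0 < q (a + e / 2).
  rewrite /q /hump (_ : a + e / 2 - a = e / 2); last by ring.
  rewrite (_ : a + e - (a + e / 2) = e / 2); last by field.
  by rewrite divr_gt0// mulr_gt0// mulr_gt0 ?expR_gt0// invr_gt0 expr0.
(* Were the total mass 0, the primitive would vanish left of a + e, and so would its derivative at
   the midpoint, where the bump is positive. *)
have c0 : 0 < F (a + e).
  rewrite lt_neqAle; apply/andP; split; last by rewrite -(Fa a)// Fmono// lerDl ltW.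
  apply/eqP => Fz.
  have Fz' t : t < a + e -> F t = 0.
    move=> tae; apply/eqP; rewrite eq_le; apply/andP; split.
      by rewrite Fz; apply/Fmono/ltW.
    by apply: Rintegral_ge0.
  have [_ d0] : is_derive (a + e / 2) (1 : R) F 0.
    apply: near_eq_is_derive (is_derive_cst _ _ _).
    near=> s; rewrite Fz'//; near: s; apply: lt_nbhsl.
    by rewrite ltrD2l ltr_pdivrMr// ltr_pMr// ltr1n.
  have [_ dq] := dF (a + e / 2).
  by rewrite -dq d0 ltxx in m0.
set c := F (a + e) in c0 Fe.
exists (fun t => c^-1 * F t), (fun t => c^-1 * q t); split.
- by move=> n; apply: CnM => //; exact: Cn_cst.
- by move=> t; have := is_deriveZ c^-1 (dF t).
- split=> [t|]; first by rewrite mulr_ge0// invr_ge0 ltW.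
  by exists c^-1 => t; rewrite ler_piMr// invr_ge0 ltW.
- split=> t ta; first by rewrite qa// Fa// mulr0.
  by rewrite qe// Fe// mulr0 mulVf// gt_eqF.
- split=> [t|al be ala abe].
    rewrite mulr_ge0 ?invr_ge0 ?(ltW c0)//=; last exact: Rintegral_ge0.
    by rewrite ler_pdivrMl// mulr1; have [/Fmono//|/ltW/Fe->//] := leP t (a + e).
  rewrite RintegralZl//; last exact: iqD.
  rewrite Rintegral_itv_bndo_bndc; last exact: iqD.
  rewrite -(@Rintegral_itvB _ q -oo%O); last 3 first.
  + exact: iqD.
  + by [].
  + by rewrite bnd_simp; lra.
  by rewrite -/(F be) -/(F al) (Fa al)// subr0 (Fe be)// mulVf// gt_eqF.
Unshelve. all: by end_near. Qed.

(** The difference of two smooth steps. Its derivative r1 - r2 consists of unit masses near a and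
    near b, so that testing with it approximates w(a) - w(b). *)
Lemma plateau_function (T a b e : R) : 0 < e -> 0 < a -> a + e <= b - e -> b < T ->
  exists phi r1 r2 : R -> R,
  [/\ test_function `]0, T[ phi, forall t, derive1 phi t = r1 t - r2 t,
    [/\ forall n, Cn n r1, forall n, Cn n r2, forall t, 0 <= r1 t, forall t, 0 <= r2 t &
      exists M, forall t, r1 t <= M /\ r2 t <= M],
    [/\ forall t, r1 t != 0 -> a < t < a + e, forall t, r2 t != 0 -> b - e < t < b,
      \int[mu]_(s in `]0, T[) r1 s = 1 & \int[mu]_(s in `]0, T[) r2 s = 1] &
    [/\ continuous phi, forall t, 0 <= phi t <= 1,
      forall t, phi t != 0 -> a < t < b & forall t, a + e <= t <= b - e -> phi t = 1]].
Proof.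
move=> e0 a0 abe bT.
have [I1 [r1 [C1 d1 [r10 [M1 rM1]] [I1a I1b] [I1le int1]]]] := smooth_step a e0.
have [I2 [r2 [C2 d2 [r20 [M2 rM2]] [I2a I2b] [I2le int2]]]] := smooth_step (b - e) e0.
rewrite subrK in I2b int2.
have dphi t : is_derive t (1 : R) (fun t => I1 t - I2 t) (r1 t - r2 t).
  by have := d1 t; have := d2 t => ? ?; exact: is_deriveB.
have Cphi n : Cn n (fun t => I1 t - I2 t).
  case: n => [|n]; exists (fun t => r1 t - r2 t) => //.
  rewrite (_ : (fun t => _) = (fun t => r1 t + (- 1) * r2 t)); last first.
    by apply/funext => t; rewrite mulN1r.
  by apply: CnD => //; apply: CnM => //; exact: Cn_cst.
have phi0 t : t <= a \/ b <= t -> I1 t - I2 t = 0.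
  case=> [ta|bt]; first by rewrite (I1a _ ta).2 (I2a t _).2 ?subrr//; lra.
  by rewrite (I2b _ bt).2 (I1b t _).2 ?subrr//; lra.
exists (fun t => I1 t - I2 t), r1, r2; split.
- split; first by move=> n t; exact: Cn_derive1n.
  exists a, b; split.
    by apply: subset_itv; rewrite bnd_simp.
  move=> t; rewrite in_itv/= negb_and -!ltNge => /orP[/ltW ta|/ltW bt].
    by apply: phi0; left.
  by apply: phi0; right.
- by move=> t; rewrite derive1E; exact: (@derive_val _ _ _ _ _ _ _ (dphi t)).
- split=> //; exists (Num.max M1 M2) => t.
  by rewrite !le_max rM1 rM2 orbT.
- split.
  + move=> t; apply: contraNT; rewrite negb_and -!leNgt => /orP[ta|bt].
      by rewrite (I1a _ ta).1.
    by rewrite (I1b _ bt).1.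
  + move=> t; apply: contraNT; rewrite negb_and -!leNgt => /orP[ta|bt].
      by rewrite (I2a _ ta).1.
    by rewrite (I2b _ bt).1.
  + by apply: int1; lra.
  + by apply: int2; lra.
- split.
  + exact: Cn_continuous (Cphi 0%N).
  + move=> t; have /andP[? ?] := I1le t; have /andP[? ?] := I2le t.
    have [tb|bt] := leP t (b - e); first by rewrite (I2a _ tb).2; apply/andP; split; lra.
    by rewrite (I1b t _).2; [apply/andP; split; lra|lra].
  + move=> t; apply: contraNT; rewrite negb_and -!leNgt => H.
    by apply/eqP/phi0; case/orP: H; [left|right].
  + by move=> t /andP[ta tb]; rewrite (I1b _ ta).2 (I2a _ tb).2 subr0.
Qed.

End Smooth.

Section LowerIntegral.
Variable R : realType.
Notation mu := (@lebesgue_measure R).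
Import HBNNSimple.

(* The integral of a nonnegative function is the supremum of the integrals of
   the simple functions below it, so monotonicity needs no measurability. *)
Lemma ae_le_lower_integral (D : set R) (f g : R -> \bar R) :
  (forall t, D t -> (0 <= f t)%E) -> (forall t, D t -> (0 <= g t)%E) ->
  {ae mu, forall t, D t -> (f t <= g t)%E} ->
  (\int[mu]_(t in D) f t <= \int[mu]_(t in D) g t)%E.
Proof.
move=> f0 g0 [N [mN N0 fgN]].
rewrite integral_mkcond [leRHS]integral_mkcond.
have fD0 t : (0 <= (f \_ D) t)%E by rewrite patchE; case: ifPn => // /set_mem/f0.
have gD0 t : (0 <= (g \_ D) t)%E by rewrite patchE; case: ifPn => // /set_mem/g0.
rewrite ge0_integralTE// ge0_integralTE//.
apply: ge_ereal_sup => _ [h /= hf <-].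
have mNC : measurable (~` N) by exact: measurableC.
(* Setting [h] to 0 on the null set puts it below [g] everywhere and does not change its
   integral. *)
pose h' := proj_nnsfun h mNC.
have h'E t : h' t = h t * (t \notin N)%:R.
  by rewrite /h' /= mindicE in_setC.
apply: (@le_trans _ _ (sintegral mu h')); last first.
  apply: ereal_sup_ubound; exists h' => // t.
  rewrite [h' t]h'E; case: (boolP (t \in N)) => [_|tN]; first by rewrite mulr0.
  rewrite mulr1; apply: le_trans (hf t) _; rewrite !patchE; case: ifPn => // /set_mem Dt.
  have := contra_not (@fgN t) (fun H : N t => negP tN (mem_set H)).
  by move=> /contrapT; exact.
rewrite -!integralT_nnsfun le_eqVlt; apply/orP; left; apply/eqP.
apply: ae_eq_integral => //.
- by apply/measurable_EFinP.
- by apply/measurable_EFinP.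
exists N; split=> // t /not_implyP[_]; apply: contra_notP => tN.
by have := h'E t; rewrite memNset// mulr1 => ->.
Qed.

Lemma ae_eq_lower_integral (D : set R) (f g : R -> \bar R) :
  (forall t, D t -> (0 <= f t)%E) -> (forall t, D t -> (0 <= g t)%E) ->
  {ae mu, forall t, D t -> f t = g t} ->
  (\int[mu]_(t in D) f t = \int[mu]_(t in D) g t)%E.
Proof.
move=> f0 g0 fg; apply/eqP; rewrite eq_le; apply/andP; split;
  apply: ae_le_lower_integral => //; move: fg;
  by apply: ae_filterS => t H /H ->.
Qed.

End LowerIntegral.

(** * Simple functions and Bochner integrals *)

Section FiniteMaps.
Variables (R : realType).
Notation mu := (@lebesgue_measure R).

(** A finite measurable partition, indexed by the list [L]. Two simple functions are put on a common
    partition by pairing their index maps. *)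
Definition fin_meas (P : choiceType) (p : R -> P) (L : seq P) :=
  [/\ uniq L, forall t, p t \in L & forall q, measurable (p @^-1` [set q])].

Lemma fin_meas_pair (P Q : choiceType) (p : R -> P) (q : R -> Q) L M :
  fin_meas p L -> fin_meas q M ->
  fin_meas (fun t => (p t, q t)) [seq (x, y) | x <- L, y <- M].
Proof.
move=> [uL pL mp] [uM qM mq]; split.
- by apply: allpairs_uniq => // -[? ?] [? ?].
- by move=> t; apply: allpairs_f.
- move=> [x y]; rewrite (_ : _ @^-1` _ = p @^-1` [set x] `&` q @^-1` [set y]).
    exact: measurableI.
  by apply/seteqP; split=> t /= [-> ->].
Qed.

Lemma fin_meas_preimage (P : choiceType) (p : R -> P) L (B : set P) :
  fin_meas p L -> measurable (p @^-1` B).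
Proof.
move=> [uL pL mp].
rewrite (_ : _ @^-1` _ = \bigcup_(q in [set` L] `&` B) p @^-1` [set q]).
  apply: fin_bigcup_measurable => //; apply: finite_setIl; exact: finite_seq.
apply/seteqP; split=> [t Bt|t [q [_ Bq] /= pq]]; last by rewrite pq.
by exists (p t) => //; split=> //; exact: pL.
Qed.

Lemma fin_meas_measurable (P : choiceType) (p : R -> P) L (F : P -> R) :
  fin_meas p L -> measurable_fun setT (F \o p).
Proof.
by move=> pL _ B mB; rewrite setTI comp_preimage; exact: fin_meas_preimage pL.
Qed.

Section Integral.
Variables (D : set R).
Hypotheses (mD : measurable D) (Dfin : (mu D < +oo)%E).

Definition fmu (B : set R) : R := fine (mu (D `&` B)).

Lemma fmuE B : measurable B -> (fmu B)%:E = mu (D `&` B).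
Proof.
move=> mB; rewrite /fmu fineK// ge0_fin_numE//.
apply: le_lt_trans Dfin; apply: le_measure; rewrite ?inE//.
exact: measurableI.
Qed.

Lemma fmu_ge0 B : 0 <= fmu B.
Proof. by rewrite /fmu fine_ge0. Qed.

Lemma fin_meas_integral (P : choiceType) (p : R -> P) L (F : P -> R) :
  fin_meas p L -> (forall q, 0 <= F q) ->
  (\int[mu]_(t in D) (F (p t))%:E = (\sum_(q <- L) fmu (p @^-1` [set q]) * F q)%R%:E)%E.
Proof.
move=> pL F0; have [uL inL mp] := pL.
pose G q := D `&` p @^-1` [set q].
have DE : D = \big[setU/set0]_(q <- L) G q.
  rewrite -bigcup_seq; apply/seteqP; split=> [t Dt|t [q _ []//]].
  by exists (p t) => //; exact: inL.
rewrite {1}DE ge0_integral_bigsetU//.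
- rewrite -sumEFin; apply: eq_bigr => q _.
  rewrite (eq_integral (fun=> (F q)%:E)); last by move=> t /set_mem[_ /= ->].
  rewrite (integral_cst mu _ (F q)%:E)/=; last exact: (measurableI _ _ mD (mp q)).
  by rewrite -fmuE// muleC.
- by move=> q; exact: (measurableI _ _ mD (mp q)).
- by apply/trivIsetP => q q' _ _ qq'; rewrite -subset0 => t [[_ /= tq] [_ /= tq']]; rewrite -tq -tq' eqxx in qq'.
- by apply/measurable_EFinP; apply: measurable_funTS; exact: (fin_meas_measurable F pL).
- by move=> t _; rewrite lee_fin.
Qed.

Variable X : completeNormedModType R.

Lemma fin_meas_simple (P : choiceType) (p : R -> P) L (c : P -> X) :
  fin_meas p L -> simple_fun (c \o p).
Proof.
move=> pL; have [uL inL mp] := pL; split.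
  apply: (@sub_finite_set _ _ (c @` [set` L])); last exact/finite_image/finite_seq.
  by move=> _ [t _ <-]; exists (p t) => //; exact: inL.
by move=> y; rewrite comp_preimage; exact: fin_meas_preimage pL.
Qed.

Lemma simple_fin_meas (s : R -> X) : simple_fun s -> exists L, fin_meas s L.
Proof.
move=> [fs ms]; exists (finmap.enum_fset (fset_set (range s))); split=> //.
by move=> t; rewrite in_fset_set// mem_set//; exists t.
Qed.

(** [simple_integral] sums over values whereas [L] lists pieces; the pieces on which [c] takes the
    same value are merged. *)
Lemma fin_meas_simple_integral (P : choiceType) (p : R -> P) L (c : P -> X) :
  fin_meas p L ->
  simple_integral D (c \o p) = \sum_(q <- L) fmu (p @^-1` [set q]) *: c q.
Proof.
move=> pL; have [uL inL mp] := pL.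
pose M := undup (map c L).
rewrite /simple_integral (@fsbig_widen _ _ _ _ _ [set` M]); last 2 first.
- by move=> _ [t _ <-] /=; rewrite mem_undup map_f.
- move=> y /= [_ nry]; rewrite (_ : _ @^-1` _ = set0) ?setI0 ?measure0 ?scale0r//.
  by rewrite -subset0 => t /= cy; apply: nry; exists t.
rewrite -fsbig_seq ?undup_uniq//.
transitivity (\sum_(y <- M) \sum_(q <- L | c q == y) fmu (p @^-1` [set q]) *: c q).
  apply: eq_bigr => y _.
  rewrite (eq_bigr (fun q => fmu (p @^-1` [set q]) *: y)); last by move=> q /eqP ->.
  rewrite -scaler_suml; congr (_ *: _); apply: EFin_inj.
  have mcy : measurable ((c \o p) @^-1` [set y]).
    by rewrite comp_preimage; exact: fin_meas_preimage pL.
  rewrite -/(fmu _) fmuE//.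
  have -> : D `&` (c \o p) @^-1` [set y] =
      \bigcup_(q in [set` [seq q <- L | c q == y]]) (D `&` p @^-1` [set q]).
    apply/seteqP; split=> [t [Dt /= cy]|t [q /=]].
      by exists (p t) => //=; rewrite mem_filter cy eqxx inL.
    by rewrite mem_filter => /andP[/eqP cq _] [Dt /= pt]; split=> //=; rewrite pt.
  rewrite measure_fin_bigcup//; last 2 first.
  - by apply/trivIsetP => q q' _ _ qq'; rewrite -subset0 => t [[_ /= tq] [_ /= tq']]; rewrite -tq -tq' eqxx in qq'.
  - by move=> q _; exact: (measurableI _ _ mD (mp q)).
  rewrite -fsbig_seq ?filter_uniq// big_filter -sumEFin; apply: eq_bigr => q _.
  by rewrite fmuE.
rewrite (exchange_big_dep xpredT)//= big_seq [RHS]big_seq; apply: eq_bigr => q qL.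
rewrite -big_filter (_ : [seq y <- M | c q == y] = [:: c q]) ?big_seq1//.
have := @filter_pred1_uniq _ M (c q) (undup_uniq _); rewrite mem_undup map_f// => /(_ isT) <-.
by apply: eq_filter => y /=; rewrite eq_sym.
Qed.

End Integral.
End FiniteMaps.

Section BochnerIntegral.
Variables (R : realType) (X : completeNormedModType R).
Notation mu := (@lebesgue_measure R).
Implicit Types (D : set R) (s u : R -> X).

Lemma simple_integral_dist D s s' : measurable D -> (mu D < +oo)%E ->
  simple_fun s -> simple_fun s' ->
  ((`|simple_integral D s - simple_integral D s'|)%:E <=
   \int[mu]_(t in D) (`|s t - s' t|)%:E)%E.
Proof.
move=> mD Dfin /simple_fin_meas[L sL] /simple_fin_meas[L' sL'].
have pL := fin_meas_pair sL sL'.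
rewrite (_ : simple_integral D s = simple_integral D (fst \o (fun t => (s t, s' t))))//.
rewrite (_ : simple_integral D s' = simple_integral D (snd \o (fun t => (s t, s' t))))//.
rewrite !(fin_meas_simple_integral mD Dfin _ pL).
rewrite (fin_meas_integral mD Dfin (F := fun q : X * X => `|q.1 - q.2|) pL)//.
rewrite lee_fin -sumrB; apply: le_trans (ler_norm_sum _ _ _) _.
apply: ler_sum => q _; rewrite -scalerBr normrZ ger0_norm//.
exact: fmu_ge0.
Qed.

Lemma measurable_simple_dist s s' : simple_fun s -> simple_fun s' ->
  measurable_fun setT (fun t => `|s t - s' t|).
Proof.
move=> /simple_fin_meas[L sL] /simple_fin_meas[L' sL'].
exact: (fin_meas_measurable (fun q : X * X => `|q.1 - q.2|) (fin_meas_pair sL sL')).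
Qed.

(* Strong measurability is up to null sets, so the distance to a simple
   function is only almost everywhere equal to a Borel function. *)
Lemma strongly_measurable_dist D u s : measurable D -> strongly_measurable D u ->
  simple_fun s -> exists e : R -> R,
    [/\ measurable_fun D e, forall t, 0 <= e t &
        {ae mu, forall t, D t -> `|u t - s t| = e t}].
Proof.
move=> mD [sg [sgs sgu]] ss.
exists (fun t => `|fine (limn_esup (fun n => (`|sg n t - s t|)%:E))|); split=> //.
  apply: measurableT_comp => //; apply: measurableT_comp => //.
  apply: measurable_fun_limn_esup => n; apply/measurable_EFinP.
  by apply: measurable_funTS; exact: (measurable_simple_dist (sgs n) ss).
move: sgu; apply: ae_filterS => t H Dt.
have c1 : (fun n => `|sg n t - s t|) @ \oo --> `|u t - s t|.
  by apply: cvg_norm; apply: cvgB; [exact: H|exact: cvg_cst].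
have c2 : (fun n => (`|sg n t - s t|)%:E) @ \oo --> (`|u t - s t|)%:E.
  by apply: cvg_EFin; [exact: nearW|exact: c1].
by rewrite (cvg_limn_einf_sup c2) /= normr_id.
Qed.

Lemma near_lt_ereal (a : nat -> \bar R) (eps : R) : 0 < eps ->
  a @ \oo --> 0%E -> \forall n \near \oo, (a n < eps%:E)%E.
Proof.
move=> eps0 a0; apply: (a0 [set x | (x < eps%:E)%E]); apply: open_nbhs_nbhs; split; last by rewrite /= lte_fin.
exact: open_ereal_lt_ereal.
Qed.

(** The difference of the approximating simple functions is at most M plus the two approximation
    errors, almost everywhere, and simple integrals obey the triangle inequality. *)
Lemma has_bochner_integral_dist D u u' (y y' : X) (M : R -> R) : measurable D ->
  (mu D < +oo)%E -> has_bochner_integral D u y -> has_bochner_integral D u' y' ->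
  measurable_fun D M -> (forall t, D t -> 0 <= M t) ->
  {ae mu, forall t, D t -> `|u t - u' t| <= M t} ->
  ((`|y - y'|)%:E <= \int[mu]_(t in D) (M t)%:E)%E.
Proof.
move=> mD Dfin [[mu_ _] [s [ss su sy]]] [[mu'_ _] [s' [ss' su' sy']]] mM M0 uM.
apply/lee_addgt0Pr => eps eps0.
(* Four errors: each of the two functions contributes the L^1 distance to its simple function and
   the distance between the integrals. *)
have e4 : 0 < eps / 4 by rewrite divr_gt0.
have near_n : \forall n \near \oo, ((`|y - y'|)%:E <= \int[mu]_(t in D) (M t)%:E + eps%:E)%E.
  near=> n.
  have [simn _] := ss n; have [simn' _] := ss' n.
  have [e [me e0 ue]] := strongly_measurable_dist mD mu_ simn.
  have [e' [me' e'0 ue']] := strongly_measurable_dist mD mu'_ simn'.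
  have E1 : (\int[mu]_(t in D) (e t)%:E <= (eps / 4)%:E)%E.
    rewrite (_ : \int[mu]_(t in D) (e t)%:E = \int[mu]_(t in D) (`|u t - s n t|)%:E)%E.
      by apply: ltW; near: n; exact: near_lt_ereal.
    apply: ae_eq_lower_integral => [t _|t _|]; rewrite ?lee_fin//.
    by move: ue; apply: ae_filterS => t H /H ->.
  have E2 : (\int[mu]_(t in D) (e' t)%:E <= (eps / 4)%:E)%E.
    rewrite (_ : \int[mu]_(t in D) (e' t)%:E = \int[mu]_(t in D) (`|u' t - s' n t|)%:E)%E.
      by apply: ltW; near: n; exact: near_lt_ereal.
    apply: ae_eq_lower_integral => [t _|t _|]; rewrite ?lee_fin//.
    by move: ue'; apply: ae_filterS => t H /H ->.
  have E3 : (\int[mu]_(t in D) (`|s n t - s' n t|)%:E <=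
      \int[mu]_(t in D) (M t)%:E + ((eps / 4)%:E + (eps / 4)%:E))%E.
    apply: le_trans (_ : (_ <= \int[mu]_(t in D) (M t)%:E + (\int[mu]_(t in D) (e t)%:E + \int[mu]_(t in D) (e' t)%:E))%E) _; last first.
      by apply: leeD => //; exact: leeD.
    have mMe : measurable_fun D (fun t => (M t)%:E) by exact/measurable_EFinP.
    have mee : measurable_fun D (fun t => (e t)%:E) by exact/measurable_EFinP.
    have mee' : measurable_fun D (fun t => (e' t)%:E) by exact/measurable_EFinP.
    have meee : measurable_fun D (fun t => (e t)%:E + (e' t)%:E)%E by exact: emeasurable_funD.
    have I1 : (\int[mu]_(t in D) ((e t)%:E + (e' t)%:E) =
        \int[mu]_(t in D) (e t)%:E + \int[mu]_(t in D) (e' t)%:E)%E.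
      by apply: ge0_integralD => // t _; rewrite lee_fin.
    have I2 : (\int[mu]_(t in D) ((M t)%:E + ((e t)%:E + (e' t)%:E)) =
        \int[mu]_(t in D) (M t)%:E + \int[mu]_(t in D) ((e t)%:E + (e' t)%:E))%E.
      apply: ge0_integralD => // t Dt.
      by apply: adde_ge0; rewrite lee_fin.
    rewrite -I1 -I2.
    apply: ae_le_lower_integral => [t _|t Dt|]; first by rewrite lee_fin.
      by apply: adde_ge0; [rewrite lee_fin M0|apply: adde_ge0; rewrite lee_fin].
    have := ae_filterI uM (ae_filterI ue ue').
    apply: ae_filterS => t [H1 [H2 H3]] Dt.
    rewrite -!EFinD lee_fin -(H2 Dt) -(H3 Dt).
    apply: (@le_trans _ _ (`|u t - u' t| + (`|u t - s n t| + `|u' t - s' n t|))); last by rewrite lerD2r H1.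
    rewrite (_ : s n t - s' n t = (u t - u' t) - ((u t - s n t) - (u' t - s' n t))); last by module R X.
    apply: le_trans (ler_normB _ _) _; rewrite lerD2l; exact: ler_normB.
  have E4 := simple_integral_dist mD Dfin simn simn'.
  have E5 : `|y - simple_integral D (s n)| <= eps / 4.
    by near: n; move/cvgrPdist_le: sy; exact.
  have E6 : `|y' - simple_integral D (s' n)| <= eps / 4.
    by near: n; move/cvgrPdist_le: sy'; exact.
  have E7 : `|y - y'| <= `|simple_integral D (s n) - simple_integral D (s' n)| + (eps / 4 + eps / 4).
    rewrite (_ : y - y' = (simple_integral D (s n) - simple_integral D (s' n)) +
      ((y - simple_integral D (s n)) - (y' - simple_integral D (s' n)))); last by module R X.
    apply: le_trans (ler_normD _ _) _; rewrite lerD2l; apply: le_trans (ler_normB _ _) _.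
    exact: lerD.
  apply: (@le_trans _ _ ((`|simple_integral D (s n) - simple_integral D (s' n)| + (eps / 4 + eps / 4))%:E)).
    by rewrite lee_fin.
  rewrite EFinD; apply: le_trans (leeD (le_trans E4 E3) (lexx _)) _.
  by rewrite -addeA leeD2l// -!EFinD lee_fin; lra.
by have [n _ /(_ n (leqnn n))] := near_n.
Unshelve. all: by end_near. Qed.

Section Combination.
Variables (D : set R) (r1 r2 : R -> R) (v1 v2 : X) (M : R).
Hypotheses (mD : measurable D) (Dfin : (mu D < +oo)%E).
Hypotheses (mr1 : measurable_fun setT r1) (mr2 : measurable_fun setT r2).
Hypotheses (r1M : forall t, `|r1 t| <= M) (r2M : forall t, `|r2 t| <= M).

Let K n : R := n.+1%:R.
Let K0 n : 0 < K n. Proof. by rewrite /K. Qed.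
(** The coefficient is quantised with mesh 1/(n+1), after a shift by [M] that makes it nonnegative
    and its level a natural number; [a] undoes the shift. *)
Let p n (r : R -> R) t := Num.truncn (K n * (r t + M)).
Let a n (k : nat) : R := k%:R / K n - M.

Let M0 : 0 <= M. Proof. exact: le_trans (r1M 0). Qed.

Let ge0 n (r : R -> R) t : (forall t, `|r t| <= M) -> 0 <= K n * (r t + M).
Proof.
move=> rM; rewrite mulr_ge0 ?(ltW (K0 n))//.
by have := rM t; rewrite ler_norml => /andP[]; lra.
Qed.

Let fmp n (r : R -> R) : measurable_fun setT r -> (forall t, `|r t| <= M) ->
  exists L, fin_meas (p n r) L.
Proof.
move=> mr rM; exists (iota 0 (Num.truncn (K n * (M + M))).+1); split.
- exact: iota_uniq.
- move=> t; rewrite mem_iota /= add0n ltnS; apply: le_truncn.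
  rewrite ler_pM2l// lerD2r; exact: le_trans (ler_norm _) (rM t).
- move=> k; rewrite (_ : _ @^-1` _ = (fun t => K n * (r t + M)) @^-1` `[k%:R, k.+1%:R[).
    have mf : measurable_fun setT (fun t => K n * (r t + M)).
      by apply: measurable_funM => //; exact: measurable_funD.
    by rewrite -[X in measurable X]setTI; apply: mf => //; exact: measurable_itv.
  apply/seteqP; split=> t /=; rewrite in_itv/=.
    by move=> <-; exact: truncn_itv (ge0 n t rM).
  by move=> H; apply/eqP; rewrite truncn_eq// ge0.
Qed.

Let pa n (r : R -> R) t : (forall t, `|r t| <= M) -> `|r t - a n (p n r t)| <= (K n)^-1.
Proof.
move=> rM; have /andP[] := truncn_itv (ge0 n t rM); rewrite -/(p n r t) -natr1.
rewrite (mulrC (K n)) -ler_pdivrMr// -ltr_pdivlMr// mulrDl mul1r => h1 h2.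
have : 0 < (K n)^-1 by rewrite invr_gt0.
by move: h1 h2; rewrite /a; set q := _ / _; set k := _^-1 => h1 h2 k0;
  rewrite ler_norml; apply/andP; split; lra.
Qed.

Let map n (r : R -> R) : measurable_fun setT r -> (forall t, `|r t| <= M) ->
  measurable_fun setT (fun t => a n (p n r t)).
Proof. by move=> mr rM; have [L pL] := fmp n mr rM; exact: (fin_meas_measurable (a n) pL). Qed.

(** The partition map [q] is finer than the level map of [r]: it will be the pair of levels of r1
    and r2, from which [f] extracts one component. *)
Let aint n (r : R -> R) (P : choiceType) (L : seq P) (q : R -> P) (f : P -> nat) : measurable_fun setT r ->
  (forall t, `|r t| <= M) -> fin_meas q L -> (forall t, f (q t) = p n r t) ->
  `|\sum_(z <- L) fmu D (q @^-1` [set z]) * a n (f z) - \int[mu]_(t in D) r t| <=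
  fine (mu D) / K n.
Proof.
move=> mr rM qL fq.
have ir : mu.-integrable D (EFin \o r).
  by apply: (@bounded_integrable _ _ _ M) => //; exact: measurable_funTS.
have H1 := @fin_meas_integral _ D mD Dfin _ q L (fun z => (f z)%:R / K n) qL (fun z => divr_ge0 (ler0n _ _) (ltW (K0 n))).
have H2 := @fin_meas_integral _ D mD Dfin _ q L (fun z => M) qL (fun z => M0).
have iM : mu.-integrable D (EFin \o (fun=> M)).
  by apply: (@bounded_integrable _ _ _ M) => // t _; rewrite ger0_norm.
have ia : mu.-integrable D (EFin \o (fun t => a n (p n r t))).
  apply: (@bounded_integrable _ _ _ (M + (K n)^-1)) => //; first by apply: measurable_funTS; exact: map.
  move=> t _; rewrite (_ : a n _ = r t - (r t - a n (p n r t))); last by ring.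
  by apply: le_trans (ler_normB _ _) _; apply: lerD => //; exact: pa.
have ip : mu.-integrable D (EFin \o (fun t => (f (q t))%:R / K n)).
  rewrite (_ : _ \o _ = (EFin \o (fun t => a n (p n r t))) \+ (EFin \o (fun=> M)))%E.
    exact: integrableD.
  by apply/funext => t; rewrite /= fq /a -EFinD subrK.
have -> : \sum_(z <- L) fmu D (q @^-1` [set z]) * a n (f z) = \int[mu]_(t in D) a n (p n r t).
  transitivity (\int[mu]_(t in D) ((f (q t))%:R / K n - M)); last first.
    by apply: eq_Rintegral => t _; rewrite /a fq.
  rewrite RintegralB// /Rintegral H1 H2 /= -sumrB.
  by apply: eq_bigr => z _; rewrite /a mulrBr.
rewrite -RintegralB//; apply: le_trans (le_normr_Rintegral _ _) _ => //.
  rewrite (_ : _ \o _ = (EFin \o (fun t => a n (p n r t))) \- (EFin \o r))%E//.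
  exact: integrableB.
have -> : fine (mu D) / K n = \int[mu]_(t in D) (K n)^-1 by rewrite Rintegral_cst// mulrC.
apply: le_Rintegral => //.
- apply: (@bounded_integrable _ _ _ (K n)^-1) => //.
    by apply: measurable_funTS; apply: measurableT_comp => //; apply: measurable_funB => //; exact: map.
  by move=> t _; rewrite normr_id distrC; exact: pa.
- by apply: (@bounded_integrable _ _ _ (K n)^-1) => // t _; rewrite ger0_norm// invr_ge0 ltW.
- by move=> t _; rewrite distrC; exact: pa.
Qed.

Lemma has_bochner_integral_combination :
  has_bochner_integral D (fun t => r1 t *: v1 + r2 t *: v2)
    ((\int[mu]_(t in D) r1 t) *: v1 + (\int[mu]_(t in D) r2 t) *: v2).
Proof.
pose c n (z : nat * nat) := a n z.1 *: v1 + a n z.2 *: v2.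
pose P n t := (p n r1 t, p n r2 t).
have fP n : exists L, fin_meas (P n) L.
  have [L1 H1] := fmp n mr1 r1M; have [L2 H2] := fmp n mr2 r2M.
  by exists [seq (x, y) | x <- L1, y <- L2]; exact: fin_meas_pair.
pose s n := c n \o P n.
have ss n : simple_fun (s n) by have [L PL] := fP n; exact: fin_meas_simple PL.
pose u t := r1 t *: v1 + r2 t *: v2.
pose C := `|v1| + `|v2|.
have us n t : `|u t - s n t| <= C / K n.
  rewrite (_ : u t - s n t = (r1 t - a n (p n r1 t)) *: v1 + (r2 t - a n (p n r2 t)) *: v2); last by rewrite /u /s /c /=; module R X.
  apply: le_trans (ler_normD _ _) _; rewrite !normrZ /C mulrDl ![_ / K n]mulrC.
  by apply: lerD; apply: ler_wpM2r => //; exact: pa.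
have hK : (fun n => (K n)^-1) @ \oo --> (0 : R) by exact: cvg_harmonic.
have hKC (c' : R) : (fun n => c' / K n) @ \oo --> (0 : R).
  by rewrite -(mulr0 c'); apply: cvgM; [exact: cvg_cst|exact: hK].
have cvgu t : (fun n => s n t) @ \oo --> u t.
  apply/cvgrPdist_le => eps eps0; have /cvgrPdist_le/(_ _ eps0) := hKC C.
  apply: filterS => n; rewrite sub0r normrN => H.
  by apply: le_trans (us n t) (le_trans (ler_norm _) H).
have bnd (w : R -> X) (c' : R) : (forall t, `|w t| <= c') ->
    (\int[mu]_(t in D) (`|w t|)%:E <= (c' * fine (mu D))%:E)%E.
  move=> wc; apply: (@le_trans _ _ (\int[mu]_(t in D) (cst c'%:E) t)%E).
    apply: ae_le_lower_integral => [t _|t _|]; rewrite ?lee_fin//.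
      exact: le_trans (wc t).
    by apply: (@filterE _ _ (ae_filter_ringOfSetsType mu)) => t _; rewrite lee_fin.
  by rewrite integral_cst// EFinM fineK// ge0_fin_numE.
have uC t : `|u t| <= M * C.
  apply: le_trans (ler_normD _ _) _; rewrite !normrZ /C mulrDr.
  by apply: lerD; apply: ler_wpM2r.
have sC n t : `|s n t| <= M * C + C / K n.
  rewrite (_ : s n t = u t - (u t - s n t)); last by module R X.
  by apply: le_trans (ler_normB _ _) _; apply: lerD.
have L1s n : L1 D (s n).
  split; last by apply: le_lt_trans (bnd _ _ (sC n)) (ltry _).
  exists (fun=> s n); split=> //.
  by apply: (@filterE _ _ (ae_filter_ringOfSetsType mu)) => t _; exact: cvg_cst.
split.
  split; last by apply: le_lt_trans (bnd _ _ uC) (ltry _).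
  exists s; split=> //.
  by apply: (@filterE _ _ (ae_filter_ringOfSetsType mu)) => t _; exact: cvgu.
exists s; split=> //.
- apply: (@squeeze_cvge _ _ _ _ (cst 0%E) _ (fun n => (C / K n * fine (mu D))%:E)).
  + apply: nearW => n; rewrite integral_ge0//=.
    exact: (bnd (fun t => u t - s n t) _ (us n)).
  + exact: cvg_cst.
  + apply: cvg_EFin; first exact: nearW.
    rewrite -(mul0r (fine (mu D))); apply: cvgM; [exact: hKC|exact: cvg_cst].
- apply/cvgrPdist_le => eps eps0; have /cvgrPdist_le/(_ _ eps0) := hKC (fine (mu D) * C).
  apply: filterS => n; rewrite sub0r normrN => H.
  apply: le_trans (le_trans (ler_norm _) H).
  have [L PL] := fP n.
  rewrite (fin_meas_simple_integral mD Dfin _ PL).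
  have A1 := @aint n r1 _ L (P n) fst mr1 r1M PL (fun t => erefl).
  have A2 := @aint n r2 _ L (P n) snd mr2 r2M PL (fun t => erefl).
  have -> : \sum_(q <- L) fmu D (P n @^-1` [set q]) *: c n q =
      (\sum_(z <- L) fmu D (P n @^-1` [set z]) * a n z.1) *: v1 +
      (\sum_(z <- L) fmu D (P n @^-1` [set z]) * a n z.2) *: v2.
    by rewrite !scaler_suml -big_split; apply: eq_bigr => z _; rewrite /c /=; module R X.
  move: A1 A2; set S1 := \sum_(z <- L) _; set S2 := \sum_(z <- L) _.
  set I1 := \int[mu]_(t in D) _; set I2 := \int[mu]_(t in D) _ => A1 A2.
  rewrite (_ : I1 *: v1 + I2 *: v2 - (S1 *: v1 + S2 *: v2) = (I1 - S1) *: v1 + (I2 - S2) *: v2); last by module R X.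
  apply: le_trans (ler_normD _ _) _; rewrite !normrZ /C mulrDr mulrDl.
  rewrite ![fine (mu D) * _ / _]mulrAC distrC (distrC I2).
  by apply: lerD; apply: ler_wpM2r.
Qed.

End Combination.

End BochnerIntegral.

(** * Increments of a function with a weak derivative *)

Section WeakDerivative.
Variables (R : realType) (X : completeNormedModType R).
Notation mu := (@lebesgue_measure R).

(** Let eta be the integral of phi' w; then -eta is the integral of phi g. [E1] compares eta with
    w(a) - w(b), [E2] compares -eta with Phi y for Phi the integral of phi, and [E3] compares Phi
    with b - a. *)
Lemma W11_increment_dist (T a b : R) (w g : R -> X) (y : X) (M : R -> R) :
  W11 `]0, T[ w g -> {within `[0, +oo[, continuous w} -> 0 < a -> a < b -> b < T ->
  measurable_fun (`]0, T[%classic : set R) M -> (forall t, 0 < t < T -> 0 <= M t) ->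
  {ae mu, forall t, 0 < t < T -> `|g t - y| <= M t} ->
  (`|w b - w a - (b - a) *: y|%:E <= \int[mu]_(t in `]a, b[) (M t)%:E)%E.
Proof.
move=> [_ _ wg] /within_continuousP cw a0 ab bT mM M0 gM.
apply/lee_addgt0Pr => eps eps0.
pose eta0 := eps / 4.
have eta00 : 0 < eta0 by rewrite divr_gt0.
have a0y : `[0, +oo[%classic a by rewrite /= in_itv/= andbT ltW.
have b0y : `[0, +oo[%classic b by rewrite /= in_itv/= andbT ltW// (lt_trans a0).
have [da da0 Ha] := cw a a0y _ eta00.
have [db db0 Hb] := cw b b0y _ eta00.
(* The width of the ramps: within the continuity radii of [w] at a and b, at most half of b - a so
   that the plateau exists, and small enough for e |y| <= eta0. *)
pose e := Num.min (Num.min da db) (Num.min ((b - a) / 2) (eta0 / (`|y| + 1))).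
have y1 : 0 < `|y| + 1 by rewrite ltr_wpDl.
have e0 : 0 < e.
  by rewrite !lt_min da0 db0 divr_gt0 ?subr_gt0//= divr_gt0.
have eda : e <= da by rewrite /e !ge_min lexx.
have edb : e <= db by rewrite /e !ge_min lexx !orbT.
have eab : e <= (b - a) / 2 by rewrite /e !ge_min lexx !orbT.
have ey : e * `|y| <= eta0.
  apply: (@le_trans _ _ (eta0 / (`|y| + 1) * `|y|)).
    by apply: ler_wpM2r => //; rewrite /e !ge_min lexx !orbT.
  by rewrite mulrAC ler_pdivrMr// ler_pM2l//; lra.
have abe : a + e <= b - e by lra.
have ae0 : 0 <= a + e by lra.
have beT : b - e <= T by lra.
have norm_aux p : b - a - 2 * e <= p -> p <= b - a -> `|p - (b - a)| <= 2 * e.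
  by move=> ? ?; rewrite ler_norml; apply/andP; split; lra.
have eta_ey : 2 * eta0 + 2 * (e * `|y|) <= eps.
  by move: ey; rewrite /eta0; lra.
have near_a t : a < t < a + e -> `|t - a| < da.
  by move=> /andP[? ?]; rewrite gtr0_norm; lra.
have near_b t : b - e < t < b -> `|t - b| < db.
  by move=> /andP[? ?]; rewrite ltr0_norm; lra.
have [phi [r1 [r2 [tphi dphi [C1 C2 r10 r20 [C rC]] [sr1 sr2 I1 I2] [cphi phi01 sphi phi1]]]]] :=
  plateau_function e0 a0 abe bT.
have [eta [H1 H2]] := wg phi tphi.
pose D := (`]0, T[%classic : set R).
have mD : measurable D by exact: measurable_itv.
have fD : (mu D < +oo)%E by exact: itv_measure_lty.
have mr1 : measurable_fun setT r1.
  by apply: continuous_measurable_fun; exact: Cn_continuous (C1 0%N).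
have mr2 : measurable_fun setT r2.
  by apply: continuous_measurable_fun; exact: Cn_continuous (C2 0%N).
have mphi : measurable_fun setT phi by exact: continuous_measurable_fun.
have r1C t : `|r1 t| <= C by rewrite ger0_norm//; have [] := rC t.
have r2C t : `|r2 t| <= C by rewrite ger0_norm//; have [] := rC t.
have phi1' t : `|phi t| <= 1 by have /andP[p0 p1] := phi01 t; rewrite ger0_norm.
have ir1 : mu.-integrable D (EFin \o r1).
  by apply: (bounded_integrable (C := C)) => //; exact: measurable_funTS.
have ir2 : mu.-integrable D (EFin \o r2).
  by apply: (bounded_integrable (C := C)) => //; exact: measurable_funTS.
have iphi : mu.-integrable D (EFin \o phi).
  by apply: (bounded_integrable (C := 1)) => //; exact: measurable_funTS.
have K1 := has_bochner_integral_combination (w a) (- w b) mD fD mr1 mr2 r1C r2C.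
have zM (t : R) : `|(fun=> 0 : R) t| <= 1 by rewrite normr0.
have mz : measurable_fun (setT : set R) (fun=> 0 : R) by exact: measurable_cst.
have K2 := has_bochner_integral_combination y 0 mD fD mphi mz phi1' zM.
have Dab t : D t -> 0 < t < T by rewrite /D /= in_itv.
(* [r1] is supported where w is within eta0 of w(a), [r2] where it is within eta0 of w(b), and each
   has mass 1. *)
have E1 : `|eta - (w a - w b)| <= 2 * eta0.
  have -> : w a - w b = (\int[mu]_(t in D) r1 t) *: w a + (\int[mu]_(t in D) r2 t) *: - w b.
    by rewrite I1 I2 !scale1r.
  rewrite -lee_fin.
  apply: le_trans (has_bochner_integral_dist (M := fun t => (r1 t + r2 t) * eta0) mD fD H1 K1 _ _ _) _.
  - by apply: measurable_funM => //; apply: measurable_funD; exact: measurable_funTS.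
  - by move=> t _; rewrite (mulr_ge0 _ (ltW eta00))// addr_ge0.
  - apply: (@filterE _ _ (ae_filter_ringOfSetsType mu)) => t /Dab/andP[t0 tT].
    have t0y : `[0, +oo[%classic t by rewrite /= in_itv/= andbT ltW.
    rewrite dphi (_ : (r1 t - r2 t) *: w t - (r1 t *: w a + r2 t *: - w b) =
      r1 t *: (w t - w a) - r2 t *: (w t - w b)); last by module R X.
    apply: le_trans (ler_normB _ _) _; rewrite !normrZ mulrDl !ger0_norm//.
    apply: lerD.
      have [->|/sr1/near_a ta] := eqVneq (r1 t) 0; first by rewrite !mul0r.
      apply: ler_wpM2l => //; exact: Ha.
    have [->|/sr2/near_b tb] := eqVneq (r2 t) 0; first by rewrite !mul0r.
    apply: ler_wpM2l => //; exact: Hb.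
  - have ir12 : mu.-integrable D (EFin \o (fun t => (r1 t + r2 t) * eta0)).
      apply: (bounded_integrable (C := (C + C) * eta0)) => //.
        by apply: measurable_funM => //; apply: measurable_funD; exact: measurable_funTS.
      move=> t _; rewrite normrM (gtr0_norm eta00); apply: (ler_wpM2r (ltW eta00)).
      by apply: le_trans (ler_normD _ _) _; exact: lerD.
    have fn : (\int[mu]_(t in D) ((r1 t + r2 t) * eta0)%:E)%E \is a fin_num.
      exact: integrable_fin_num.
    rewrite -(fineK fn) lee_fin -/(Rintegral mu D (fun t => (r1 t + r2 t) * eta0)).
    rewrite RintegralZr//; first by rewrite RintegralD// I1 I2.
    rewrite (_ : _ \o _ = (EFin \o r1) \+ (EFin \o r2))%E//.
    exact: integrableD.
pose Phi := \int[mu]_(t in D) phi t.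
(* phi y is integrated as the combination phi y + 0 0. Since phi <= 1 vanishes outside (a,b), [M]
   restricted to (a,b) is a majorant. *)
have E2 : (`|- eta - Phi *: y|%:E <= \int[mu]_(t in `]a, b[) (M t)%:E)%E.
  rewrite (_ : Phi *: y = Phi *: y + (\int[mu]_(t in D) 0) *: (0 : X)); last by rewrite scaler0 addr0.
  apply: le_trans (has_bochner_integral_dist (M := M \_ `]a, b[) mD fD H2 K2 _ _ _) _.
  - rewrite -measurable_restrict//.
    by apply: measurable_funS mM => // t [].
  - by move=> t /Dab Dt; rewrite patchE; case: ifP => // _; exact: M0.
  - move: gM; apply: ae_filterS => t H /Dab Dt.
    rewrite (_ : phi t *: g t - (phi t *: y + 0 *: 0) = phi t *: (g t - y)); last by module R X.
    have /andP[p0 p1] := phi01 t.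
    rewrite normrZ ger0_norm// patchE; case: ifPn => [_|nt].
      apply: le_trans (H Dt); rewrite -[leRHS]mul1r; exact: ler_wpM2r.
    have [->|/sphi st] := eqVneq (phi t) 0; first by rewrite mul0r.
    by case/negP: nt; rewrite inE/= in_itv.
  - rewrite (_ : (fun t => _) = (EFin \o M) \_ `]a, b[); last first.
      by apply/funext => t; rewrite !patchE; case: ifP.
    rewrite -integral_mkcondr.
    rewrite (_ : D `&` _ = `]a, b[%classic)//; apply/seteqP; split=> [t []//|t tab]; split=> //.
    move: tab; rewrite /D /= !in_itv/= => /andP[at_ tb].
    by rewrite (lt_trans a0)//= (lt_trans tb).
have mab (c d : R) : c <= d -> \int[mu]_(t in `]c, d[) (1 : R) = d - c.
  move=> cd; rewrite Rintegral_cst// mul1r /= lebesgue_measure_itv/= lte_fin.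
  by case: ifPn => [_//|]; rewrite -leNgt => dc; apply/eqP; rewrite eq_sym subr_eq0 eq_le cd dc.
(* phi lies between the indicators of [a + e, b - e) and of (a,b). *)
have E3 : `|Phi - (b - a)| <= 2 * e.
  have i1 (c d : R) : mu.-integrable `]c, d[ (EFin \o (fun=> 1 : R)).
    exact: itv_integrable_cst.
  have subD (c d : R) : 0 <= c -> d <= T -> (`]c, d[%classic : set R) `<=` D.
    move=> c0 dT t; rewrite /D /= !in_itv/= => /andP[ct td].
    by rewrite (le_lt_trans c0 ct) (lt_le_trans td).
  have P1 : Phi <= b - a.
    have <- : \int[mu]_(t in `]a, b[) (1 : R) = b - a by apply: mab; exact: ltW.
    have -> : Phi = \int[mu]_(t in `]a, b[) phi t.
      rewrite /Phi Rintegral_mkcond [RHS]Rintegral_mkcond; congr Rintegral.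
      apply/funext => t; rewrite !patchE.
      have [tab|] := boolP (t \in `]a, b[%classic).
        by rewrite mem_set//; apply: (@subD a b); [exact: ltW|exact: ltW|exact/set_mem].
      move=> nt; case: ifP => // _; apply/eqP; apply: contraNT nt => /sphi st.
      by rewrite inE/= in_itv.
    apply: le_Rintegral => //.
      by apply: integrableS iphi => //; apply: subD; exact: ltW.
    by move=> t _; have /andP[] := phi01 t.
  have P2 : b - a - 2 * e <= Phi.
    rewrite (_ : b - a - 2 * e = (b - e) - (a + e)); last by ring.
    rewrite -mab//.
    have sub : (`]a + e, b - e[%classic : set R) `<=` D by exact: subD.
    apply: le_trans (ge0_le_Rintegral_subset _ _ sub iphi _) => //; last first.
      by move=> t _; have /andP[] := phi01 t.
    apply: le_Rintegral => //; first exact: integrableS iphi.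
    by move=> t; rewrite /= in_itv/= => /andP[t1 t2]; rewrite phi1// !ltW.
  exact: norm_aux.
apply: (@le_trans _ _ ((`|- eta - Phi *: y| + (2 * eta0 + 2 * (e * `|y|)))%:E)).
  rewrite lee_fin (_ : w b - w a - (b - a) *: y = (- eta - Phi *: y) + ((eta - (w a - w b)) + (Phi - (b - a)) *: y)); last by module R X.
  apply: le_trans (ler_normD _ _) _; rewrite lerD2l; apply: le_trans (ler_normD _ _) _.
  by apply: lerD => //; rewrite normrZ mulrA; apply: ler_wpM2r.
rewrite EFinD; apply: leeD => //; by rewrite lee_fin.
Qed.

End WeakDerivative.

Section TraceUpper.
Variables (R : realType) (X : completeNormedModType R) (E : banachFunctionSpace R).
Notation mu := (@lebesgue_measure R).
Notation pos := (`]0, +oo[%classic : set R).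

Lemma norm_tr_kquot (A : set (X * X)) (x : X) (tau : R) :
  op_dom A !=set0 -> hardy_bounded E -> 0 < tau ->
  (norm_tr E (op_couple A) tau x < +oo)%E -> bfs_car E (kquot A x \_ `]0, tau[).
Proof.
move=> A0 hE tau0 /ereal_inf_lt[_ [[w g] /= [[cw wg] w0] <-] /bfs_enormD_lty[]].
move=> /bfs_enorm_ltyP[g1 Eg1 H1] /bfs_enorm_ltyP[g2 Eg2 H2].
have [h [mh Eh h0 gh]] := bfs_car_norm_version Eg1.
have iloc T := bfs_locally_integrable T Eh mh.
have dist t : 0 < t < tau -> `|x - w t| / t <= hardy h t.
  move=> /andP[t0 tt]; rewrite /hardy mulrC ler_pM2l ?invr_gt0// distrC.
  have fn : (\int[mu]_(s in `]0%R, t[) (h s)%:E)%E \is a fin_num.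
    by apply: integrable_fin_num => //; exact: iloc.
  (* Increments are controlled from points a > 0; below, a tends to 0 by continuity of [w], whose
     value at 0 is x. *)
  have inc a : 0 < a -> a < t -> `|w t - w a| <= \int[mu]_(s in `]0, t[) h s.
    move=> a0 at_; rewrite -lee_fin /Rintegral fineK//.
    rewrite (_ : w t - w a = w t - w a - (t - a) *: 0); last by rewrite scaler0 subr0.
    apply: le_trans (W11_increment_dist (M := h) (wg _ tau0) cw a0 at_ tt _ _ _) _.
    - by apply: measurable_funS mh; [exact: measurable_pos|exact: itv0_pos].
    - by [].
    - move: (ae_posI H1 gh); apply: ae_filterS => s Hs /andP[s0 st].
      have [+ <-] := Hs s0; rewrite subr0 cutoffE; last by rewrite /= in_itv/= s0.
      by rewrite /= lee_fin normr_id.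
    - apply: ge0_subset_integral => //.
      + apply/measurable_EFinP; apply: measurable_funS mh; first exact: measurable_pos.
        exact: itv0_pos.
      + by move=> s _; rewrite lee_fin.
      + by apply: subset_itvr; rewrite bnd_simp ltW.
  apply/ler_addgt0Pr => eps eps0.
  have /within_continuousP/(_ 0) := cw; rewrite /= in_itv/= lexx => /(_ isT _ eps0)[d d0 Hd].
  pose a := Num.min (d / 2) (t / 2).
  have a0 : 0 < a by rewrite lt_min !divr_gt0.
  have ad : a < d by rewrite gt_min; apply/orP; left; lra.
  have a_t : a < t by rewrite gt_min; apply/orP; right; lra.
  rewrite -w0 (_ : w t - w 0 = (w t - w a) + (w a - w 0)); last by module R X.
  apply: le_trans (ler_normD _ _) _; apply: lerD; first exact: inc.
  by apply: Hd; rewrite ?in_itv/= ?(ltW a0)// subr0 gtr0_norm.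
apply: bfs_car_le (bfs_carD (bfs_car_norm (bfs_car_hardy hE Eh)) (bfs_car_norm Eg2)).
  by apply: measurable_patch => //; exact: (measurable_kquot x A0 (@itv0_pos _ _)).
apply: ae_posS H2 => t t0 h2; rewrite patchE.
case: ifPn => [/set_mem St|_]; last by rewrite normr0.
rewrite ger0_norm ?kquot_ge0//=; apply: le_trans (ler_norm _).
apply: (@kquot_le_ext _ _ _ _ A0 _ (w t)) => //.
- rewrite lee_fin; apply: le_trans (ler_norm _).
  by apply: dist; move: St; rewrite /= in_itv.
- by apply: le_trans h2; rewrite cutoffE//=; exact: lee_abs.
Qed.

End TraceUpper.

(** * Almost everywhere differentiation *)

Section Differentiation.
Variables (R : realType) (X : completeNormedModType R).
Notation mu := (@lebesgue_measure R).

Lemma simple_fun_cst (y : X) : simple_fun (fun _ : R => y).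
Proof.
split; first by apply: (@sub_finite_set _ _ [set y]) => // _ [t _ <-].
move=> z; have [->|yz] := pselect (y = z).
  by rewrite (_ : _ @^-1` _ = setT)//; apply/seteqP; split.
rewrite (_ : _ @^-1` _ = set0); first exact: measurable0.
by rewrite -subset0 => t /= /yz.
Qed.

Lemma L1_dist (T : R) (g : R -> X) (y : X) : L1 `]0, T[ g -> exists e : R -> R,
  [/\ mu.-integrable `]0, T[ (EFin \o e), forall t, 0 <= e t &
      {ae mu, forall t, 0 < t < T -> `|g t - y| = e t}].
Proof.
move=> [mg ig]; pose D := `]0, T[%classic : set R.
have mD : measurable D by exact: measurable_itv.
have fD : (mu D < +oo)%E by exact: itv_measure_lty.
have [e0 [me0 e00 ge0]] := strongly_measurable_dist mD mg (simple_fun_cst 0).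
have [e [me e_ge0 ge]] := strongly_measurable_dist mD mg (simple_fun_cst y).
have ie0 : mu.-integrable D (EFin \o e0).
  apply/integrableP; split; first exact/measurable_EFinP.
  apply: le_lt_trans ig; rewrite le_eqVlt; apply/orP; left; apply/eqP.
  apply: ae_eq_lower_integral => [t _|t _|]; rewrite ?lee_fin//.
  move: ge0; apply: ae_filterS => t H Dt /=.
  by rewrite -(H Dt) subr0 normr_id.
have iy : mu.-integrable D (EFin \o (fun=> `|y|)).
  by apply: (bounded_integrable (C := `|y|)) => // t _; rewrite normr_id.
exists e; split=> //.
  apply/integrableP; split; first exact/measurable_EFinP.
  have : mu.-integrable D ((EFin \o e0) \+ (EFin \o (fun=> `|y|%R)))%E by exact: integrableD.
  move=> /integrableP[_].
  apply: le_lt_trans; apply: ae_le_lower_integral => [t _|t _|]; rewrite ?lee_fin//.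
  have := ae_filterI ge0 ge.
  apply: ae_filterS => t [H1 H2] Dt /=.
  rewrite -(H1 Dt) -(H2 Dt) lee_fin subr0 normr_id ger0_norm ?addr_ge0//.
  exact: ler_normB.
Qed.

Let q (w : R -> X) n t := n.+1%:R *: (w (n.+1%:R^-1 + t) - w t).

(** [W11_increment_dist] bounds |q - y| by a mean of |g - y| over a shrinking interval, which tends
    to |g(t) - y| almost everywhere. The exceptional null set depends on [y]. *)
Let near_quotient (T : R) (w g : R -> X) (y : X) :
  W11 `]0, T[ w g -> {within `[0, +oo[, continuous w} ->
  {ae mu, forall t, 0 < t < T -> forall eps : R, 0 < eps ->
    \forall n \near \oo, `|q w n t - y| <= `|g t - y| + eps}.
Proof.
move=> wg cw; have [_ L1g _] := wg.
have [e [ie e0 ge]] := L1_dist y L1g.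
have /integrableP[/measurable_EFinP me _] := ie.
pose f := e \_ `]0, T[.
have fi : mu.-integrable setT (EFin \o f).
  rewrite (_ : EFin \o _ = (EFin \o e) \_ `]0, T[); last first.
    by apply/funext => t; rewrite /= /f !patchE; case: ifP.
  by rewrite -integrable_mkcond.
have fiD (D : set R) : measurable D -> mu.-integrable D (EFin \o f).
  by move=> mD; apply: integrableS fi.
pose F t := \int[mu]_(s in `]-oo, t]) f s.
have := FTC1Ny (fun r => fiD _ (measurable_itv `]-oo, r])) (open_integrable_locally openT fi).
move=> dF; have := ae_filterI dF ge.
apply: ae_filterS => t [[dFt dFE] get_] t0T eps eps0.
have Dt : (`]0, T[%classic : set R) t by rewrite /= in_itv.
have hn n : 0 < n.+1%:R^-1 :> R by rewrite invr_gt0.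
have c0 : (fun n : nat => n.+1%:R^-1 : R) @ \oo --> (0 : R) by exact: cvg_harmonic.
have := derivable_cvg_seq dFt c0 (fun n => lt0r_neq0 (hn n)).
rewrite dFE /f patchE mem_set// -(get_ t0T) => /cvgrPdist_le/(_ _ eps0).
have tT : 0 < T - t by have /andP[_ ?] := t0T; rewrite subr_gt0.
move: (near_infty_natSinv_lt (PosNum tT)) => /=.
apply: filterS2 => n nT Fn.
have bT : n.+1%:R^-1 + t < T by rewrite -ltrBrDr.
have tb : t < n.+1%:R^-1 + t by rewrite ltrDr.
have /andP[t0 _] := t0T.
have := W11_increment_dist (y := y) wg cw t0 tb bT me (fun s _ => e0 s).
have ge' : {ae mu, forall t, 0 < t < T -> `|g t - y| <= e t}.
  by move: ge; apply: ae_filterS => s H /H ->.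
move=> /(_ ge').
set b := _ + t.
have FE : F b - F t = \int[mu]_(s in `]t, b[) e s.
  rewrite /F Rintegral_itvB ?bnd_simp ?(ltW tb)//; last exact: fiD.
  rewrite -Rintegral_itv_bndo_bndc; last exact: fiD.
  apply: eq_Rintegral => s /set_mem/=; rewrite in_itv/= => /andP[ts sb].
  by rewrite /f patchE mem_set//= in_itv/= (lt_trans t0 ts) (lt_trans sb bT).
have fn : (\int[mu]_(s in `]t, b[) (e s)%:E)%E \is a fin_num.
  apply: integrable_fin_num => //; apply: integrableS ie => // s.
  by rewrite /= !in_itv/= => /andP[ts sb]; rewrite (lt_trans t0 ts) (lt_trans sb bT).
rewrite -(fineK fn) lee_fin -/(Rintegral mu `]t, b[ e) -FE => H.
have n0 : n.+1%:R != 0 :> R by rewrite pnatr_eq0.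
rewrite (_ : q w n t - y = n.+1%:R *: (w b - w t - (b - t) *: y)); last first.
  by rewrite /q -/b [b - t]addrK [RHS]scalerBr scalerA mulfV// scale1r.
rewrite normrZ ger0_norm//; apply: (@le_trans _ _ (n.+1%:R * (F b - F t))).
  exact: ler_wpM2l.
move: Fn; rewrite invrK -/b distrC => /(le_trans (ler_norm _)).
by rewrite lerBlDl.
Qed.

Lemma W11_derivative_cvg (T : R) (w g : R -> X) :
  W11 `]0, T[ w g -> {within `[0, +oo[, continuous w} ->
  {ae mu, forall t, 0 < t < T ->
    (fun n => n.+1%:R *: (w (n.+1%:R^-1 + t) - w t)) @ \oo --> g t}.
Proof.
move=> wg cw; have [_ [[s [ss sg]] _] _] := wg.
have /choice[L sL] : forall n, exists L : seq X, fin_meas (s n) L.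
  by move=> n; exact: simple_fin_meas.
(* Here y runs through the values of the simple functions approximating [g], listed in [L n]:
   countably many null sets. *)
have H : {ae mu, forall t, forall n j : nat, 0 < t < T -> forall eps : R, 0 < eps ->
    \forall m \near \oo, `|q w m t - nth 0 (L n) j| <= `|g t - nth 0 (L n) j| + eps}.
  by apply: ae_foralln => n; apply: ae_foralln => j; exact: near_quotient wg cw.
have := ae_filterI H sg.
apply: ae_filterS => t [{}H {}sg] t0T.
apply/cvgrPdist_le => eps eps0.
(* |g(t) - s_n(t)| enters twice, through the triangle inequality and through [near_quotient], whose
   own error is the third part. *)
have e3 : 0 < eps / 3 by rewrite divr_gt0.
have Dt : (`]0, T[%classic : set R) t by rewrite /= in_itv.
have /cvgrPdist_le/(_ _ e3)[n _ /(_ n (leqnn n)) gs] := sg Dt.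
have [_ inL _] := sL n.
have := H n (index (s n t) (L n)) t0T _ e3; rewrite nth_index//.
apply: filterS => m Hm.
rewrite -[m.+1%:R *: _]/(q w m t).
rewrite (_ : g t - q w m t = (g t - s n t) - (q w m t - s n t)); last by module R X.
by apply: le_trans (ler_normB _ _) _; move: gs Hm; rewrite /=; lra.
Qed.

End Differentiation.

Section AlmostEverywhere.
Variables (R : realType) (X : completeNormedModType R).
Notation mu := (@lebesgue_measure R).
Implicit Types (D : set R) (u v w g : R -> X).

Lemma L1_ae D u v : {ae mu, forall t, D t -> u t = v t} -> L1 D u -> L1 D v.
Proof.
move=> uv [[s [ss su]] ui]; split.
  exists s; split=> //; have := ae_filterI uv su.
  by apply: ae_filterS => t [H1 H2] Dt; rewrite -(H1 Dt); exact: H2.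
apply: le_lt_trans ui; rewrite le_eqVlt; apply/orP; left; apply/eqP.
apply: ae_eq_lower_integral => [t _|t _|]; rewrite ?lee_fin//.
by move: uv; apply: ae_filterS => t H /H ->.
Qed.

Lemma has_bochner_integral_ae D u v y : {ae mu, forall t, D t -> u t = v t} ->
  has_bochner_integral D u y -> has_bochner_integral D v y.
Proof.
move=> uv [Lu [s [ss us sy]]]; split; first exact: L1_ae Lu.
exists s; split=> //.
rewrite (_ : (fun n => _) = (fun n => \int[mu]_(t in D) `|u t - s n t|%:E)%E)//.
apply/funext => n; apply: ae_eq_lower_integral => [t _|t _|]; rewrite ?lee_fin//.
by move: uv; apply: ae_filterS => t H /H ->.
Qed.

Lemma W11_ae D w u v : {ae mu, forall t, D t -> u t = v t} -> W11 D w u -> W11 D w v.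
Proof.
move=> uv [Lw Lu wu]; split=> //; first exact: L1_ae Lu.
move=> phi /wu[y [H1 H2]]; exists y; split=> //; apply: has_bochner_integral_ae H2.
by move: uv; apply: ae_filterS => t H /H ->.
Qed.

End AlmostEverywhere.

Section TraceLower.
Variables (R : realType) (X : completeNormedModType R) (E : banachFunctionSpace R).
Variables (A : set (X * X)) (omega tau : R) (x : X).
Hypotheses (w0 : 0 <= omega) (mA : m_accretive omega A) (A0 : op_dom A !=set0).
Hypotheses (tau0 : 0 < tau) (tauw : tau * omega < 1).
Hypothesis Ek : bfs_car E (kquot A x \_ `]0, tau[).
Notation mu := (@lebesgue_measure R).
Notation S := (`]0, tau[%classic : set R).

Let c := (1 - tau * omega)^-1.
Let C := 2 * c ^+ 2.
Let C0 : 0 <= C. Proof. by rewrite mulr_ge0// sqr_ge0. Qed.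
Let u t := resolvent A (Num.min t tau) x.

Let u_dist a b : 0 <= a -> a < b ->
  `|u b - u a| <= C * (Num.min b tau - Num.min a tau) * kquot A x (Num.min b tau).
Proof.
move=> a0 ab; have btau : Num.min b tau <= tau by rewrite ge_min lexx orbT.
have bw : Num.min b tau * omega <= tau * omega by rewrite ler_wpM2r.
apply: (resolvent_diff_kquot x w0 mA).
- by rewrite le_min a0 ltW.
- by rewrite le_min !ge_min (ltW ab) lexx orbT.
- by rewrite lt_min (le_lt_trans a0 ab).
- exact: le_lt_trans tauw.
- by rewrite /c ler_pdivlMl ?subr_gt0// mulr1; lra.
Qed.

Let kS := kquot A x \_ S.

Let kS0 t : 0 < t -> 0 <= kS t.
Proof. by move=> t0; rewrite /kS patchE; case: ifP => // _; exact: kquot_ge0. Qed.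

Let ikS T : mu.-integrable `]0, T[ (EFin \o kS).
Proof.
apply: bfs_locally_integrable Ek _; apply: measurable_patch => //.
exact: (measurable_kquot x A0 (@itv0_pos _ _)).
Qed.

Let u_abs_cont T : abs_cont `[0, T[ u.
Proof.
apply: (@abs_cont_integral _ _ _ kS C) => // [t /andP[t0 _]|a b a0 ab bT]; first exact: kS0.
apply: le_trans (u_dist a0 ab) _; rewrite -mulrA; apply: (ler_wpM2l C0).
have kSI r s : 0 <= r -> mu.-integrable `]r, s[ (EFin \o kS).
  move=> r0; apply: integrableS (ikS s) => //.
  by apply: subset_itvr; rewrite bnd_simp.
set b' := Num.min b tau; set a' := Num.min a tau.
have a'0 : 0 <= a' by rewrite le_min a0 ltW.
have a'a : a' <= tau by rewrite ge_min lexx orbT.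
have b'b : b' <= b by rewrite ge_min lexx.
have b'tau : b' <= tau by rewrite ge_min lexx orbT.
(* When both points are past tau the curve is constant and the factor b' - a' is nonpositive;
   otherwise a' = a. *)
have [a'b'|b'a'] := ltP a' b'; last first.
  apply: (@le_trans _ _ 0).
    rewrite mulr_le0_ge0 ?subr_le0// kquot_ge0// lt_min tau0 andbT.
    exact: le_lt_trans ab.
  by apply: Rintegral_ge0 => s; rewrite /= in_itv/= => /andP[/(le_lt_trans a0) s0 _]; exact: kS0.
have aa' : a <= a'.
  rewrite le_min lexx/= leNgt; apply/negP => taua; move: a'b'.
  by rewrite /a' min_r ?(ltW taua)// ltNge b'tau.
apply: (@le_trans _ _ (\int[mu]_(s in `]a', b'[) kS s)); last first.
  apply: ge0_le_Rintegral_subset => //.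
  - apply: subset_itv; by rewrite bnd_simp.
  - exact: kSI.
  - by move=> s; rewrite /= in_itv/= => /andP[/(le_lt_trans a0) s0 _]; exact: kS0.
have muab : fine (mu (`]a', b'[%classic : set R)) = b' - a'.
  by rewrite /= lebesgue_measure_itv/= lte_fin a'b'.
rewrite mulrC -muab -Rintegral_cst//; apply: le_Rintegral => //.
- exact: itv_integrable_cst.
- exact: kSI.
move=> s; rewrite /= in_itv/= => /andP[as_ sb].
have s0 : 0 < s by exact: le_lt_trans as_.
rewrite /kS patchE mem_set/= ?in_itv/= ?s0 ?(lt_le_trans sb)//.
by apply: kquot_nincr => //; exact: ltW.
Qed.

(** The Radon-Nikodym property yields one derivative for each T; the limit of the quotients agrees
    almost everywhere with all of them. *)
Let g t := lim ((fun n => n.+1%:R *: (u (n.+1%:R^-1 + t) - u t)) @ \oo).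

Lemma kquot_norm_tr : radon_nikodym_property X ->
  (norm_tr E (op_couple A) tau x < +oo)%E.
Proof.
move=> RN; have [cu _ Au] := kquot_norm_C A0 w0 mA tau0 tauw Ek.
have ug T : 0 < T -> W11 `]0, T[ u g /\ {ae mu, forall t, 0 < t < T ->
    (fun n => n.+1%:R *: (u (n.+1%:R^-1 + t) - u t)) @ \oo --> g t}.
  move=> T0; have [gT uT] := RN T u T0 (@u_abs_cont T).
  have lgT := W11_derivative_cvg uT cu.
  split; last first.
    move: lgT; apply: ae_filterS => t H /H {}H.
    by rewrite /g (cvg_lim _ H).
  apply: W11_ae uT; move: lgT.
  by apply: ae_filterS => t H /H {}H; rewrite /g (cvg_lim _ H).
have [_ gtau] := ug tau tau0.
have Eg : (bfs_enorm E (cutoff tau (fun t => `|g t|%:E)) < +oo)%E.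
  apply/bfs_enorm_ltyP; exists (C \*o kS); first exact: bfs_carZ.
  move: gtau; apply: ae_filterS => t H t0.
  have [St|nSt] := pselect (S t); last by rewrite cutoff0// abse0 lee_fin.
  have /andP[_ tt] : 0 < t < tau by move: St; rewrite /= in_itv.
  rewrite cutoffE//= lee_fin normr_id [X in _ <= X]ger0_norm; last by rewrite mulr_ge0// kS0.
  rewrite /kS patchE mem_set//.
  have {}H := H St.
  have nH : (fun n => `|n.+1%:R *: (u (n.+1%:R^-1 + t) - u t)|) @ \oo --> `|g t| by exact: cvg_norm.
  rewrite -(cvg_lim _ nH)//; apply: limr_le; first by apply/cvg_ex; exists `|g t|.
  have td : 0 < tau - t by rewrite subr_gt0.
  move: (near_infty_natSinv_lt (PosNum td)) => /=; apply: filterS => n nt.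
  have n0 : 0 < n.+1%:R^-1 :> R by rewrite invr_gt0.
  have tb : t < n.+1%:R^-1 + t by rewrite ltrDr.
  have btau : n.+1%:R^-1 + t < tau by rewrite -ltrBrDr.
  (* The bound has the K-quotient at t + 1/(n+1), which is at most its value at [t]. *)
  have := u_dist (ltW t0) tb; rewrite !min_l ?(ltW btau) ?(ltW tt)// addrK => Hu.
  rewrite normrZ ger0_norm// -ler_pdivlMl//; apply: le_trans Hu _.
  rewrite (mulrC C n.+1%:R^-1) -mulrA; apply: (ler_wpM2l (ltW n0)); apply: (ler_wpM2l C0).
  by apply: kquot_nincr => //; exact: ltW.
apply: le_lt_trans (lte_add_pinfty Eg Au).
apply: ereal_inf_lbound; exists (u, g) => //; split.
  by split=> // T T0; have [] := ug T T0.
by rewrite /= /u (min_l (ltW tau0)) resolvent0.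
Qed.

End TraceLower.

(** * Equality of the spaces *)

Section Cutoff.
Variables (R : realType) (F : R -> \bar R) (f : R -> R).
Hypothesis Ff : forall t, 0 < t -> F t = (f t)%:E.

Lemma cutoff_patch (tau t : R) : 0 < t -> cutoff tau F t = ((f \_ `]0, tau[) t)%:E.
Proof.
move=> t0; have [St|nSt] := pselect ((`]0, tau[%classic : set R) t).
  by rewrite cutoffE// patchE mem_set// Ff.
by rewrite cutoff0// patchE memNset.
Qed.

Lemma patch_pos t : 0 < t -> F t = ((f \_ `]0, +oo[) t)%:E.
Proof. by move=> t0; rewrite patchE mem_set ?Ff//= in_itv/= t0. Qed.

End Cutoff.

Theorem corollary4p3 (R : realType) (X : completeNormedModType R)
    (A : set (X * X)) (omega : R) (E : banachFunctionSpace R) (tau h : R)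
    (B := op_id_add h A) (NA := op_couple A) (NB := op_couple B)
    (D := edom (norm_Ktau E NA tau)) :
  0 <= omega -> m_accretive omega A -> hardy_bounded E ->
  0 < tau -> 0 < h -> tau * omega < 1 -> h * omega < 1 ->
  (op_dom A `<=`
     [set x | bfs_mem E (cutoff tau
        (fun t => (`|x - resolvent A t x| / t)%:E))] /\
   [set x | bfs_mem E (cutoff tau
        (fun t => (`|x - resolvent A t x| / t)%:E))] = D /\
   [set x | bfs_mem E (fun t => (`|x - resolvent B t x| / t)%:E)] = D /\
   [set x | closure (op_dom A) x /\ bfs_mem E (cutoff tau
        (fun t => (`|x - semigroup A t x| / t)%:E))] = D /\
   [set x | closure (op_dom A) x /\ bfs_mem E (cutoff tau
        (fun t => (`|x - semigroup B t x| / t)%:E))] = D /\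
   [set x | bfs_mem E (cutoff tau (Kquot NA x))] = D /\
   [set x | bfs_mem E (cutoff tau (Kquot NB x))] = D /\
   edom (norm_Ktau E NB tau) = D /\
   [set x | bfs_mem E (Kquot NB x)] = D /\
   edom (norm_K E NB) = D /\
   [set x | fin_abs_cont tau (Var_resolvent A x) /\
            bfs_mem E (cutoff tau (Var_derivative A x))] = D /\
   [set x | (forall T, 0 < T -> fin_abs_cont T (Var_resolvent B x)) /\
            bfs_mem E (Var_derivative B x)] = D /\
   edom (norm_L0 E NA tau) = D /\
   edom (norm_C E NA tau) = D /\
   edom (norm_L0 E NB tau) = D /\
   edom (norm_C E NB tau) = D /\
   D `<=` closure (op_dom A)) /\
  (radon_nikodym_property X -> D = edom (norm_tr E NA tau)).
Proof.
move=> w0 mA hE tau0 h0 tauw hw.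
(* The range condition provides a point of the domain, and thereby a finite K-functional. *)
have A0 : op_dom A !=set0 := op_dom_neq0 0 mA h0 hw.
have B0 : op_dom B !=set0 by rewrite op_dom_id_add.
have mB : m_accretive 0 B := m_accretive_id_add mA h0 hw.
have tau00 : tau * 0 < 1 by rewrite mulr0.
pose S := `]0, tau[%classic : set R.
(* Every set is reduced to this real-valued condition; [eqD] turns the equivalence into an equality
   with [D]. *)
pose P x := bfs_car E (kquot A x \_ S).
have mk (N : set (X * X)) x T : op_dom N !=set0 ->
    measurable_fun (`]0, +oo[%classic : set R) (kquot N x \_ [set` Interval (BRight 0) T]).
  by move=> N0; apply: measurable_patch => //; exact: (measurable_kquot x N0 (@itv0_pos _ _)).
have NKtau (N : set (X * X)) x : op_dom N !=set0 ->
    (norm_Ktau E (op_couple N) tau x < +oo)%E <-> bfs_car E (kquot N x \_ S).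
  move=> N0; apply: bfs_enorm_ltyE; last exact: mk.
  by apply: cutoff_patch => t t0; exact: kquotE.
have MKtau (N : set (X * X)) x : op_dom N !=set0 ->
    bfs_mem E (cutoff tau (Kquot (op_couple N) x)) <-> bfs_car E (kquot N x \_ S).
  by move=> N0; apply: bfs_memE; apply: cutoff_patch => t t0; exact: kquotE.
have BA x : bfs_car E (kquot B x \_ S) <-> P x by exact: bfs_car_id_add.
have BAoo x : bfs_car E (kquot B x \_ `]0, +oo[) <-> P x.
  by apply: iff_trans (BA x); exact: (bfs_car_id_add_infty _ hE mA h0 hw tau0).
have DE : D = [set x | P x].
  by apply/seteqP; split=> x /=; [move/(NKtau A x A0)|move=> Px; apply/(NKtau A x A0)].
have eqD (Y : set X) : (forall x, Y x <-> P x) -> Y = D.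
  by move=> YP; rewrite DE; apply/seteqP; split=> x /YP.
have cl x : P x -> closure (op_dom A) x.
  exact: (kquot_closure A0 w0 mA tau0 tauw).
have memS (f : R -> R) : bfs_mem E (cutoff tau (fun t => (f t)%:E)) <-> bfs_car E (f \_ S).
  by apply: bfs_memE; exact: cutoff_patch.
have mempos (f : R -> R) : bfs_mem E (fun t => (f t)%:E) <-> bfs_car E (f \_ `]0, +oo[).
  by apply: bfs_memE; exact: patch_pos.
have Sc t : S t -> t * omega < 1 /\ 1 <= (1 - tau * omega)^-1 * (1 - t * omega).
  rewrite /S /= in_itv/= => /andP[t0 tt].
  have tw : t * omega <= tau * omega by rewrite ler_wpM2r// ltW.
  split; first exact: le_lt_trans tauw.
  by rewrite ler_pdivlMl ?subr_gt0// mulr1; lra.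
have resA x : bfs_car E ((fun t => `|x - resolvent A t x| / t) \_ S) <-> P x.
  exact: (@bfs_car_resolvent _ _ _ _ omega (1 - tau * omega)^-1).
(* I + hA has type 0, so the constant 1 serves on the whole of (0,oo). *)
have resB x : bfs_car E ((fun t => `|x - resolvent B t x| / t) \_ `]0, +oo[) <-> P x.
  apply: iff_trans (BAoo x); apply: (@bfs_car_resolvent _ _ _ _ 0 1) => // t _.
  by rewrite mulr0 subr0 mulr1.
split; last first.
  move=> RN; apply/esym/eqD => x; split; first exact: norm_tr_kquot.
  by move=> Px; exact: (kquot_norm_tr w0 mA A0 tau0 tauw Px RN).
split; first by move=> x Ax; apply/memS/resA/bfs_car_op_dom.
split; first by apply: eqD => x; apply: iff_trans (resA x); exact: memS.
split; first by apply: eqD => x; apply: iff_trans (resB x); exact: mempos.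
split.
  apply: eqD => x; split=> [[clx]|Px].
    by move/memS/(bfs_car_semigroup w0 mA hE tau0 tauw clx).
  split; first exact: cl.
  apply/memS/(bfs_car_semigroup w0 mA hE tau0 tauw) => //.
  exact: cl.
split.
  have clB x : closure (op_dom A) x -> closure (op_dom B) x by rewrite op_dom_id_add.
  apply: eqD => x; split=> [[clx]|Px].
    by move/memS/(bfs_car_semigroup (lexx 0) mB hE tau0 tau00 (clB _ clx))/BA.
  split; first exact: cl.
  apply/memS/(bfs_car_semigroup (lexx 0) mB hE tau0 tau00).
    exact/clB/cl.
  exact/BA.
split; first by apply: eqD => x; exact: MKtau.
split; first by apply: eqD => x; apply: iff_trans (BA x); exact: MKtau.
split; first by apply: eqD => x; apply: iff_trans (BA x); exact: NKtau.
split.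
  apply: eqD => x; apply: iff_trans (BAoo x); apply: bfs_memE.
  by apply: patch_pos => t t0; exact: kquotE.
split.
  apply: eqD => x; apply: iff_trans (BAoo x); apply: bfs_enorm_ltyE; last exact: mk.
  by apply: patch_pos => t t0; exact: kquotE.
split.
  apply: eqD => x.
  (* The index predicate [Q] of the section is here the singleton of tau. *)
  have H : (forall T, T = tau -> fin_abs_cont T (Var_resolvent A x)) /\
      bfs_car E (derive1 (fine \o Var_resolvent A x : R -> R^o) \_ S) <-> P x.
    apply: (@resolvent_variation_kquot _ _ E A omega (1 - tau * omega)^-1) => //.
    - exact: measurable_itv.
    - exact: interval_is_interval.
    - exact: itv0_pos.
    - move=> t; rewrite /S /= in_itv/= => /andP[t0 tt].
      by exists ((t + tau) / 2); [rewrite /= in_itv/=; apply/andP; split|]; lra.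
    - move=> s t s0 st; rewrite /S /= !in_itv/= s0 => /andP[_]; exact: le_lt_trans.
    - by move=> _ ->; split=> // t t0 tt; rewrite /S /= in_itv/= t0.
    - by move=> t; rewrite /S /= in_itv/= => /andP[_ tt]; exists tau.
  apply: iff_trans H; split=> -[VAC Ev]; split.
  - by move=> _ ->.
  - exact: ((memS (derive1 (fine \o Var_resolvent A x : R -> R^o))).1 Ev).
  - exact: VAC.
  - exact: ((memS (derive1 (fine \o Var_resolvent A x : R -> R^o))).2 Ev).
split.
  apply: eqD => x; apply: iff_trans (BAoo x).
  have H : (forall T, 0 < T -> fin_abs_cont T (Var_resolvent B x)) /\
      bfs_car E (derive1 (fine \o Var_resolvent B x : R -> R^o) \_ `]0, +oo[) <->
      bfs_car E (kquot B x \_ `]0, +oo[).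
    apply: (@resolvent_variation_kquot _ _ E B 0 1) => //.
    - exact: interval_is_interval.
    - by move=> t; rewrite /= !in_itv/= !andbT => t0; exists (t + 1); rewrite /= ?in_itv/= ?andbT; lra.
    - by move=> s t s0 st _; rewrite /= in_itv/= s0.
    - by move=> t _; rewrite mulr0 subr0 mulr1.
    - by move=> T T0; split=> // t t0 _; rewrite /= in_itv/= t0.
    - by move=> t; rewrite /= in_itv/= andbT => t0; exists (t + 1); lra.
  apply: iff_trans H; split=> -[VAC Ev]; split=> //.
  - exact: ((mempos (derive1 (fine \o Var_resolvent B x : R -> R^o))).1 Ev).
  - exact: ((mempos (derive1 (fine \o Var_resolvent B x : R -> R^o))).2 Ev).
split; first by apply: eqD => x; exact: (norm_L0_iff E x A0 w0 mA tau0 tauw).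
split; first by apply: eqD => x; exact: (norm_C_iff E x A0 w0 mA tau0 tauw).
split; first by apply: eqD => x; apply: iff_trans (BA x); exact: (norm_L0_iff E x B0 (lexx 0) mB tau0 tau00).
split; first by apply: eqD => x; apply: iff_trans (BA x); exact: (norm_C_iff E x B0 (lexx 0) mB tau0 tau00).
by rewrite DE.
Qed.
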